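(* Let $\Theta$ be the threefield theta series attached to $L=\mathbb{Q}(\sqrt[4]{6},i)$ and its quadratic subfields $\mathbb{Q}(\sqrt{-6})$, $\mathbb{Q}(i)$, $\mathbb{Q}(\sqrt6)$, let $\rho\in\mathbb{Z}[[q]]$ be the power series such that $q\rho(q^{24})$ is the part of the $q$-series $\Theta$ with exponents congruent to $1$ modulo $24$, and write $$\rho(q)=\sum_{n\ge 0}r(n)q^n.$$ Then for every $n\ge 0$, $r(n)$ equals the number of partitions of $n$ into distinct $3$-colored odd parts and an even number of distinct $2$-colored even parts, minus the number of partitions of $n$ into distinct $3$-colored odd parts and an odd number of distinct $2$-colored even parts.
   Context: Colored partitions: each odd part carries one of $3$ colors and each even part one of $2$ colors. ''Distinct'' means that no (size, color) pair is repeated; thus each odd size may occur at most $3$ times and each even size at most $2$ times, in different colors. The number of odd parts is unrestricted (possibly zero), and zero even parts counts as an even number. Ray class groups: for a number field $K$ and modulus $\mathfrak{f}=\mathfrak{f}_0\mathfrak{f}_\infty$ ($\mathfrak{f}_0$ an integral ideal, $\mathfrak{f}_\infty$ a set of real embeddings), $Cl_K(\mathfrak{f})=I_\mathfrak{f}/P_\mathfrak{f}$, where $I_\mathfrak{f}$ is the group of fractional ideals coprime to $\mathfrak{f}_0$ and $P_\mathfrak{f}$ is the subgroup of principal fractional ideals $(\alpha/\beta)$ in $I_\mathfrak{f}$ with $\alpha,\beta\in\mathcal{O}_K$ coprime to $\mathfrak{f}_0$, $\alpha\equiv\beta \pmod{\mathfrak{f}_0}$, and $\alpha/\beta$ positive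 at all embeddings in $\mathfrak{f}_\infty$. For an abelian extension $L/K$ with conductor $\mathfrak{f}=\mathfrak{f}_{L/K}$, the Artin map induces $Cl_K(\mathfrak{f})/N_{L/K}(\mathfrak{f})\cong \mathrm{Gal}(L/K)$ for a certain subgroup $N_{L/K}(\mathfrak{f})$. For a character $\chi$ of $Cl_K(\mathfrak{f})$ the ray class character theta series is $$\Theta_{\mathfrak{f},\chi}=\sum_{\mathfrak{a}}\chi(\mathfrak{a})\,q^{N(\mathfrak{a})},$$ the sum being over nonzero integral ideals $\mathfrak{a}$ of $\mathcal{O}_K$ coprime to $\mathfrak{f}_0$, with $N(\mathfrak{a})$ the absolute norm. Threefield theta series (Cohen): let $L/\mathbb{Q}$ be Galois with $\mathrm{Gal}(L/\mathbb{Q})$ having cyclic center of index $4$. The fixed field $B$ of the center is biquadratic, with three quadratic subfields $K_1,K_2,K_3$, and each $L/K_i$ is abelian, with conductor $\mathfrak{f}_i$. When $[L:\mathbb{Q}]=8$, for each $i$ there are exactly two characters $\chi_{i,1},\chi_{i,2}$ of $Cl_{K_i}(\mathfrak{f}_i)/N_{L/K_i}(\mathfrak{f}_i)\cong \mathrm{Gal}(L/K_i)$ which are nontrivial on the center $\mathrm{Gal}(L/B)$. Cohen's theorem states that the six series $\Theta_{\mathfrak{f}_i,\chi_{i,j}}$ ($1\le i\le 3$, $1\le j\le 2$) are equal; their common value is the threefield theta series $\Theta$. For $L=\mathbb{Q}(\sqrt[4]{6},i)$ one has $B=\mathbb{Q}(\sqrt6,i)$, $K_1=\mathbb{Q}(\sqrt{-6})$,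 $K_2=\mathbb{Q}(i)$, $K_3=\mathbb{Q}(\sqrt6)$. *)

(* Defs.v *)
From HB Require Import structures.
From mathcomp Require Import all_boot all_order all_algebra all_fingroup.
From mathcomp Require Import all_solvable all_field.
From mathcomp Require Import finmap.
From mathcomp Require Import boolp classical_sets functions cardinality fsbigop.

Set Implicit Arguments.
Unset Strict Implicit.
Unset Printing Implicit Defensive.

Import Order.TTheory GRing.Theory Num.Theory.

Local Open Scope nat_scope.

(* A part of size k and color c is the pair (k, c), with colors 0, 1, 2 for odd
   k and 0, 1 for even k.  As the parts are distinct, a partition of n is a
   finite set of such pairs, and all its parts have size at most n. *)
Definition colored_partition (n : nat) (S : {set 'I_n.+1 * 'I_3}) : bool :=
  [forall x in S, (0 < x.1) && (odd x.1 || (x.2 < 2))]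
  && (\sum_(x in S) x.1 == n).

Definition nb_even_parts (n : nat) (S : {set 'I_n.+1 * 'I_3}) : nat :=
  #|[pred x in S | ~~ odd x.1]|.

Definition partitions_even (n : nat) : nat :=
  #|[pred S : {set 'I_n.+1 * 'I_3} |
      colored_partition S && ~~ odd (nb_even_parts S)]|.

Definition partitions_odd (n : nat) : nat :=
  #|[pred S : {set 'I_n.+1 * 'I_3} |
      colored_partition S && odd (nb_even_parts S)]|.

Local Open Scope ring_scope.
Local Open Scope classical_set_scope.

Section Ideals.
Variable L : splittingFieldType rat.
Implicit Types (K : {subfield L}) (a b p J : set L).

Definition ring_of_integers K : set L :=
  [set x | x \in K /\ integralOver (intr : int -> L) x].

Definition fractional_ideal K J : Prop :=
  [/\ J `<=` [set` K],
      exists2 x, J x & x != 0,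
      forall x y, J x -> J y -> J (x + y),
      forall c x, ring_of_integers K c -> J x -> J (c * x) &
      exists2 d, ring_of_integers K d /\ d != 0 &
        forall x, J x -> ring_of_integers K (d * x)].

Definition integral_ideal K a : Prop :=
  fractional_ideal K a /\ a `<=` ring_of_integers K.

Definition prime_ideal K p : Prop :=
  [/\ integral_ideal K p, ~ p 1 &
      forall x y, ring_of_integers K x -> ring_of_integers K y ->
        p (x * y) -> p x \/ p y].

Definition principal K (x : L) : set L :=
  [set c * x | c in ring_of_integers K].

Definition ideal_mul a b : set L :=
  [set x | exists n (u v : 'I_n -> L),
     [/\ forall k, a (u k), forall k, b (v k) & x = \sum_(k < n) u k * v k]].

Definition coprime_ideals a b : Prop :=
  exists x y, [/\ a x, b y & x + y = 1].

(* fset_set sends infinite sets to fset0, so this is 0 when the set of residue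
   classes is infinite; this does not happen for a nonzero ideal. *)
Definition absolute_norm K a : nat :=
  #|` fset_set [set [set y | a (y - x)] | x in ring_of_integers K]|%fset.

End Ideals.

Section ClassFieldTheory.
Variable L : splittingFieldType rat.
Implicit Types (K : {subfield L}) (J p P : set L).

Definition lies_over K P p : Prop :=
  prime_ideal {:L}%AS P /\ P `&` ring_of_integers K = p.

Definition unramified K p : Prop :=
  forall P, lies_over K P p -> ~ (p `<=` ideal_mul P P).

(* All primes P over p are used at once: the Frobenius does not depend on P
   when L/K is abelian. *)
Definition is_frobenius K p (s : gal_of {:L}) : Prop :=
  s \in 'Gal({:L} / K)%g /\
  forall P, lies_over K P p ->
    forall x, ring_of_integers {:L}%AS x -> P (s x - x ^+ absolute_norm K p).

Definition real_embedding K (t : {rmorphism subvs_of K -> algC}) : Prop :=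
  forall x, t x \is Num.real.

Definition ramified_embedding K (t : {rmorphism subvs_of K -> algC}) : Prop :=
  exists2 T : {rmorphism L -> algC},
    forall x : subvs_of K, T (vsval x) = t x &
    exists y, T y \isn't Num.real.

Record modulus K := Modulus {
  finite_part : set L;
  infinite_part : set {rmorphism subvs_of K -> algC};
  finite_partP : integral_ideal K finite_part;
  infinite_partP : infinite_part `<=` @real_embedding K
}.

Section Modulus.
Variables (K : {subfield L}) (f : modulus K).

Definition coprime_to_modulus : set (set L) :=
  [set a | integral_ideal K a /\ coprime_ideals a (finite_part f)].

(* Cl_K(f) = I_f / P_f, with I_f = ray_ideals, whose elements are the quotients
   of integral ideals coprime to f_0, and P_f = ray_principal. *)
Definition ray_ideals : set (set L) :=
  [set J | fractional_ideal K J /\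
     exists a b, [/\ coprime_to_modulus a, coprime_to_modulus b &
                     ideal_mul J b = a]].

Definition ray_principal : set (set L) :=
  [set J | exists x y,
     [/\ x != 0 /\ y != 0,
         coprime_to_modulus (principal K x),
         coprime_to_modulus (principal K y),
         ring_of_integers K x /\ ring_of_integers K y /\ finite_part f (x - y) &
         (forall t, infinite_part f t -> 0 < t (vsproj K (x / y))) /\
         J = principal K (x / y)]].

Definition is_artin_map (Phi : set L -> gal_of {:L}) : Prop :=
  (forall J J', ray_ideals J -> ray_ideals J' ->
     Phi (ideal_mul J J') = (Phi J * Phi J')%g) /\
  (forall p, prime_ideal K p -> coprime_to_modulus p -> is_frobenius K p (Phi p)).

(* f is divisible by every place of K ramified in L, and the Artin map factors
   through Cl_K(f) = I_f / P_f. *)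
Definition admissible : Prop :=
  [/\ forall p, prime_ideal K p -> coprime_to_modulus p -> unramified K p,
      forall t, real_embedding t -> ramified_embedding t -> infinite_part f t &
      forall Phi, is_artin_map Phi ->
        forall J, ray_principal J -> Phi J = 1%g].

(* A character of Cl_K(f) / N_{L/K}(f), where N_{L/K}(f) is the kernel of the
   Artin map, given as a function on I_f; its values outside I_f are
   irrelevant. *)
Definition class_character (Phi : set L -> gal_of {:L}) (chi : set L -> algC) :
    Prop :=
  (forall J J', ray_ideals J -> ray_ideals J' ->
     chi (ideal_mul J J') = chi J * chi J') /\
  (forall J, ray_ideals J -> ray_principal J \/ Phi J = 1%g -> chi J = 1).

(* the center of Gal(L/Q), that is, Gal(L/B) *)
Definition nontrivial_on_center (Phi : set L -> gal_of {:L})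
    (chi : set L -> algC) : Prop :=
  exists J, [/\ ray_ideals J, Phi J \in ('Z('Gal({:L} / 1%AS)))%g & chi J != 1].

(* the coefficient of q^n in Theta_{f,chi} *)
Definition theta_coef (chi : set L -> algC) (n : nat) : algC :=
  \sum_(a \in [set a | coprime_to_modulus a /\ absolute_norm K a = n]) chi a.

End Modulus.

Definition modulus_dvd K (f m : modulus K) : Prop :=
  finite_part m `<=` finite_part f /\ infinite_part f `<=` infinite_part m.

Definition is_conductor K (f : modulus K) : Prop :=
  admissible f /\ forall m : modulus K, admissible m -> modulus_dvd f m.

(* Theta is the coefficient sequence of Theta_{f,chi} for f the conductor of
   L/K and each character chi nontrivial on the center. *)
Definition is_theta_over K (Theta : nat -> algC) : Prop :=
  exists (f : modulus K) (Phi : set L -> gal_of {:L}),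
    [/\ is_conductor f, is_artin_map f Phi &
        forall chi, class_character f Phi chi ->
          nontrivial_on_center f Phi chi ->
          forall n, Theta n = theta_coef f chi n].

Definition is_threefield_theta K1 K2 K3 (Theta : nat -> algC) : Prop :=
  [/\ is_theta_over K1 Theta, is_theta_over K2 Theta & is_theta_over K3 Theta].

End ClassFieldTheory.

Definition qseries_part (d k : nat) (u : nat -> algC) : nat -> algC :=
  fun m => if (m == k %[mod d])%N then u m else 0.

(* the coefficient of q^m in q rho(q^24), where rho = sum_n r(n) q^n *)
Definition q_rho_q24 (r : nat -> algC) : nat -> algC :=
  fun m => if (0 < m)%N && (24 %| m.-1)%N then r (m.-1 %/ 24)%N else 0.

(* Main.v *)
Require Import Defs.
From HB Require Import structures.
From mathcomp Require Import all_boot all_order all_algebra all_fingroup.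
From mathcomp Require Import all_solvable all_field.
From mathcomp Require Import boolp classical_sets functions cardinality fsbigop.
From mathcomp Require Import zify ring lra.

Set Implicit Arguments.
Unset Strict Implicit.
Unset Printing Implicit Defensive.

Import Order.TTheory GRing.Theory Num.Theory.
Local Open Scope ring_scope.

(** Two theta series are compared coefficient by coefficient.

    On the side of partitions, the difference of the two numbers is the coefficient
    of q^n in the product of (1 + q^s)^3 over odd s and (1 - q^s)^2 over even s.
    This product splits into the product of (1 + q^s)^2 (s odd) and 1 - q^s (s even),
    which is the sum of q^(m^2) over all integers m, and the product of 1 - (-q)^s
    over all s, which by Euler's pentagonal number theorem is the sum of
    e(k) q^(k(3k - 1)/2), e(k) = (-1)^(k(k - 1)/2).  Both are instances of Jacobi's
    triple product.  So the difference is the sum of e(k) over the pairs (k, m) with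
    k(3k - 1)/2 + m^2 = n, that is (6k - 1)^2 + 24 m^2 = 24n + 1
    ([partitions_sum]).

    On the side of theta series, the field K = Q(theta), theta = sqrt(-6), is the
    convenient one of the three.  An integral ideal of K with norm congruent to 1
    modulo 24 is principal, with a unique generator 6k - 1 + 2m theta
    ([ideal_one_mod24]): the ideals in the other class have norms 2x^2 + 3y^2.
    A character of Gal(L/K) that is nontrivial on the center is the action on
    beta = (1 + i)a, a square root of 2 theta.  At a prime not above 2 or 3 the
    Frobenius element multiplies beta by the quadratic symbol of 2 theta, and on the
    ideal generated by x + 2m theta the resulting product of Legendre symbols is
    (6 / x), by nothing more than quadratic reciprocity over Z
    ([jac_norm_form], [artin_principal]).  Moreover (6 / (6k - 1)) = e(k)
    ([jac6_sign]), so the two sums agree term by term ([theta_coefE]).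

    The theta series is only summed over ideals coprime to the conductor, which is
    defined by minimality among the admissible moduli.  The same explicit formula
    shows that the Artin symbol of a principal ideal with generator congruent to 1
    modulo 24 is trivial, so the modulus 24 is admissible ([admissible24]); here one
    also needs that the primes above p > 3 are unramified in L
    ([unramified_above]).  Hence the conductor divides 24 and no ideal of norm
    24n + 1 is lost. *)

(** * Gaussian binomials and the triple product *)
Section QBinomial.
Variables (R : comNzRingType) (Q : R).

Fixpoint qbin n k : R :=
  match n, k with
  | _, 0%N => 1
  | 0%N, _.+1 => 0
  | n'.+1, k'.+1 => qbin n' k' + Q ^+ k'.+1 * qbin n' k'.+1
  end.

Definition qpoch n : R := \prod_(i < n) (1 - Q ^+ i.+1).

Lemma qbin0 n : qbin n 0 = 1. Proof. by case: n. Qed.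

Lemma qbinS n k : qbin n.+1 k.+1 = qbin n k + Q ^+ k.+1 * qbin n k.+1.
Proof. by []. Qed.

Lemma qbin_small n k : (n < k)%N -> qbin n k = 0.
Proof.
elim: n k => [|n IHn] [|k] // ltnk.
by rewrite qbinS !IHn ?mulr0 ?addr0 // ltnW.
Qed.

Lemma qbinnn n : qbin n n = 1.
Proof. by elim: n => // n IHn; rewrite qbinS IHn qbin_small // mulr0 addr0. Qed.

(** The mirror image of the recursion that defines [qbin].  The triple product
    grows at both ends, and each end consumes one of the two rules. *)
Lemma qbinS_sym n k : (k <= n)%N ->
  qbin n.+1 k.+1 = qbin n k.+1 + Q ^+ (n - k) * qbin n k.
Proof.
elim: n k => [|n IHn] k lekn.
  by case: k lekn => // _; rewrite /= !mulr0 mulr1 addrC.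
rewrite qbinS; case: k lekn => [|k] lekn.
  have E1 := IHn 0%N isT; have E2 := qbinS n 0; rewrite qbin0 subn0 mulr1 in E1.
  rewrite qbin0 expr1 in E2.
  by rewrite !qbin0 subn0 mulr1 expr1 {1}E1 E2 exprS; ring.
move: lekn; rewrite leq_eqVlt => /orP[/eqP[->]|ltkn].
  rewrite subnn qbinnn !(@qbin_small n.+1) // mulr0 add0r addr0.
  by rewrite mul1r.
have e1 : (n - k = (n - k.+1).+1)%N by lia.
have E1 := IHn k (ltnW ltkn); have E2 := IHn k.+1 ltkn.
have D1 := qbinS n k; have D2 := qbinS n k.+1.
rewrite subSS {1}E1 {1}E2 D1 D2 e1 !exprS; ring.
Qed.

Lemma qpochS n : qpoch n.+1 = qpoch n * (1 - Q ^+ n.+1).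
Proof. by rewrite /qpoch big_ord_recr. Qed.

Lemma qbin_fact k l : qbin (k + l) k * (qpoch k * qpoch l) = qpoch (k + l).
Proof.
elim: k l => [|k IHk] l; first by rewrite qbin0 /qpoch big_ord0 !mul1r add0n.
elim: l => [|l IHl]; first by rewrite addn0 qbinnn /qpoch big_ord0 mulr1 mul1r.
have e : (k.+1 + l = k + l.+1)%N by lia.
have := IHk l.+1; rewrite -e => Ek.
rewrite addnS qbinS qpochS [qpoch (k.+1 + l).+1]qpochS.
transitivity (qbin (k.+1 + l) k * (qpoch k * qpoch l.+1) * (1 - Q ^+ k.+1)
  + Q ^+ k.+1 * (1 - Q ^+ l.+1) * (qbin (k.+1 + l) k.+1 * (qpoch k.+1 * qpoch l))).
  rewrite !qpochS; ring.
rewrite Ek IHl -addnS exprD; ring.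
Qed.

End QBinomial.

Section JacobiTripleProduct.
Variables (R : comNzRingType) (u v : R).
Let Q := u * v.

Definition tri_up (j : int) : nat := (`|(j * (j + 1))%R| %/ 2)%N.
Definition tri_dn (j : int) : nat := (`|(j * (j - 1))%R| %/ 2)%N.

Lemma even_mulS (j : int) : exists h : int, j * (j + 1) = h * 2.
Proof.
have [k [ek|ek]] : exists k : int, j = k * 2 \/ j = k * 2 + 1.
- by exists (j %/ 2)%Z; lia.
- by exists (k * (j + 1)); rewrite ek; ring.
- by exists (j * (k + 1)); rewrite ek; ring.
Qed.

Lemma tri_upE j : (tri_up j)%:Z *+ 2 = j * (j + 1).
Proof.
have [h eh] := even_mulS j; have : 0 <= j * (j + 1) by nia.
by rewrite /tri_up eh; lia.
Qed.

Lemma tri_dnE j : (tri_dn j)%:Z *+ 2 = j * (j - 1).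
Proof.
have [h eh] := even_mulS (j - 1); rewrite subrK mulrC in eh.
have : 0 <= j * (j - 1) by nia.
by rewrite /tri_dn eh; lia.
Qed.

(** With u = z q and v = q / z this is the Laurent term z^j q^(j^2); two
    variables u and v avoid negative powers of z. *)
Definition jterm (j : int) : R := u ^+ tri_up j * v ^+ tri_dn j.

Lemma jterm_up (N i : nat) (j : int) : j + i%:Z = N%:Z ->
  Q ^+ i * jterm (j + 1) = u * Q ^+ N * jterm j.
Proof.
move=> eN; rewrite /jterm /Q !exprMn.
have E1 := tri_upE j; have E2 := tri_upE (j + 1).
have E3 := tri_dnE j; have E4 := tri_dnE (j + 1).
transitivity (u ^+ (i + tri_up (j + 1)) * v ^+ (i + tri_dn (j + 1))).
  rewrite !exprD; ring.
have -> : (i + tri_up (j + 1) = 1 + N + tri_up j)%N by nia.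
have -> : (i + tri_dn (j + 1) = N + tri_dn j)%N by nia.
rewrite !exprD expr1; ring.
Qed.

Lemma jterm_dn (M k : nat) (j : int) : j + M%:Z = k%:Z ->
  Q ^+ k * jterm (j - 1) = v * Q ^+ M * jterm j.
Proof.
move=> eN; rewrite /jterm /Q !exprMn.
have E1 := tri_upE j; have E2 := tri_upE (j - 1).
have E3 := tri_dnE j; have E4 := tri_dnE (j - 1).
transitivity (u ^+ (k + tri_up (j - 1)) * v ^+ (k + tri_dn (j - 1))).
  rewrite !exprD; ring.
have -> : (k + tri_up (j - 1) = M + tri_up j)%N by nia.
have -> : (k + tri_dn (j - 1) = 1 + M + tri_dn j)%N by nia.
rewrite !exprD expr1; ring.
Qed.

Definition jsum N M : R :=
  \sum_(k < (N + M).+1) qbin Q (N + M) k * jterm (k%:Z - M%:Z).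

Lemma jsum00 : jsum 0 0 = 1.
Proof. by rewrite /jsum big_ord1 /= mul1r /jterm /= mulr1. Qed.

Lemma jsumSr N M : jsum N M.+1 = (1 + v * Q ^+ M) * jsum N M.
Proof.
rewrite /jsum addnS; set n := (N + M)%N.
rewrite big_ord_recl qbin0 mul1r.
under eq_bigr => k _ do rewrite lift0 qbinS mulrDl.
rewrite big_split /= mulrDl mul1r addrCA; congr (_ + _).
  by apply: eq_bigr => k _; congr (_ * jterm _); lia.
rewrite mulr_sumr big_ord_recr /= qbin_small // mulr0 mul0r addr0.
rewrite big_ord_recl qbin0 mul1r -(@jterm_dn M 0) /= ?mul1r; last by lia.
congr (_ + _); first by congr jterm; lia.
apply: eq_bigr => k _; rewrite /bump /= add1n [RHS]mulrCA -(@jterm_dn M k.+1); last by lia.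
rewrite -mulrA mulrCA; congr (_ * (_ * jterm _)); lia.
Qed.

Lemma jsumSl N M : jsum N.+1 M = (1 + u * Q ^+ N) * jsum N M.
Proof.
rewrite /jsum addSn; set n := (N + M)%N.
rewrite big_ord_recl qbin0 mul1r.
under eq_bigr => k _ do rewrite lift0 qbinS_sym 1?leq_ord // mulrDl.
rewrite big_split /= mulrDl mul1r addrA; congr (_ + _).
  rewrite [RHS]big_ord_recl qbin0 mul1r big_ord_recr /= qbin_small // mul0r addr0.
  by congr (_ + _); apply: eq_bigr => k _; rewrite lift0.
rewrite mulr_sumr; apply: eq_bigr => k _.
rewrite [RHS]mulrCA -(@jterm_up N (n - k)); last by have := ltn_ord k; lia.
rewrite mulrAC mulrC; congr (_ * (_ * jterm _)). lia.
Qed.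

(** A polynomial form of the triple product: one factor at a time, the Pascal
    rules match the relations between consecutive terms [jterm]. *)
Lemma finite_jacobi N :
  \prod_(k < N) ((1 + u * Q ^+ k) * (1 + v * Q ^+ k)) = jsum N N.
Proof.
have E0 M : jsum 0 M = \prod_(k < M) (1 + v * Q ^+ k).
  elim: M => [|M IH]; first by rewrite jsum00 big_ord0.
  by rewrite jsumSr IH big_ord_recr mulrC.
have E M : jsum M N = \prod_(k < M) (1 + u * Q ^+ k) * jsum 0 N.
  elim: M => [|M IH]; first by rewrite big_ord0 mul1r.
  by rewrite jsumSl IH big_ord_recr /=; ring.
by rewrite E E0 big_split.
Qed.

End JacobiTripleProduct.

Section Truncation.
Implicit Types p q : {poly int}.

(** Congruence modulo X^m; it makes polynomials serve as truncated power series. *)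
Definition eqX m p q := forall i, (i < m)%N -> p`_i = q`_i.

Lemma eqX_sym m p q : eqX m p q -> eqX m q p.
Proof. by move=> e i /e. Qed.
Lemma eqX_trans m p q r : eqX m p q -> eqX m q r -> eqX m p r.
Proof. by move=> e1 e2 i im; rewrite e1 ?e2. Qed.

Lemma eqX_le m m' p q : (m' <= m)%N -> eqX m p q -> eqX m' p q.
Proof. by move=> le e i im; apply: e; apply: leq_trans le. Qed.

Lemma eqXM m p q p' q' : eqX m p q -> eqX m p' q' -> eqX m (p * p') (q * q').
Proof.
move=> e e' i im; rewrite !coefM; apply: eq_bigr => j _.
by rewrite e ?e' //; have := ltn_ord j; lia.
Qed.

Lemma eqX_sum m (I : finType) (F G : I -> {poly int}) :
  (forall k, eqX m (F k) (G k)) -> eqX m (\sum_k F k) (\sum_k G k).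
Proof. by move=> e i im; rewrite !coef_sum; apply: eq_bigr => j _; apply: e. Qed.

(** A power series with constant term 1 is invertible, so it can be cancelled
    modulo any power of X. *)
Lemma eqX_cancel m (c : {poly int}) p q : c`_0 = 1 -> eqX m (c * p) (c * q) -> eqX m p q.
Proof.
move=> c0 e i; elim/ltn_ind: i => i IH im.
have := e i im; rewrite !coefM !big_ord_recl /= c0 !mul1r !subn0.
have -> : \sum_(k < i) c`_(bump 0 k) * p`_(i - bump 0 k) =
          \sum_(k < i) c`_(bump 0 k) * q`_(i - bump 0 k).
  apply: eq_bigr => k _; rewrite IH //; have := ltn_ord k; rewrite /bump /=; lia.
exact: addIr.
Qed.

Lemma eqX_Xmul m d p q r : eqX (m - d) p q -> eqX m (p * ('X^d * r)) (q * ('X^d * r)).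
Proof.
move=> e i im; rewrite !mulrA ![_ * 'X^d]mulrC -!mulrA !coefXnM.
case: ltnP => // di; rewrite !coefM; apply: eq_bigr => j _; rewrite e //.
have := ltn_ord j; lia.
Qed.

Lemma eqX_1D m d r : (m <= d)%N -> eqX m (1 + 'X^d * r) 1.
Proof.
by move=> le i im; rewrite coefD coefXnM (leq_trans im le) addr0.
Qed.

Lemma eqX_1B m d r : (m <= d)%N -> eqX m (1 - 'X^d * r) 1.
Proof. by move=> le; rewrite -mulrN; apply: eqX_1D. Qed.

End Truncation.

Section TruncatedJacobi.
Variables (u' v' : {poly int}).
Let u := 'X * u'.
Let v := 'X * v'.
Let Q := u * v.

Lemma QE : Q = 'X^2 * (u' * v').
Proof. by rewrite /Q /u /v expr2; ring. Qed.

Lemma qpoch_trunc d n : (d <= n)%N -> eqX (2 * d.+1) (qpoch Q n) (qpoch Q d).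
Proof.
elim: n => [|n IH]; first by rewrite leqn0 => /eqP->.
rewrite leq_eqVlt => /orP[/eqP->//|ltdn].
rewrite qpochS -[qpoch Q d]mulr1; apply: eqXM; first exact: IH.
rewrite QE exprMn -exprM; apply: eqX_1B; lia.
Qed.

Lemma qpoch_coef0 n : (qpoch Q n)`_0 = 1.
Proof.
have := qpoch_trunc (leq0n n) (isT : (0 < 2 * 1)%N).
by rewrite /qpoch big_ord0 => ->; rewrite coef1.
Qed.

(** As N grows, the Gaussian binomials of N.*2 tend to the inverse of the
    infinite product; d measures the distance from k to the ends 0 and N.*2. *)
Lemma qbin_trunc N d k : (d <= N)%N -> (d <= k)%N -> (k + d <= N.*2)%N ->
  eqX (2 * d.+1) (qpoch Q N * qbin Q N.*2 k) 1.
Proof.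
move=> dN dk kd; apply: (@eqX_cancel _ (qpoch Q N)); first exact: qpoch_coef0.
have [l el] : exists l, N.*2 = (k + l)%N by exists (N.*2 - k)%N; lia.
have dl : (d <= l)%N by lia.
have T n (dn : (d <= n)%N) : eqX (2 * d.+1) (qpoch Q n) (qpoch Q N).
  by apply: (eqX_trans (qpoch_trunc dn)); apply: eqX_sym; apply: qpoch_trunc.
rewrite mulr1; apply: eqX_trans (T N.*2 _); last by lia.
rewrite el -qbin_fact [_ * qbin _ _ _]mulrC mulrCA; apply: eqXM => //.
by apply: eqXM; apply: eqX_sym; [exact: T k dk | exact: T l dl].
Qed.

(** In the finite form the coefficient of [jterm] at j is only correct modulo
    X^(2(N - |j|) + 2), but [jterm] itself is divisible by X^(j^2), and
    2(N - |j|) + 2 + j^2 > N. *)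
Lemma jacobi_trunc N :
  eqX N.+1
    (\prod_(k < N) ((1 + u * Q ^+ k) * (1 + v * Q ^+ k) * (1 - Q ^+ k.+1)))
    (\sum_(k < N.*2.+1) jterm u v (k%:Z - N%:Z)).
Proof.
rewrite big_split /= (finite_jacobi u v) mulrC /jsum mulr_sumr addnn.
apply: eqX_sum => k; rewrite mulrA -[X in eqX _ _ X]mul1r.
set j := k%:Z - N%:Z.
have kle : (k <= N.*2)%N by rewrite -ltnS ltn_ord.
have -> : jterm u v j = 'X^(tri_up j + tri_dn j) * (u' ^+ tri_up j * v' ^+ tri_dn j).
  by rewrite /jterm /u /v !exprMn exprD; ring.
apply: eqX_Xmul; pose d := (N - `|j|)%N.
have Eu := tri_upE j; have Ed := tri_dnE j.
have : eqX (2 * d.+1) (qpoch Q N * qbin Q N.*2 k) 1.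
  by apply: qbin_trunc; rewrite /d /j; lia.
apply: eqX_le; rewrite /d.
have : (tri_up j + tri_dn j)%:Z = j * j by nia.
have jN : (`|j| <= N)%N by rewrite /j; lia.
nia.
Qed.

End TruncatedJacobi.

(** The generalized pentagonal number j(3j - 1)/2. *)
Definition pent (j : int) : nat := (tri_up j + 2 * tri_dn j)%N.

(** * Colored partitions as a double theta sum *)
Section Partitions.

Definition part_factor s : {poly int} :=
  if odd s then (1 + 'X^s) ^+ 3 else (1 - 'X^s) ^+ 2.

(** Expanding the product over all pairs (size, color) chooses a set of pairs;
    the sign -1 attached to even sizes counts the even parts. *)
Lemma partitions_coef n :
  (partitions_even n)%:R - (partitions_odd n)%:R
   = (\prod_(s < n) part_factor s.+1)`_n.
Proof.
pose al (x : 'I_n.+1 * 'I_3) := (0 < x.1)%N && (odd x.1 || (x.2 < 2)%N).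
(* F vanishes on the pairs that are not legal parts, among them size 0 *)
pose F (x : 'I_n.+1 * 'I_3) : {poly int} :=
  if al x then (-1) ^+ (~~ odd x.1) * 'X^(x.1) else 0.
have EF : \prod_(s < n) part_factor s.+1 = \prod_x (F x + 1).
  rewrite (eq_bigr (fun x => (fun s c => F (s, c) + 1) x.1 x.2)); last by case.
  rewrite -(pair_bigA _ (fun s c => F (s, c) + 1)) /= big_ord_recl /=.
  rewrite [X in _ = X * _]big1 ?mul1r; last first.
    by move=> c _; rewrite /F /al /= add0r.
  apply: eq_bigr => s _.
  rewrite !big_ord_recl big_ord0 /F /al /= /bump /= !add0n add1n /= /part_factor /=.
  by case: (odd s) => /=; rewrite ?expr0 ?expr1; ring.
have -> : (partitions_even n)%:R - (partitions_odd n)%:R =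
   \sum_(S : {set 'I_n.+1 * 'I_3} | colored_partition S)
     (-1) ^+ nb_even_parts S :> int.
  rewrite (bigID (fun S => odd (nb_even_parts S))) /= addrC; congr (_ + _).
    rewrite /partitions_even -sum1_card natr_sum; apply: eq_bigr => S.
    by case/andP=> _ /negbTE e; rewrite -signr_odd e.
  rewrite /partitions_odd -sum1_card natr_sum -sumrN; apply: eq_bigr => S.
  by case/andP=> _ e; rewrite -signr_odd e.
rewrite EF bigA_distr coef_sum.
rewrite [RHS](bigID (fun S : {set 'I_n.+1 * 'I_3} => [forall x in S, al x])) /= [X in _ = _ + X]big1 ?addr0; last first.
  move=> S /forall_inPn[x xS nal].
  by rewrite (bigD1 x) //= xS /F (negbTE nal) mul0r coef0.
transitivity (\sum_(S : {set 'I_n.+1 * 'I_3} | [forall x in S, al x])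
    (if (\sum_(x in S) x.1 == n)%N then (-1) ^+ nb_even_parts S else 0 : int)).
  by rewrite -big_mkcondr; apply: eq_bigl.
apply: eq_bigr => S /forall_inP alS.
rewrite -big_mkcond /=.
rewrite (eq_bigr (fun x : 'I_n.+1 * 'I_3 => (-1) ^+ (~~ odd x.1) * 'X^(x.1))); last first.
  by move=> x /alS; rewrite /F => ->.
rewrite big_split /= -!(big_morph _ (exprD _) (expr0 _)).
rewrite /nb_even_parts -sum1_card.
have -> : (\sum_(x in S) (~~ odd x.1) = \sum_(i in [pred x in S | ~~ odd x.1]) 1)%N.
  rewrite big_mkcondr /=; apply: eq_bigr => x _; by case: odd.
have E m : (-1) ^+ m = ((-1) ^+ m)%:P :> {poly int} by rewrite rmorphXn rmorphN1.
rewrite E coefCM coefXn eq_sym.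
by case: eqP; rewrite ?mulr1 ?mulr0.
Qed.

Lemma prod_trunc (f : nat -> {poly int}) n N : (n <= N)%N ->
  (forall s, (n < s)%N -> eqX n.+1 (f s) 1) ->
  eqX n.+1 (\prod_(s < n) f s.+1) (\prod_(s < N) f s.+1).
Proof.
move=> le f1.
elim: N le => [|N IH]; first by rewrite leqn0 => /eqP->.
rewrite leq_eqVlt => /orP[/eqP->//|lt].
rewrite big_ord_recr /= -[X in eqX _ X]mulr1; apply: eqXM; first exact: IH.
by apply: eqX_sym; apply: f1.
Qed.

Definition phi_factor s : {poly int} :=
  if odd s then (1 + 'X^s) ^+ 2 else 1 - 'X^s.
Definition psi_factor s : {poly int} := if odd s then 1 + 'X^s else 1 - 'X^s.

Lemma prod_pairs (f : nat -> {poly int}) N :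
  \prod_(s < N.*2) f s.+1 = \prod_(k < N) (f (k.*2).+1 * f (k.*2).+2).
Proof.
elim: N => [|N IH]; first by rewrite !big_ord0.
by rewrite doubleS !big_ord_recr /= IH -mulrA.
Qed.

Lemma prod_triples (f : nat -> {poly int}) N :
  \prod_(s < 3 * N) f s.+1 =
  \prod_(k < N) (f (3 * k).+1 * f (3 * k).+2 * f (3 * k).+3).
Proof.
elim: N => [|N IH]; first by rewrite muln0 !big_ord0.
by rewrite mulnS addnC addn3 !big_ord_recr /= IH !mulrA.
Qed.

(** The triple product at u = v = X. *)
Lemma phi_trunc n :
  eqX n.+1 (\prod_(s < n) phi_factor s.+1)
    (\sum_(k < n.*2.+1) 'X^(`|k%:Z - n%:Z| ^ 2)).
Proof.
apply: eqX_trans.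
  apply: (@prod_trunc phi_factor n n.*2); first by lia.
  move=> s lt; rewrite /phi_factor; case: odd; rewrite ?expr2.
    rewrite -[1 as X in eqX _ _ X]mulr1.
    by apply: eqXM; rewrite -['X^s]mulr1; apply: eqX_1D.
  by rewrite -['X^s]mulr1; apply: eqX_1B.
rewrite prod_pairs.
have := @jacobi_trunc 1 1 n; rewrite !mulr1.
have -> : \prod_(k < n) ((1 + 'X * ('X * 'X) ^+ k) * (1 + 'X * ('X * 'X) ^+ k) *
      (1 - ('X * 'X) ^+ k.+1)) =
   \prod_(k < n) (phi_factor (k.*2).+1 * phi_factor (k.*2).+2) :> {poly int}.
  apply: eq_bigr => k _; rewrite /phi_factor /= odd_double /= -!expr2 -!exprM.
  by rewrite !mul2n doubleS -exprS -mulrA.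
have -> : \sum_(k < n.*2.+1) jterm 'X 'X (k%:Z - n%:Z) =
   \sum_(k < n.*2.+1) 'X^(`|k%:Z - n%:Z| ^ 2) :> {poly int}; last by [].
apply: eq_bigr => k _; rewrite /jterm -exprD; congr ('X^_).
have := tri_upE (k%:Z - n%:Z); have := tri_dnE (k%:Z - n%:Z); nia.
Qed.

(** The triple product at u = X and v = - X^2: Euler's pentagonal number theorem
    with X replaced by - X. *)
Lemma psi_trunc n :
  eqX n.+1 (\prod_(s < n) psi_factor s.+1)
    (\sum_(k < n.*2.+1) ((-1) ^+ tri_dn (k%:Z - n%:Z)) *: 'X^(pent (k%:Z - n%:Z))).
Proof.
apply: eqX_trans.
  apply: (@prod_trunc psi_factor n (3 * n)); first by lia.
  move=> s lt; rewrite /psi_factor; case: odd; rewrite -['X^s]mulr1.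
    exact: eqX_1D.
  exact: eqX_1B.
rewrite prod_triples.
have := @jacobi_trunc 1 (- 'X) n; rewrite !mulr1.
have -> : \prod_(k < n) ((1 + 'X * ('X * ('X * - 'X)) ^+ k) *
      (1 + 'X * - 'X * ('X * ('X * - 'X)) ^+ k) *
      (1 - ('X * ('X * - 'X)) ^+ k.+1)) =
  \prod_(k < n) (psi_factor (3 * k).+1 * psi_factor (3 * k).+2 * psi_factor (3 * k).+3) :> {poly int}.
  apply: eq_bigr => k _; rewrite /psi_factor /= !oddM /=.
  have Ek : ('X * ('X * - 'X)) ^+ k = (-1) ^+ odd k * 'X^(3 * k) :> {poly int}.
    by rewrite signr_odd exprM -exprMn; congr (_ ^+ _); ring.
  rewrite (exprS ('X * _) k) Ek (exprS 'X (3 * k).+2).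
  rewrite (exprS 'X (3 * k).+1) (exprS 'X (3 * k)).
  by case: (odd k) => /=; rewrite ?expr0 ?expr1; ring.
have -> : \sum_(k < n.*2.+1) jterm 'X ('X * - 'X) (k%:Z - n%:Z) =
   \sum_(k < n.*2.+1) ((-1) ^+ tri_dn (k%:Z - n%:Z)) *: 'X^(pent (k%:Z - n%:Z)) :> {poly int}; last by [].
apply: eq_bigr => k _; rewrite /jterm mulrN -expr2 (exprNn 'X^2) -exprM.
by rewrite /pent exprD -mul_polyC rmorphXn /= polyCN mulrCA.
Qed.

(** The product (1 + X^s)^3 over odd s times (1 - X^s)^2 over even s is the
    product of the two preceding theta series. *)
Lemma partitions_sum n :
  (partitions_even n)%:R - (partitions_odd n)%:R =
  \sum_(k < n.*2.+1) \sum_(m < n.*2.+1)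
    (if (pent (k%:Z - n%:Z) + `|m%:Z - n%:Z| ^ 2 == n)%N
     then (-1) ^+ tri_dn (k%:Z - n%:Z) else 0) :> int.
Proof.
rewrite partitions_coef.
have -> : \prod_(s < n) part_factor s.+1 =
  \prod_(s < n) psi_factor s.+1 * \prod_(s < n) phi_factor s.+1.
  rewrite -big_split /=; apply: eq_bigr => s _.
  by rewrite /part_factor /psi_factor /phi_factor; case: ifP => _; rewrite !exprS expr0; ring.
have -> := eqXM (psi_trunc (n := n)) (phi_trunc (n := n)) (ltnSn n).
rewrite mulr_suml coef_sum; apply: eq_bigr => k _.
rewrite mulr_sumr coef_sum; apply: eq_bigr => m _.
rewrite -scalerAl -exprD coefZ coefXn eq_sym.
by case: eqP; rewrite ?mulr1 ?mulr0.
Qed.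

End Partitions.

(** * Quadratic reciprocity *)
Lemma sum_geq n c : (\sum_(k < n) (c <= k) = n - c)%N.
Proof.
elim: n => [|n IH]; first by rewrite big_ord0.
by rewrite big_ord_recr /= IH; case: leqP; lia.
Qed.

Section Legendre.

Lemma Fp_int_eq0 p (z : int) : prime p -> (z%:~R == 0 :> 'F_p) = (p %| z)%Z.
Proof.
move=> pp; have ch := pchar_Fp pp.
rewrite dvdzE absz_nat (dvdn_pcharf ch); case: z => n; first by rewrite absz_nat -pmulrn.
by rewrite NegzE mulrNz oppr_eq0 abszN absz_nat -pmulrn.
Qed.

Lemma Fp_fermat p (x : 'F_p) : prime p -> x ^+ p = x.
Proof. by move=> pp; have := expf_card x; rewrite card_Fp. Qed.

(** Euler's criterion taken as the definition of the Legendre symbol: it is the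
    form in which Frobenius elements produce it. *)
Definition leg (a : int) (p : nat) : int :=
  if a%:~R == 0 :> 'F_p then 0 else if a%:~R ^+ p./2 == 1 :> 'F_p then 1 else -1.

Variable p : nat.
Hypotheses (pp : prime p) (op : odd p).

Lemma odd_doubleE : p = (p./2).*2.+1.
Proof. by rewrite -[LHS]odd_double_half op. Qed.

Lemma half_gt0 : (0 < p./2)%N.
Proof. by have := prime_gt1 pp; have := odd_doubleE; lia. Qed.

Lemma legE a : (leg a p)%:~R = a%:~R ^+ p./2 :> 'F_p.
Proof.
rewrite /leg; set x : 'F_p := a%:~R; have [->|x0] := eqVneq x 0.
  by rewrite expr0n; have := half_gt0; case: (p./2).
have : (x ^+ p./2) ^+ 2 == 1.
  have e : x ^+ (p./2).*2.+1 = x by rewrite -odd_doubleE Fp_fermat.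
  rewrite exprS in e.
  by rewrite -exprM muln2; apply/eqP/(mulfI x0); rewrite e mulr1.
by rewrite sqrf_eq1; case: (x ^+ p./2 =P 1) => [->|_ /eqP->].
Qed.

Lemma leg_cases a : leg a p = 0 \/ leg a p = 1 \/ leg a p = -1.
Proof. by rewrite /leg; case: ifP => _; [left|case: ifP; right; [left|right]]. Qed.

Lemma leg_inj (s t : int) : `|s| <= 1 -> `|t| <= 1 -> s%:~R = t%:~R :> 'F_p -> s = t.
Proof.
move=> s1 t1 /eqP; rewrite -subr_eq0 -intrB Fp_int_eq0 // => /dvdzP[k e].
have p3 : (2 < p)%N by have := half_gt0; have := odd_doubleE; lia.
have k0 : k = 0 by nia.
by move/eqP: e; rewrite k0 mul0r subr_eq0 => /eqP.
Qed.

Lemma leg_le1 a : `|leg a p| <= 1.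
Proof. by case: (leg_cases a) => [|[]] ->. Qed.

Lemma leg_eq a (s : int) : `|s| <= 1 -> s%:~R = a%:~R ^+ p./2 :> 'F_p -> leg a p = s.
Proof. by move=> s1 e; apply: leg_inj; rewrite ?leg_le1 // legE. Qed.

Lemma legM a b : leg (a * b) p = leg a p * leg b p.
Proof.
apply: leg_eq; last by rewrite !intrM exprMn !legE.
by case: (leg_cases a) => [|[]] ->; case: (leg_cases b) => [|[]] ->.
Qed.

Lemma leg_mod a b : (p %| a - b)%Z -> leg a p = leg b p.
Proof.
rewrite -Fp_int_eq0 // intrB subr_eq0 => /eqP e.
by rewrite /leg e.
Qed.

Lemma leg_sqr1 a : ~~ (p %| a)%Z -> leg a p ^+ 2 = 1.
Proof. by rewrite /leg -Fp_int_eq0 // => /negbTE->; case: ifP. Qed.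

Lemma legN1 : leg (-1) p = (-1) ^+ p./2.
Proof.
apply: leg_eq; last by rewrite rmorphXn.
by rewrite normrX normrN1 expr1n.
Qed.

(** If the symbol were 1, then a and the (p - 1)/2 nonzero squares would be too
    many roots of the polynomial X^((p - 1)/2) - 1. *)
Lemma leg_nonsquare a : (forall b : int, ~~ (p %| b ^+ 2 - a)%Z) -> leg a p = -1.
Proof.
move=> nsq; case: (leg_cases a) => [l0|[l1|//]].
  have := nsq 0; rewrite expr0n sub0r dvdzE abszN -dvdzE => /negP[].
  by move: l0; rewrite /leg -Fp_int_eq0 //; case: eqP => // _; case: ifP.
have ax : a%:~R ^+ p./2 = 1 :> 'F_p by rewrite -legE l1.
pose S := [seq (i.+1%:R : 'F_p) ^+ 2 | i <- iota 0 p./2].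
have natF (i j : nat) : (i < p)%N -> (j < p)%N -> i%:R = j%:R :> 'F_p -> i = j.
  move=> ip jp /(congr1 val) /=; rewrite !val_Fp_nat // !modn_small //.
have uS : uniq S.
  rewrite map_inj_in_uniq ?iota_uniq // => i j; rewrite !mem_iota /= !add0n => ih jh.
  move/eqP; rewrite eqf_sqr => /orP[/eqP/natF|].
    by have := odd_doubleE; lia.
  rewrite -addr_eq0 -natrD -(dvdn_pcharf (pchar_Fp pp)) => /dvdn_leq.
  by have := odd_doubleE; lia.
pose P : {poly 'F_p} := 'X^(p./2) - 1.
have szP : size P = p./2.+1 by rewrite size_XnsubC // half_gt0.
have nzP : P != 0 by rewrite -size_poly_gt0 szP.
have rS : all (root P) (a%:~R :: S).
  rewrite /= /root /P !hornerE ax subrr eqxx /=.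
  apply/allP => y /mapP[i]; rewrite mem_iota add0n => ih ->.
  rewrite !hornerE -exprM mul2n subr_eq0.
  have i0 : (i.+1%:R : 'F_p) != 0.
    by rewrite -(dvdn_pcharf (pchar_Fp pp)) gtnNdvd //; have := odd_doubleE; lia.
  by apply/eqP/(mulfI i0); rewrite -exprS -odd_doubleE mulr1 Fp_fermat.
have uaS : uniq (a%:~R :: S).
  rewrite /= uS andbT; apply/mapP => -[i _ ea]; have := nsq i.+1%:Z.
  by rewrite -Fp_int_eq0 // rmorphB rmorphXn /= ea subrr eqxx.
have := max_poly_roots nzP rS uaS.
by rewrite szP /= size_map size_iota ltnn.
Qed.

Section GaussLemma.
Variable a : nat.
Hypothesis ap : ~~ (p %| a)%N.

Definition gauss_count : nat := (\sum_(k < p./2) (p./2 < (a * k.+1) %% p))%N.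

Let r k := ((a * k.+1) %% p)%N.
Let s k := if (p./2 < r k)%N then (p - r k)%N else r k.

Let r_gt0 k : (k < p./2)%N -> (0 < r k)%N.
Proof.
move=> kh; rewrite lt0n -/(dvdn p _) Euclid_dvdM // negb_or ap gtnNdvd //.
by have := odd_doubleE; lia.
Qed.

Let r_lt k : (r k < p)%N. Proof. by rewrite ltn_mod prime_gt0. Qed.

Let s_bnd k : (k < p./2)%N -> (0 < s k <= p./2)%N.
Proof.
move=> /r_gt0; have := r_lt k; have := odd_doubleE; rewrite /s.
by move: (r k) => x; case: (ltnP p./2 x); lia.
Qed.

Let s_perm : perm_eq [seq s k | k <- iota 0 p./2] (iota 1 p./2).
Proof.
have us : uniq [seq s k | k <- iota 0 p./2].
  rewrite map_inj_in_uniq ?iota_uniq // => i j; rewrite !mem_iota /= !add0n => ih jh.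
  have key : r i = r j \/ (r i + r j = p)%N -> i = j.
    rewrite /r => -[e|e].
      have {e} : (a * i.+1 == a * j.+1 %[mod p])%N by apply/eqP.
      wlog ij : i j ih jh / (i <= j)%N.
        move=> W; case: (leqP i j) => [ij|/ltnW ji] e; first exact: W.
        by apply/esym/W; rewrite // eq_sym.
      rewrite eq_sym eqn_mod_dvd ?leq_mul // -mulnBr Euclid_dvdM // (negbTE ap) /=.
      rewrite subSS; case: (posnP (j - i)) => [|ij0 /(dvdn_leq ij0)]; first lia.
      by have := odd_doubleE; lia.
    have : (p %| a * (i.+1 + j.+1))%N.
      by rewrite /dvdn mulnDr -modnDm e modnn.
    rewrite Euclid_dvdM // (negbTE ap) /= => /dvdn_leq.
    by have := odd_doubleE; lia.
  move=> e; apply: key; move: e; have := r_lt i; have := r_lt j.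
  by rewrite /s; move: (r i) (r j) => x y; case: ifP; case: ifP; lia.
apply: (uniq_perm us (iota_uniq _ _)).
have [||//] := uniq_min_size us (s2 := iota 1 p./2); last by rewrite size_map !size_iota.
by move=> _ /mapP[k + ->]; rewrite !mem_iota add0n add1n ltnS => /s_bnd.
Qed.

(** Up to sign, the residues of a, 2a, ..., (p - 1)/2 a are the numbers
    1, ..., (p - 1)/2; compare the two products. *)
Lemma gauss_lemma : leg a p = (-1) ^+ gauss_count.
Proof.
apply: leg_eq; first by rewrite normrX normrN1 expr1n.
have f0 : \prod_(k <- iota 1 p./2) (k%:R : 'F_p) != 0.
  rewrite prodf_seq_neq0; apply/allP => k; rewrite mem_iota add1n /= => /andP[k0 kh].
  rewrite -(dvdn_pcharf (pchar_Fp pp)) gtnNdvd //; have := odd_doubleE; lia.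
apply: (mulIf f0); rewrite rmorphXn rmorphN1.
have iotaE : iota 0 p./2 = index_iota 0 p./2 by rewrite /index_iota subn0.
transitivity (\prod_(k < p./2) ((a * k.+1)%N%:R : 'F_p)); last first.
  rewrite -[iota 1 _]/(iota (1 + 0) _) iotaDl big_map iotaE.
  rewrite big_mkord -[X in _ ^+ X]card_ord -prodr_const -big_split /=.
  by apply: eq_bigr => k _; rewrite natrM -pmulrn.
rewrite -(perm_big _ s_perm) /= big_map iotaE big_mkord.
rewrite /gauss_count (big_morph _ (exprD _) (expr0 _)) -big_split /=.
have p0 : p%:R = 0 :> 'F_p by exact: (pcharf0 (pchar_Fp pp)).
apply: eq_bigr => k _; rewrite /s -/(r k).
have -> : (a * k.+1)%N%:R = (r k)%:R :> 'F_p.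
  by rewrite [in LHS](divn_eq (a * k.+1) p) natrD natrM p0 mulr0 add0r.
case: ifP => _; last by rewrite mul1r.
by rewrite natrB ?p0 ?(ltnW (r_lt k)) // sub0r mulN1r opprK.
Qed.

(** For odd a the number of sign changes in Gauss's lemma has the parity of this
    sum, as one sees by adding the residues of the multiples of a modulo 2. *)
Lemma eisenstein : odd a -> leg a p = (-1) ^+ (\sum_(k < p./2) (a * k.+1) %/ p)%N.
Proof.
move=> oa; rewrite gauss_lemma -signr_odd -[in RHS]signr_odd; congr (_ ^+ _).
have es : (\sum_(k < p./2) s k = \sum_(k < p./2) k.+1)%N.
  have iotaE : iota 0 p./2 = index_iota 0 p./2 by rewrite /index_iota subn0.
  have := perm_big _ s_perm (op := addn) (x := 0%N) (P := xpredT) (F := id) => /=.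
  by rewrite big_map -[iota 1 _]/(iota (1 + 0) _) iotaDl big_map iotaE !big_mkord.
have e1 : (\sum_(k < p./2) a * k.+1 =
    (\sum_(k < p./2) (a * k.+1) %/ p) * p + \sum_(k < p./2) r k)%N.
  rewrite big_distrl -big_split; apply: eq_bigr => k _ /=.
  exact: divn_eq.
have e2 : (\sum_(k < p./2) r k + (\sum_(k < p./2) (p./2 < r k) * s k).*2 =
    \sum_(k < p./2) s k + p * gauss_count)%N.
  rewrite /gauss_count -mul2n !big_distrr -!big_split; apply: eq_bigr => k _ /=.
  rewrite -/(r k) /s; have := r_lt k; move: (r k) => x.
  by case: (ltnP p./2 x) => /=; lia.
have := congr1 odd e2; rewrite es !oddD odd_double addbF oddM op /= => e2'.
have := congr1 odd e1; rewrite -big_distrr /= oddD !oddM oa op /= andbT e2'.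
by do 3!case: odd.
Qed.

End GaussLemma.

Lemma leg2 : leg 2 p = (-1) ^+ ((p %% 8 == 3) || (p %% 8 == 5))%N.
Proof.
have np : ~~ (p %| 2)%N.
  by rewrite gtnNdvd //; have := odd_doubleE; have := half_gt0; lia.
rewrite (gauss_lemma np) /gauss_count.
have -> : (\sum_(k < p./2) (p./2 < (2 * k.+1) %% p) = p./2 - (p./2)./2)%N.
  transitivity (\sum_(k < p./2) ((p./2)./2 <= k))%N.
    apply: eq_bigr => k _; rewrite modn_small; have := ltn_ord k; have := odd_doubleE; lia.
  exact: sum_geq.
rewrite -signr_odd -[in RHS]signr_odd; congr (_ ^+ _).
have := odd_doubleE; lia.
Qed.

End Legendre.

Lemma sum_ltn n c : (\sum_(k < n) (k < c) = minn n c)%N.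
Proof.
elim: n => [|n IH]; first by rewrite big_ord0 min0n.
by rewrite big_ord_recr /= IH; case: ltnP; lia.
Qed.

(** The two sums count the points of a rectangle on either side of its diagonal,
    which contains none of them. *)
Lemma lattice_count p q : prime p -> odd p -> prime q -> odd q -> p != q ->
  (\sum_(k < p./2) (q * k.+1) %/ p + \sum_(l < q./2) (p * l.+1) %/ q =
   p./2 * q./2)%N.
Proof.
move=> pp op pq oq npq.
have half (p' q' k : nat) : odd p' -> odd q' -> prime p' -> (k < p'./2)%N ->
    ((q' * k.+1) %/ p' = \sum_(l < q'./2) (p' * l.+1 <= q' * k.+1))%N.
  move=> op' oq' pp' kh.
  under eq_bigr => l _ do rewrite [(p' * _)%N]mulnC -leq_divRL ?prime_gt0 //.
  rewrite sum_ltn; apply/esym/minn_idPr.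
  rewrite -ltnS ltn_divLR ?prime_gt0 //.
  have := odd_doubleE op'; have := odd_doubleE oq'; nia.
under eq_bigr => k _ do rewrite (half p q k op oq pp (ltn_ord k)).
under [X in (_ + X)%N]eq_bigr => k _ do rewrite (half q p k oq op pq (ltn_ord k)).
rewrite exchange_big /= -big_split /= -[RHS]mulnC -[X in (X * _)%N]card_ord -sum_nat_const.
apply: eq_bigr => l _; rewrite -big_split /= -[RHS]card_ord -sum1_card.
apply: eq_bigr => k _; case: ltngtP => // e.
have : (p %| q * k.+1)%N by rewrite -e dvdn_mulr.
rewrite Euclid_dvdM // dvdn_prime2 // (negbTE npq) /= => /dvdn_leq.
have := ltn_ord k; have := odd_doubleE op; lia.
Qed.

Lemma leg_reciprocity p q : prime p -> odd p -> prime q -> odd q -> p != q ->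
  leg q p * leg p q = (-1) ^+ (p./2 * q./2)%N.
Proof.
move=> pp op pq oq npq.
rewrite !eisenstein // ?dvdn_prime2 // 1?eq_sym // -exprD lattice_count //.
Qed.

Section Jacobi.

(** The product runs over all primes up to n, those that do not divide n
    contributing an exponent 0. *)
Definition jac (a : int) (n : nat) : int := \prod_(p < n.+1 | prime p) leg a p ^+ logn p n.

Lemma jac_wide a n B : (n < B)%N ->
  jac a n = \prod_(p < B | prime p) leg a p ^+ logn p n.
Proof.
move=> nB; rewrite /jac (big_ord_widen_cond _ (fun p => prime p)
  (fun p => leg a p ^+ logn p n) nB).
rewrite [RHS](bigID (fun p : 'I_B => (p < n.+1)%N)) /= [X in _ = _ * X]big1 ?mulr1 //.
by move=> p /andP[_ np]; rewrite ltn_log0 // ltnNge.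
Qed.

Lemma jac1 a : jac a 1 = 1.
Proof. by rewrite /jac big1 // => p _; rewrite logn1. Qed.

Lemma jacMn a m n : (0 < m)%N -> (0 < n)%N -> jac a (m * n) = jac a m * jac a n.
Proof.
move=> m0 n0; have B := ltnSn (m * n).
rewrite (jac_wide a B) (@jac_wide a m (m * n).+1) ?(@jac_wide a n (m * n).+1); try nia.
by rewrite -big_split; apply: eq_bigr => p _ /=; rewrite lognM // exprD.
Qed.

Lemma jac_prime a p : prime p -> jac a p = leg a p.
Proof.
move=> pp; rewrite /jac (bigD1 ord_max) //= logn_prime // eqxx expr1 big1 ?mulr1 //.
move=> q /andP[pq]; rewrite -val_eqE /= logn_prime // => /negbTE qp.
by rewrite qp.
Qed.

Lemma mul_prime_ind (P : nat -> Prop) : P 1%N ->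
  (forall p n, prime p -> (0 < n)%N -> P n -> P (p * n)%N) ->
  forall n, (0 < n)%N -> P n.
Proof.
move=> P1 PM; elim/ltn_ind => n IH n0.
have [->//|n1] := eqVneq n 1%N.
have pp : prime (pdiv n) by apply: pdiv_prime; lia.
have /dvdnP[m em] := pdiv_dvd n; rewrite em mulnC.
have p1 := prime_gt1 pp.
by apply: PM => //; [|apply: IH]; nia.
Qed.

Lemma coprime_int_nat (a : int) p : prime p -> ~~ (p %| a)%Z = coprime p `|a|%N.
Proof. by move=> pp; rewrite prime_coprime // dvdzE absz_nat. Qed.

Lemma jacM a b n : odd n -> jac (a * b) n = jac a n * jac b n.
Proof.
move=> on; have n0 : (0 < n)%N by case: n on.
move: n n0 on; apply: mul_prime_ind => [|p n pp n0 IH]; first by rewrite !jac1.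
rewrite oddM => /andP[op on]; have p0 := prime_gt0 pp.
by rewrite !jacMn // !(jac_prime _ pp) legM // IH //; ring.
Qed.

Lemma jac_mod a b n : odd n -> (n %| a - b)%Z -> jac a n = jac b n.
Proof.
move=> on; have n0 : (0 < n)%N by case: n on.
move: n n0 on; apply: mul_prime_ind => [|p n pp n0 IH]; first by rewrite !jac1.
rewrite oddM => /andP[op on] d; have p0 := prime_gt0 pp.
rewrite !jacMn // !(jac_prime _ pp) (@leg_mod p _ a b) ?IH //.
  by apply: dvdz_trans d; rewrite PoszM dvdz_mull.
by apply: dvdz_trans d; rewrite PoszM dvdz_mulr.
Qed.

Lemma jac_sqr a n : odd n -> coprime n `|a|%N -> jac a n ^+ 2 = 1.
Proof.
move=> on; have n0 : (0 < n)%N by case: n on.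
move: n n0 on; apply: mul_prime_ind => [|p n pp n0 IH]; first by rewrite !jac1.
rewrite oddM coprimeMl => /andP[op on] /andP[cp cn]; have p0 := prime_gt0 pp.
by rewrite !jacMn // !(jac_prime _ pp) exprMn IH // leg_sqr1 // coprime_int_nat.
Qed.

Lemma jacN1 n : odd n -> jac (-1) n = (-1) ^+ (n %% 4 == 3)%N.
Proof.
move=> on; have n0 : (0 < n)%N by case: n on.
move: n n0 on; apply: mul_prime_ind => [|p n pp n0 IH]; first by rewrite !jac1.
rewrite oddM => /andP[op on]; have p0 := prime_gt0 pp.
rewrite jacMn // (jac_prime _ pp) legN1 // IH // -signr_odd -signr_addb; congr (_ ^+ _).
have ep := odd_doubleE op; have en := odd_doubleE on.
rewrite -modnMm; have : (p %% 4 == 1 \/ p %% 4 == 3)%N by lia.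
have : (n %% 4 == 1 \/ n %% 4 == 3)%N by lia.
by move=> [/eqP->|/eqP->] [/eqP e|/eqP e]; rewrite e /=; lia.
Qed.

Lemma jac2 n : odd n -> jac 2 n = (-1) ^+ ((n %% 8 == 3) || (n %% 8 == 5))%N.
Proof.
move=> on; have n0 : (0 < n)%N by case: n on.
move: n n0 on; apply: mul_prime_ind => [|p n pp n0 IH]; first by rewrite !jac1.
rewrite oddM => /andP[op on]; have p0 := prime_gt0 pp.
rewrite jacMn // (jac_prime _ pp) leg2 // IH // -signr_addb; congr (_ ^+ _).
have ep := odd_doubleE op; have en := odd_doubleE on.
have cases (m : nat) : m = (m./2).*2.+1 ->
  [\/ m %% 8 = 1, m %% 8 = 3, m %% 8 = 5 | m %% 8 = 7]%N.
  move=> e; have : (m %% 8 = 1 \/ m %% 8 = 3 \/ m %% 8 = 5 \/ m %% 8 = 7)%N by lia.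
  by case=> [|[|[]]]; [apply: Or41|apply: Or42|apply: Or43|apply: Or44].
by rewrite -modnMm; case: (cases p ep) => ->; case: (cases n en) => ->.
Qed.

Definition qr_sign m n : int := (-1) ^+ ((m %% 4 == 3) && (n %% 4 == 3))%N.

Lemma mod4_mul m n : odd m -> odd n ->
  ((m * n) %% 4 == 3)%N = (m %% 4 == 3)%N (+) (n %% 4 == 3)%N.
Proof.
move=> om on; have em := odd_doubleE om; have en := odd_doubleE on.
rewrite -modnMm; have : (m %% 4 == 1 \/ m %% 4 == 3)%N by lia.
have : (n %% 4 == 1 \/ n %% 4 == 3)%N by lia.
by move=> [/eqP->|/eqP->] [/eqP->|/eqP->].
Qed.

Lemma qr_signMr m n n' : odd n -> odd n' -> qr_sign m (n * n') = qr_sign m n * qr_sign m n'.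
Proof.
by move=> on on'; rewrite /qr_sign mod4_mul // -signr_addb andb_addr.
Qed.

Lemma qr_signMl m n n' : odd n -> odd n' -> qr_sign (n * n') m = qr_sign n m * qr_sign n' m.
Proof.
by move=> on on'; rewrite /qr_sign mod4_mul // -signr_addb andb_addl.
Qed.

(** Both sides are multiplicative in m and in n, which reduces the law to primes. *)
Lemma jac_reciprocity (m n : nat) : odd m -> odd n -> coprime m n ->
  jac m n * jac n m = qr_sign m n.
Proof.
move=> om on; have n0 : (0 < n)%N by case: n on.
move: n n0 on; apply: mul_prime_ind => [|q n pq n0 IHn].
  rewrite jac1 mul1r /qr_sign andbF expr0 => _ _; have m0 : (0 < m)%N by case: m om.
  move: m m0 om; apply: mul_prime_ind => [|p m pp m0 IHm]; first by rewrite !jac1.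
  rewrite oddM => /andP[op om]; rewrite jacMn ?(prime_gt0 pp) // IHm // (jac_prime _ pp) mulr1.
  by apply: leg_eq; rewrite // expr1n.
rewrite oddM coprimeMr => /andP[oq on] /andP[cq cn]; have q0 := prime_gt0 pq.
rewrite PoszM jacM // jacMn // qr_signMr // mulrACA IHn //; congr (_ * _).
have m0 : (0 < m)%N by case: m om {cn IHn cq}.
clear cn IHn.
move: m m0 om cq; apply: mul_prime_ind => [|p m pp m0 IHm].
  rewrite jac1 mulr1 /qr_sign expr0 jac_prime // => _ _.
  by apply: leg_eq; rewrite // expr1n.
rewrite oddM coprimeMl => /andP[op om] /andP[cp cm]; have p0 := prime_gt0 pp.
rewrite PoszM jacM // jacMn // qr_signMl // mulrACA IHm //; congr (_ * _).
rewrite (jac_prime _ pp) (jac_prime _ pq) leg_reciprocity //; last first.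
  by move: cp; rewrite prime_coprime // dvdn_prime2 // eq_sym.
have e3 (m' : nat) : odd m' -> (m' %% 4 == 3)%N = odd m'./2.
  by move=> om'; have := odd_doubleE om'; lia.
by rewrite /qr_sign -signr_odd oddM !e3 // andbC.
Qed.

Lemma jac3 n : odd n -> ~~ (3 %| n)%N ->
  jac 3 n = (-1) ^+ ((n %% 4 == 3)%N (+) (n %% 3 == 2)%N).
Proof.
move=> on n3; have c3 : coprime 3 n by rewrite prime_coprime.
have := jac_reciprocity (isT : odd 3) on c3; rewrite /qr_sign /= (jac_prime _ (isT : prime 3)).
have -> : leg n 3 = (-1) ^+ (n %% 3 == 2)%N.
  have [e|e] : (n %% 3 = 1 \/ n %% 3 = 2)%N by lia.
    rewrite e (@leg_mod 3 isT _ 1); last by lia.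
    by apply: leg_eq; rewrite // expr1n.
  rewrite e (@leg_mod 3 isT _ (-1)); last by lia.
  by rewrite legN1.
move=> /(congr1 ( *%R^~ ((-1) ^+ (n %% 3 == 2)%N))).
by rewrite -mulrA -expr2 sqrr_sign mulr1 signr_addb => ->.
Qed.

Lemma jac6 n : odd n -> ~~ (3 %| n)%N ->
  jac 6 n = (-1) ^+ (n %% 24 \in [:: 7; 11; 13; 17])%N.
Proof.
move=> on n3; rewrite (jacM 2 3) // jac2 // jac3 // -signr_addb; congr (_ ^+ _).
have e8 : (n %% 8 = (n %% 24) %% 8)%N by lia.
have e4 : (n %% 4 = (n %% 24) %% 4)%N by lia.
have e3 : (n %% 3 = (n %% 24) %% 3)%N by lia.
have : (n %% 24 \in [:: 1; 5; 7; 11; 13; 17; 19; 23])%N.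
  by rewrite !inE; have := odd_doubleE on; lia.
rewrite e8 e4 e3; move: (n %% 24)%N => r; rewrite !inE.
by do 7?[case/orP]; move/eqP->.
Qed.

Lemma odd_int_sqr (x : int) : odd `|x| -> exists k, x ^+ 2 = 8 * k + 1.
Proof.
move=> ox; have [h eh] : exists h : int, x = 2 * h + 1.
  by exists (x %/ 2)%Z; have := odd_doubleE ox; lia.
have [k ek] := even_mulS h; exists k.
rewrite eh; transitivity (4 * (h * (h + 1)) + 1); first by ring.
by rewrite ek; ring.
Qed.

(** If N = x^2 + 24 m^2 is the norm of x + 2m theta, where theta = sqrt(-6), then
    theta is congruent to - b modulo this number, so that the left hand side is the
    symbol of 2 theta.  It equals (- x m / N); since N is 1 modulo 8 the sign drops
    out, (m / N) = (x^2 / m) = 1 up to the prime 2, and (x / N) = (24 m^2 / x) =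
    (6 / x). *)
Lemma jac_norm_form (x m b : int) (N : nat) :
  N%:Z = x ^+ 2 + 24 * m ^+ 2 -> odd `|x| -> ~~ (3 %| `|x|)%N -> coprime `|x| `|m| ->
  (N%:Z %| 2 * m * b - x)%Z -> jac (- (2 * b)) N = jac 6 `|x|.
Proof.
move=> eN ox x3 cxm dv; have [k ek] := odd_int_sqr ox.
have N8 : (N %% 8 = 1)%N.
  have : N%:Z = 8 * (k + 3 * m ^+ 2) + 1 by rewrite eN ek; ring.
  by lia.
have oN : odd N by have := odd_double_half N; case: odd => //; lia.
have N4 : (N %% 4 == 3)%N = false by lia.
have N1 : jac (-1) N = 1 by rewrite jacN1 // N4.
have jabs (z : int) : jac z N = jac `|z|%N N.
  have [z0|z0] := lerP 0 z; first by rewrite gez0_abs.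
  by rewrite -[LHS]mul1r -N1 -jacM // mulN1r ltz0_abs.
have eNn : N = (`|x| * `|x| + 24 * (`|m| * `|m|))%N by lia.
have cmN : coprime N `|m|.
  rewrite eNn addnC mulnA coprime_sym /coprime gcdnMDl -/(coprime _ _).
  by rewrite coprimeMr coprime_sym cxm.
have cxN : coprime `|x| N.
  rewrite eNn /coprime gcdnMDl -/(coprime _ _) (_ : 24 = 2 * (2 * (2 * 3)))%N //.
  by rewrite !coprimeMr !coprimen2 ox cxm /= andbT coprime_sym prime_coprime.
have [m0|mn0] := posnP `|m|.
  move: cxm; rewrite m0 /coprime gcdn0 => /eqP x1.
  have -> : N = 1%N by lia.
  by rewrite x1 !jac1.
have E : jac (- (2 * b)) N = jac x N * jac m N.
  transitivity (jac (-1) N * (jac x N * jac m N)); last by rewrite N1 mul1r.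
  transitivity (jac (- (2 * b)) N * jac m N ^+ 2); first by rewrite jac_sqr // mulr1.
  rewrite expr2 -!jacM //.
  apply: jac_mod => //; case/dvdzP: dv => q eq; apply/dvdzP; exists (- (m * q)).
  have -> : x = 2 * m * b - q * N%:Z by rewrite -eq; ring.
  ring.
have jac1l : jac 1 N = 1.
  by have := @jacM 1 1 N oN; rewrite mulr1 -expr2 jac_sqr // coprimen1.
have Em (d : nat) : (0 < d)%N -> (d %| `|m|)%N -> jac d N = 1.
  move: d; apply: mul_prime_ind => // p d pp d0 IH dm.
  have pm : (p %| `|m|)%N by apply: dvdn_trans dm; apply: dvdn_mulr.
  rewrite PoszM jacM // IH ?mulr1; last by apply: dvdn_trans dm; apply: dvdn_mull.
  have [->|op] := even_prime pp; first by rewrite jac2 // N8.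
  have cpN : coprime p N by apply: coprime_dvdl pm _; rewrite coprime_sym.
  have := jac_reciprocity op oN cpN; rewrite /qr_sign.
  rewrite N4 andbF expr0 (jac_prime _ pp) (@leg_mod p pp _ (x * x)); last first.
    apply/dvdzP; exists (24 * (m %/ p)%Z * m).
    have : m = (m %/ p)%Z * p by rewrite divzK // dvdzE.
    move: (m %/ p)%Z => y ey; rewrite eN {1}expr2 ey; ring.
  rewrite legM // -expr2 leg_sqr1 ?mulr1 // dvdzE absz_nat.
  by rewrite -prime_coprime // coprime_sym; apply: coprime_dvdr cxm.
rewrite E [jac m N]jabs Em // mulr1 jabs.
have := jac_reciprocity ox oN cxN; rewrite /qr_sign.
rewrite N4 andbF expr0 => rec.
have -> : jac 6 `|x| = jac N `|x|.
  have o2m : coprime `|x| `|(2 * m)%R| by rewrite abszM coprimeMr coprimen2 ox.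
  transitivity (jac 6 `|x| * jac (2 * m) `|x| ^+ 2); first by rewrite jac_sqr // mulr1.
  rewrite expr2 -!jacM //.
  apply: jac_mod => //; apply/dvdzP.
  have [s es] : exists s : int, x = s * `|x|%N%:Z.
    by exists (sgz x); rewrite -intEsg.
  by exists (- (s * x)); rewrite eN expr2 {1}es; ring.
have := @jac_sqr (absz x) N oN; rewrite absz_nat coprime_sym => /(_ cxN) e.
have nz : jac `|x|%N N != 0 by apply: contra_eq_neq e => ->; rewrite expr0n.
by apply: (mulfI nz); rewrite -expr2 e rec.
Qed.

(** The signs of the pentagonal number theorem for - X are the values of the
    character (6 / .) of conductor 24. *)
Lemma jac6_sign (j : int) : jac 6 `|(6 * j - 1)%R| = (-1) ^+ tri_dn j.
Proof.
rewrite jac6; try lia.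
rewrite -[RHS]signr_odd; congr (_ ^+ _).
have [q [r [ej r4]]] : exists q r : int, j = 4 * q + r /\ 0 <= r < 4.
  by exists (j %/ 4)%Z, (j %% 4)%Z; lia.
have := tri_dnE j; rewrite !inE.
have /or4P : [|| r == 0, r == 1, r == 2 | r == 3] by lia.
by case=> /eqP er; rewrite ej er; nia.
Qed.

End Jacobi.

(** * The ring Z[sqrt(-6)] and its ideals *)
Section IdealProduct.
Variable L : splittingFieldType rat.
Implicit Types (K : {subfield L}) (a b J : set L).

Local Notation O K := (ring_of_integers K).

Lemma ideal_mulC a b : ideal_mul a b = ideal_mul b a.
Proof.
suff sub (c d : set L) x : ideal_mul c d x -> ideal_mul d c x.
  by apply/predeqP => x; split; apply: sub.
case=> n [u [v [cu dv ->]]]; exists n, v, u; split=> //.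
by apply: eq_bigr => k _; rewrite mulrC.
Qed.

Lemma ideal_mul_mem a b x y : a x -> b y -> ideal_mul a b (x * y).
Proof.
move=> ax bY; exists 1%N, (fun=> x), (fun=> y).
by split=> //; rewrite big_ord1.
Qed.

Lemma ideal_mulD a b x y :
  ideal_mul a b x -> ideal_mul a b y -> ideal_mul a b (x + y).
Proof.
case=> n [u [v [au bv ->]]] [m [u' [v' [au' bv' ->]]]].
exists (n + m)%N, (fun k : 'I_(n + m) => match fintype.split k with inl i => u i | inr j => u' j end).
exists (fun k : 'I_(n + m) => match fintype.split k with inl i => v i | inr j => v' j end).
split=> [k|k|]; try by case: fintype.split.
rewrite big_split_ord /=; congr (_ + _); apply: eq_bigr => k _.
  by rewrite (unsplitK (inl k)).
by rewrite (unsplitK (inr k)).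
Qed.

Lemma ideal_mulZ K a b c x : (forall c x, O K c -> a x -> a (c * x)) ->
  O K c -> ideal_mul a b x -> ideal_mul a b (c * x).
Proof.
move=> aZ Oc [n [u [v [au bv ->]]]]; exists n, (fun k => c * u k), v.
split=> // [k|]; first exact: aZ.
by rewrite mulr_sumr; apply: eq_bigr => k _; rewrite mulrA.
Qed.

Lemma ideal_mul_sub a b J : J 0 -> (forall x y, J x -> J y -> J (x + y)) ->
  (forall x y, a x -> b y -> J (x * y)) -> (ideal_mul a b `<=` J)%classic.
Proof.
move=> J0 JD ab x [n [u [v [au bv ->]]]].
by apply: (big_ind J) => // k _; apply: ab.
Qed.

End IdealProduct.

Section QuadraticIdeals.
Variables (L : splittingFieldType rat) (K : {subfield L}) (th : L).
Hypothesis th2 : th ^+ 2 = - 6%:R.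

Definition quad_int (u v : int) : L := u%:~R + v%:~R * th.

Local Notation qi := quad_int.

(** The arithmetic of the ideals of K only depends on the coordinates of integers
    on the basis 1, theta. *)
Hypothesis OKE : forall x, ring_of_integers K x <-> exists u v, x = qi u v.
Hypothesis qi_eq0 : forall u v, qi u v = 0 -> u = 0 /\ v = 0.

Local Notation OK := (ring_of_integers K).

Lemma qiD u v u' v' : qi u v + qi u' v' = qi (u + u') (v + v').
Proof. by rewrite /quad_int !intrD; ring. Qed.

Lemma qiN u v : - qi u v = qi (- u) (- v).
Proof. by rewrite /quad_int !intrN; ring. Qed.

Lemma qiB u v u' v' : qi u v - qi u' v' = qi (u - u') (v - v').
Proof. by rewrite qiN qiD. Qed.

Lemma qiM u v u' v' : qi u v * qi u' v' = qi (u * u' - 6 * v * v') (u * v' + v * u').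
Proof.
rewrite /quad_int !(intrD, intrN, intrM).
transitivity (u%:~R * u'%:~R + v%:~R * v'%:~R * th ^+ 2 + (u%:~R * v'%:~R + v%:~R * u'%:~R) * th).
  by ring.
by rewrite th2; ring.
Qed.

Lemma qi_inj u v u' v' : qi u v = qi u' v' -> u = u' /\ v = v'.
Proof.
by move/eqP; rewrite -subr_eq0 qiB => /eqP/qi_eq0[/subr0_eq-> /subr0_eq->].
Qed.

Lemma qi0 : qi 0 0 = 0. Proof. by rewrite /quad_int mul0r addr0. Qed.
Lemma qi1 : qi 1 0 = 1. Proof. by rewrite /quad_int mul0r addr0. Qed.
Lemma qiz u : qi u 0 = u%:~R. Proof. by rewrite /quad_int mul0r addr0. Qed.

Lemma OKqi u v : OK (qi u v). Proof. by apply/OKE; exists u, v. Qed.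

(** The lattice g (Z c + Z (b + theta)), an ideal of norm g^2 c as soon as c
    divides b^2 + 6. *)
Definition quad_lattice (g c b : int) : set L :=
  [set x | exists s t, x = qi (g * (c * s + b * t)) (g * t)].

Local Notation lat := quad_lattice.

Lemma lat_qi g c b u v : lat g c b (qi u v) <->
  exists s t, u = g * (c * s + b * t) /\ v = g * t.
Proof.
split=> [[s [t /qi_inj[-> ->]]]|[s [t [-> ->]]]]; by exists s, t.
Qed.

Lemma latD g c b x y : lat g c b x -> lat g c b y -> lat g c b (x + y).
Proof.
move=> [s [t ->]] [s' [t' ->]]; exists (s + s'), (t + t').
by rewrite qiD; congr qi; ring.
Qed.

Lemma lat0 g c b : lat g c b 0.
Proof. by exists 0, 0; rewrite -qi0; congr qi; ring. Qed.

Lemma latZ g c b x y : (c %| b ^+ 2 + 6)%Z -> OK x -> lat g c b y -> lat g c b (x * y).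
Proof.
move=> /dvdzP[e ec] /OKE[u [v ->]] [s [t ->]]; rewrite qiM.
exists (u * s - v * b * s - v * t * e), (u * t + v * c * s + v * b * t).
have -> : g * (c * (u * s - v * b * s - v * t * e) + b * (u * t + v * c * s + v * b * t)) =
   g * (c * u * s + b * u * t + v * t * (b ^+ 2 - e * c)) by ring.
by rewrite -ec; congr qi; ring.
Qed.

Lemma lat_integral (g c b : int) : 0 < g -> 0 < c -> (c %| b ^+ 2 + 6)%Z ->
  integral_ideal K (lat g c b).
Proof.
move=> g0 c0 dc.
have sub : (lat g c b `<=` OK)%classic by move=> x [s [t ->]]; apply: OKqi.
split=> //; split=> //.
- by move=> x /sub[].
- exists (qi (g * c) 0); first by exists 1, 0; congr qi; ring.
  by apply/eqP => /qi_eq0[]; nia.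
- exact: latD.
- by move=> x y; apply: latZ.
- exists 1; first by rewrite -qi1; split; [apply: OKqi|rewrite qi1 oner_neq0].
  by move=> x /sub; rewrite mul1r.
Qed.

(** Hermite normal form: g generates the second coordinates of J, g c the
    rational integers in J, and the stability of J under theta forces g to divide
    everything and c to divide b^2 + 6. *)
Lemma integral_lat J : integral_ideal K J ->
  exists g c b, [/\ 0 < g, 0 < c, (c %| b ^+ 2 + 6)%Z & J = lat g c b].
Proof.
move=> [[_ [x0 Jx0 nx0] JD JZ _] JO].
have JN x : J x -> J (- x) by rewrite -mulN1r => /JZ; apply; rewrite -qi1 qiN; apply: OKqi.
have Jz (n : int) x : J x -> J (n%:~R * x) by rewrite -qiz; apply: JZ; apply: OKqi.
(* the smallest positive element of a subgroup of the integers generates it *)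
have gen (S : int -> Prop) : (forall x y, S x -> S y -> S (x - y)) ->
    (exists2 x, S x & x != 0) ->
    exists2 g : int, 0 < g /\ S g & forall x, S x -> (g %| x)%Z.
  move=> SB [x Sx nx].
  have S0 : S 0 by rewrite -(subrr x); apply: SB.
  have SN y : S y -> S (- y) by rewrite -sub0r; apply: SB.
  have SM y (n : nat) : S y -> S (y *+ n).
    by move=> Sy; elim: n => // n IH; rewrite mulrSr -[X in _ + X]opprK; apply: SB => //; apply: SN.
  have SMz y (n : int) : S y -> S (n * y).
    move=> Sy; case: n => n; first by rewrite -natz mulr_natl; apply: SM.
    by rewrite NegzE mulNr; apply: SN; rewrite -natz mulr_natl; apply: SM.
  have ex : exists n, `[< (0 < n)%N /\ S n%:Z >].
    exists `|x|%N; apply/asboolP; split; first by rewrite absz_gt0.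
    by have [e|e] := lerP 0 x; [rewrite gez0_abs|rewrite ltz0_abs //; apply: SN].
  case: (ex_minnP ex) => g /asboolP[g0 Sg] gmin.
  exists g%:Z => // y Sy; rewrite /dvdz.
  have Sr : S (y %% g)%Z.
    by rewrite /modz; apply: SB => //; apply: SMz.
  have r0 : 0 <= (y %% g)%Z by rewrite modz_ge0 //; lia.
  have rlt : (y %% g)%Z < g by rewrite ltz_pmod.
  apply/dvdz_mod0P/eqP/negPn/negP => rn0.
  have := gmin `|(y %% g)%Z|%N; rewrite (_ : `[< _ >]); first by lia.
  by apply/asboolP; rewrite gez0_abs //; split=> //; lia.
have [g [g0 [B JB]] gP] : exists2 g : int, 0 < g /\ (exists s, J (qi s g)) &
    forall t, (exists s, J (qi s t)) -> (g %| t)%Z.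
  apply: gen => [x y [s Js] [s' Js']|].
    by exists (s - s'); rewrite -qiB; apply/JD/JN.
  have /OKE[u [v ex]] := JO _ Jx0.
  have [v0|nv0] := eqVneq v 0; last by exists v => //; exists u; rewrite -ex.
  exists u; last by apply: contra_neq nx0 => u0; rewrite ex v0 u0 qi0.
  exists 0; have := JZ (qi 0 1) _ (OKqi 0 1) Jx0.
  by rewrite ex v0 qiM; congr J; congr qi; ring.
have [A [A0 JA] AP] : exists2 A : int, 0 < A /\ J (qi A 0) &
    forall s, J (qi s 0) -> (A %| s)%Z.
  apply: gen => [x y Jx Jy|]; first by have := JD _ _ Jx (JN _ Jy); rewrite qiB subrr.
  exists (B ^+ 2 + 6 * g ^+ 2); last by nia.
  have := JZ (qi B (- g)) _ (OKqi _ _) JB.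
  by rewrite qiM; congr J; congr qi; ring.
have /dvdzP[c ec] : (g %| A)%Z.
  apply: gP; exists 0; have := JZ (qi 0 1) _ (OKqi 0 1) JA.
  by rewrite qiM; congr J; congr qi; ring.
have /dvdzP[b eb] : (g %| B)%Z.
  apply: gP; exists (- (6 * g)); have := JZ (qi 0 1) _ (OKqi 0 1) JB.
  by rewrite qiM; congr J; congr qi; ring.
have dcb : (c %| b ^+ 2 + 6)%Z.
  have /AP : J (qi (g * (b ^+ 2 + 6)) 0).
    have := JZ (qi b (- 1)) _ (OKqi _ _) JB; rewrite qiM eb.
    by congr J; congr qi; ring.
  by rewrite ec [c * g]mulrC dvdz_mul2l; lia.
exists g, c, b; split=> //; first by nia.
apply/predeqP => x; split=> [Jx|[s [t ->]]].
  have /OKE[u [v ex]] := JO _ Jx.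
  have /dvdzP[t et] : (g %| v)%Z by apply: gP; exists u; rewrite -ex.
  have /dvdzP[s es] : (A %| u - t * B)%Z.
    apply: AP; have := JD _ _ Jx (JN _ (Jz t _ JB)); rewrite ex -qiz qiM qiB.
    by congr J; rewrite et; congr qi; ring.
  exists s, t; rewrite ex et; congr qi; last by ring.
  by move/eqP: es; rewrite subr_eq => /eqP->; rewrite ec eb; ring.
have -> : qi (g * (c * s + b * t)) (g * t) = s%:~R * qi A 0 + t%:~R * qi B g.
  by rewrite -!qiz !qiM qiD ec eb; congr qi; ring.
by apply: JD; apply: Jz.
Qed.

(** The numbers u + v theta with 0 <= v < g and 0 <= u < g c represent the residue
    classes. *)
Lemma lat_norm (g c b : int) : 0 < g -> 0 < c ->
  absolute_norm K (lat g c b) = (`|g| ^ 2 * `|c|)%N.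
Proof.
move=> g0 c0; rewrite /absolute_norm; apply: card_fset_set.
pose G := `|g|%N; pose C := `|c|%N.
have eg : g = G by rewrite gez0_abs // ltW.
have ec : c = C by rewrite gez0_abs // ltW.
have G0 : (0 < G)%N by rewrite /G; lia.
pose f (k : nat) : set L := [set y | lat g c b (y - qi (k %/ G)%N (k %% G)%N)]%classic.
have coset_eq x x' : lat g c b (x - x') ->
    [set y | lat g c b (y - x)]%classic = [set y | lat g c b (y - x')]%classic.
  move=> d; apply/predeqP => y; split=> h.
    by have := latD h d; rewrite subrKA.
  have dN : lat g c b (x' - x).
    by case: d => s [t e]; exists (- s), (- t); rewrite -opprB e qiN; congr qi; ring.
  by have := latD h dN; rewrite subrKA.
have -> : [set [set y | lat g c b (y - x)] | x in OK]%classic = (f @` `I_(G ^ 2 * C))%classic.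
  apply/predeqP => S; split=> [[x /OKE[u [v ->]] <-]|[k _ <-]]; last first.
    by exists (qi (k %/ G)%N (k %% G)%N) => //; apply: OKqi.
  pose t := (v %/ g)%Z; pose w := (v %% g)%Z.
  pose u' := u - g * b * t; pose s := (u' %/ (g * c))%Z; pose z := (u' %% (g * c))%Z.
  have gc0 : 0 < g * c by nia.
  have w0 : 0 <= w < g by rewrite modz_ge0 ?ltz_pmod //; lia.
  have z0 : 0 <= z < g * c by rewrite modz_ge0 ?ltz_pmod //; lia.
  have ev : v = g * t + w by rewrite mulrC; apply: divz_eq.
  have eu : u = g * (c * s + b * t) + z.
    have : u' = s * (g * c) + z by apply: divz_eq.
    by rewrite /u' => /eqP; rewrite subr_eq => /eqP->; ring.
  have lw : (`|w| < G)%N by lia.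
  exists (`|z| * G + `|w|)%N.
    by rewrite /= ; have : (`|z| < G * C)%N by [lia]; nia.
  rewrite /f divnMDl // divn_small // addn0 modnMDl modn_small //.
  apply: coset_eq; exists (- s), (- t); rewrite qiB !gez0_abs; try lia.
  by rewrite ev eu; congr qi; ring.
apply: inj_card_eq => j k /set_mem /= jlt /set_mem /= klt e.
have : f k (qi (j %/ G)%N (j %% G)%N) by rewrite -e /f /= subrr; apply: lat0.
rewrite /f /= qiB => /lat_qi[s [t [e1 e2]]].
have jm : (j %% G < G)%N by rewrite ltn_mod.
have km : (k %% G < G)%N by rewrite ltn_mod.
have jd : (j %/ G < G * C)%N by rewrite ltn_divLR //; nia.
have kd : (k %/ G < G * C)%N by rewrite ltn_divLR //; nia.
have t0 : t = 0 by nia.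
have s0 : s = 0.
  have {}e1 : (j %/ G)%N%:Z - (k %/ G)%N%:Z = (G * C)%N%:Z * s by rewrite e1 t0 eg ec; lia.
  nia.
rewrite (divn_eq j G) (divn_eq k G); subst s t; congr (_ * _ + _)%N; lia.
Qed.

Lemma lat_absorb (g c b : int) : (c %| b ^+ 2 + 6)%Z ->
  forall x y, OK x -> lat g c b y -> lat g c b (x * y).
Proof. by move=> dc x y; apply: latZ. Qed.

Lemma square_dvd24 (e r : int) : 0 <= e -> 24 = e ^+ 2 * r -> e = 1 \/ e = 2.
Proof.
rewrite expr2 => e0 er; have r0 : 0 < r by nia.
have e5 : e < 5.
  by rewrite ltNge; apply/negP => e5; have e25 : 25 <= e * e; nia.
have [ee|[ee|[ee|[ee|ee]]]] : e = 0 \/ e = 3 \/ e = 4 \/ e = 1 \/ e = 2 by lia.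
- by move: er; rewrite ee; lia.
- by move: er; rewrite ee; lia.
- by move: er; rewrite ee; lia.
- by left.
- by right.
Qed.

(** The discriminant -24 is fundamental: a common divisor e of c, c' and 2b has
    a square that divides 4(b^2 + 6) - (2b)^2 = 24, and e = 2 is impossible because
    b^2 + 6 is never divisible by 4. *)
Lemma disc_gcd (c c' b : int) : (c * c' %| b ^+ 2 + 6)%Z ->
  exists A B C : int, A * c + B * c' + C * (2 * b) = 1.
Proof.
move=> d; have [u [v e1]] := Bezoutz c c'; have [w [z e2]] := Bezoutz (gcdz c c') (2 * b).
set e := gcdz (gcdz c c') (2 * b) in e2; suff e1' : e = 1.
  by exists (w * u), (w * v), z; rewrite -[RHS]e1' -e2 -e1; ring.
have dg : (e %| gcdz c c')%Z by apply: dvdz_gcdl.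
have /dvdzP[x ex] : (e %| c)%Z by apply: dvdz_trans dg (dvdz_gcdl _ _).
have /dvdzP[y ey] : (e %| c')%Z by apply: dvdz_trans dg (dvdz_gcdr _ _).
have /dvdzP[t et] : (e %| 2 * b)%Z by apply: dvdz_gcdr.
have e0 : 0 <= e by rewrite /e.
case/dvdzP: d => q; rewrite ex ey => eq.
have : 24 = e ^+ 2 * (4 * q * x * y - t ^+ 2).
  have -> : 24 = 4 * (b ^+ 2 + 6) - (2 * b) ^+ 2 by ring.
  by rewrite eq et; ring.
set r := 4 * q * x * y - t ^+ 2 => e24.
have : e = 1 \/ e = 2.
  exact: square_dvd24 e0 e24.
case=> // e2'; exfalso.
move: eq; rewrite e2' => eq.
have {eq}: b ^+ 2 + 6 = 4 * (q * x * y) by rewrite eq; ring.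
have [k [ek|ek]] : exists k : int, b = k * 2 \/ b = k * 2 + 1 by exists (b %/ 2)%Z; lia.
  have -> : b ^+ 2 + 6 = 4 * k ^+ 2 + 6 by rewrite ek; ring.
  by move: (k ^+ 2) (q * x * y) => ? ?; lia.
have -> : b ^+ 2 + 6 = 4 * (k ^+ 2 + k) + 7 by rewrite ek; ring.
by move: (k ^+ 2) (q * x * y) => ? ?; lia.
Qed.

(** The product contains c, c' and 2b times b + theta, the last one from
    (b + theta)^2, hence b + theta itself by [disc_gcd]. *)
Lemma lat_mul (c c' b : int) : (c * c' %| b ^+ 2 + 6)%Z ->
  ideal_mul (lat 1 c b) (lat 1 c' b) = lat 1 (c * c') b.
Proof.
move=> d; have [e ee] := dvdzP d.
have dc : (c %| b ^+ 2 + 6)%Z by apply: dvdz_trans d; apply: dvdz_mulr.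
apply/predeqP => x; split; move: x.
  apply: ideal_mul_sub; [exact: lat0|exact: latD|].
  move=> _ _ [s [t ->]] [s' [t' ->]]; rewrite qiM.
  exists (s * s' - e * t * t'), (c * s * t' + t * c' * s' + 2 * b * t * t').
  have -> : 1 * (c * s + b * t) * (1 * (c' * s' + b * t')) - 6 * (1 * t) * (1 * t') =
     1 * (c * c' * s * s' + b * (c * s * t' + t * c' * s' + 2 * b * t * t') - t * t' * (b ^+ 2 + 6)) by ring.
  by rewrite ee; congr qi; ring.
move=> _ [s [t ->]]; have [A [B [C eABC]]] := disc_gcd d.
have az := lat_absorb (g := 1) dc.
have mulz k u v : lat 1 c b u -> lat 1 c' b v -> ideal_mul (lat 1 c b) (lat 1 c' b) (qi k 0 * (u * v)).
  by move=> hu hv; apply: (ideal_mulZ az); [apply: OKqi | apply: ideal_mul_mem].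
have h1 (c0 : int) : lat 1 c0 b (qi c0 0) by exists 1, 0; congr qi; ring.
have h2 (c0 : int) : lat 1 c0 b (qi b 1) by exists 0, 1; congr qi; ring.
have -> : qi (1 * (c * c' * s + b * t)) (1 * t) =
  qi (s + t * C * e) 0 * (qi c 0 * qi c' 0) + (qi (t * A) 0 * (qi c 0 * qi b 1)
   + (qi (t * B) 0 * (qi b 1 * qi c' 0) + qi (t * C) 0 * (qi b 1 * qi b 1))).
  rewrite !qiM !qiD; congr qi.
    transitivity (s * c * c' + t * b * (A * c + B * c' + C * (2 * b)) + t * C * (e * (c * c') - (b ^+ 2 + 6))); last by ring.
    by rewrite eABC ee; ring.
  by transitivity (t * (A * c + B * c' + C * (2 * b))); [rewrite eABC|]; ring.
by do !apply: ideal_mulD; apply: mulz.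
Qed.

Lemma lat_scale (g g' c b : int) : (c %| b ^+ 2 + 6)%Z ->
  ideal_mul (lat g 1 0) (lat g' c b) = lat (g * g') c b.
Proof.
move=> dc; have [e ee] := dvdzP dc; apply/predeqP => x; split; move: x.
  apply: ideal_mul_sub; [exact: lat0|exact: latD|].
  move=> _ y [s [t ->]] hy.
  have -> : qi (g * (1 * s + 0 * t)) (g * t) = qi s t * qi g 0 by rewrite qiM; congr qi; ring.
  rewrite -mulrA; apply: latZ => //; first exact: OKqi.
  case: hy => s' [t' ->]; exists s', t'; rewrite qiM; congr qi; ring.
move=> _ [s [t ->]].
have -> : qi (g * g' * (c * s + b * t)) (g * g' * t) = qi g 0 * qi (g' * (c * s + b * t)) (g' * t).
  by rewrite qiM; congr qi; ring.
apply: ideal_mul_mem; last by exists s, t.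
by exists 1, 0; congr qi; ring.
Qed.

(** Here [disc_gcd] is applied to p and (b^2 + 6) / p. *)
Lemma lat_split (p b : int) : (p %| b ^+ 2 + 6)%Z ->
  ideal_mul (lat 1 p b) (lat 1 p (- b)) = lat p 1 0.
Proof.
move=> d; have [e ee] := dvdzP d; apply/predeqP => x; split; move: x.
  apply: ideal_mul_sub; [exact: lat0|exact: latD|].
  move=> _ _ [s [t ->]] [s' [t' ->]]; rewrite qiM.
  exists (p * s * s' - b * s * t' + b * t * s' - e * t * t'), (s * t' + t * s').
  have -> : 1 * (p * s + b * t) * (1 * (p * s' + - b * t')) - 6 * (1 * t) * (1 * t') =
     p * (p * s * s' - b * s * t' + b * t * s') - t * t' * (b ^+ 2 + 6) by ring.
  by rewrite ee; congr qi; ring.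
move=> _ [s [t ->]].
have d' : (e * p %| b ^+ 2 + 6)%Z by rewrite ee.
have [C [A [B eABC]]] := disc_gcd d'.
have az := lat_absorb (g := 1) d.
have mulz z u v : OK z -> lat 1 p b u -> lat 1 p (- b) v ->
    ideal_mul (lat 1 p b) (lat 1 p (- b)) (z * (u * v)).
  by move=> Oz hu hv; apply: (ideal_mulZ az) => //; apply: ideal_mul_mem.
have h1 (b0 : int) : lat 1 p b0 (qi p 0) by exists 1, 0; congr qi; ring.
have h2 (b0 : int) : lat 1 p b0 (qi b0 1) by exists 0, 1; congr qi; ring.
have -> : qi (p * (1 * s + 0 * t)) (p * t) =
  (qi s t * qi A 0) * (qi p 0 * qi p 0) + ((qi s t * qi B 0) * (qi b 1 * qi p 0)
   + ((qi s t * qi (- B) 0) * (qi p 0 * qi (- b) 1) + (qi s t * qi (- C) 0) * (qi b 1 * qi (- b) 1))).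
  have -> : qi (p * (1 * s + 0 * t)) (p * t) = qi s t * qi p 0 by rewrite qiM; congr qi; ring.
  rewrite -!mulrA -!mulrDr; congr (_ * _); rewrite !qiM !qiD; congr qi; last by ring.
  transitivity (p * (C * e + A * p + B * (2 * b)) + C * (b ^+ 2 + 6 - e * p)); last by ring.
  by rewrite eABC ee; ring.
by do !apply: ideal_mulD; apply: mulz => //; rewrite qiM; apply: OKqi.
Qed.

Lemma lat1P (c b u v : int) : lat 1 c b (qi u v) <-> (c %| u - b * v)%Z.
Proof.
rewrite lat_qi; split=> [[s [t [-> ->]]]|/dvdzP[s es]].
  by apply/dvdzP; exists s; ring.
exists s, v; split; last by ring.
by move/eqP: es; rewrite subr_eq => /eqP->; ring.
Qed.

Lemma latzP (g u v : int) : lat g 1 0 (qi u v) <-> (g %| u)%Z /\ (g %| v)%Z.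
Proof.
rewrite lat_qi; split=> [[s [t [-> ->]]]|[/dvdzP[s ->] /dvdzP[t ->]]].
  by split; apply: dvdz_mulr.
by exists s, t; split; ring.
Qed.

Lemma dvdz_prime_mul (p : nat) (x y : int) : prime p ->
  (p %| x * y)%Z = (p %| x)%Z || (p %| y)%Z.
Proof. by move=> pp; rewrite !dvdzE abszM absz_nat Euclid_dvdM. Qed.

Lemma prime_dvdz1 (p : nat) : prime p -> ~~ (p %| 1)%Z.
Proof. by move=> pp; rewrite dvdzE absz_nat dvdn1; case: p pp => [|[]]. Qed.

Lemma lat_prime_split (p : nat) (b : int) : prime p -> (p %| b ^+ 2 + 6)%Z ->
  prime_ideal K (lat 1 p b).
Proof.
move=> pp d; have p0 := prime_gt0 pp; split.
- by apply: lat_integral.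
- by rewrite -qi1 lat1P mulr0 subr0; apply/negP/prime_dvdz1.
move=> _ _ /OKE[u [v ->]] /OKE[u' [v' ->]]; rewrite qiM !lat1P => h.
apply/orP; rewrite -dvdz_prime_mul //.
have -> : (u - b * v) * (u' - b * v') =
  (u * u' - 6 * v * v' - b * (u * v' + v * u')) + v * v' * (b ^+ 2 + 6) by ring.
by rewrite rpredD // dvdz_mull.
Qed.

(** If p does not divide v, then u / v is a square root of - 6 modulo p. *)
Lemma inert_dvd (p : nat) (u v : int) : prime p ->
  (forall b : int, ~~ (p %| b ^+ 2 + 6)%Z) ->
  (p %| u ^+ 2 + 6 * v ^+ 2)%Z -> (p %| u)%Z /\ (p %| v)%Z.
Proof.
move=> pp nb d; have [pv|pv] := boolP (p %| v)%Z.
  split=> //; have : (p %| u * u)%Z.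
    have -> : u * u = (u ^+ 2 + 6 * v ^+ 2) - 6 * v * v by ring.
    by rewrite rpredB // dvdz_mull.
  by rewrite dvdz_prime_mul // orbb.
have cpv : coprimez p v by rewrite coprimezE absz_nat prime_coprime // -dvdzE in pv *.
have [[A B] /= eAB] := coprimezP _ _ cpv.
have /negP[] := nb (u * B).
have -> : (u * B) ^+ 2 + 6 = B ^+ 2 * (u ^+ 2 + 6 * v ^+ 2) + 6 * (1 - B * v) * (1 + B * v) by ring.
apply: rpredD; first exact: dvdz_mull.
rewrite -mulrA; apply/dvdz_mull/dvdz_mulr.
by apply/dvdzP; exists A; rewrite -eAB; ring.
Qed.

Lemma lat_prime_inert (p : nat) : prime p ->
  (forall b : int, ~~ (p %| b ^+ 2 + 6)%Z) -> prime_ideal K (lat p 1 0).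
Proof.
move=> pp nb; have p0 := prime_gt0 pp; split.
- by apply: lat_integral.
- by rewrite -qi1 latzP => -[p1 _]; move: p1; apply/negP/prime_dvdz1.
move=> _ _ /OKE[u [v ->]] /OKE[u' [v' ->]]; rewrite qiM !latzP => -[h1 h2].
have /orP : (p %| (u ^+ 2 + 6 * v ^+ 2))%Z || (p %| (u' ^+ 2 + 6 * v' ^+ 2))%Z.
  rewrite -dvdz_prime_mul //.
  have -> : (u ^+ 2 + 6 * v ^+ 2) * (u' ^+ 2 + 6 * v' ^+ 2) =
    (u * u' - 6 * v * v') * (u * u' - 6 * v * v') + 6 * (u * v' + v * u') * (u * v' + v * u') by ring.
  by rewrite rpredD // dvdz_mull.
by case=> /(inert_dvd pp nb); [left|right].
Qed.

Lemma qnorm_gt0 (u v : int) : (u != 0) || (v != 0) -> 0 < u ^+ 2 + 6 * v ^+ 2.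
Proof.
have u2 := sqr_ge0 u; have v2 := sqr_ge0 v.
by case/orP; rewrite -sqrf_eq0 => /eqP; lia.
Qed.

(** Up to the content g, the ideal generated by u' + v' theta with coprime u' and
    v' has cyclic quotient, in which theta becomes the integer - b. *)
Lemma principal_lat (u v : int) : (u != 0) || (v != 0) ->
  exists g u' v' N b : int, [/\ 0 < g, 0 < N, u = g * u' /\ v = g * v', coprimez u' v' &
    [/\ N = u' ^+ 2 + 6 * v' ^+ 2, (N %| u' - b * v')%Z, (N %| b ^+ 2 + 6)%Z &
      principal K (qi u v) = lat g N b]].
Proof.
move=> nz; pose g := gcdz u v.
have g0 : 0 < g by rewrite lt_neqAle /g eq_sym gcdz_eq0 negb_and nz.
have /dvdzP[u' eu] : (g %| u)%Z by apply: dvdz_gcdl.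
have /dvdzP[v' ev] : (g %| v)%Z by apply: dvdz_gcdr.
have [A [B eAB]] : exists A B : int, A * u' + B * v' = 1.
  have [A [B e]] := Bezoutz u v; exists A, B; apply: (mulIf (_ : g != 0)); first by lia.
  by rewrite mul1r [in RHS]/g -e [in RHS]eu [in RHS]ev; ring.
pose N := u' ^+ 2 + 6 * v' ^+ 2.
(* w is the inverse of v' modulo N, read off from the square of A u' + B v' = 1 *)
pose w := 2 * A * B * u' + B ^+ 2 * v' - 6 * A ^+ 2 * v'.
have evw : v' * w = 1 - A ^+ 2 * N.
  transitivity ((A * u' + B * v') ^+ 2 - A ^+ 2 * N); last by rewrite eAB expr1n.
  by rewrite /w /N; ring.
have e1 : u' - u' * w * v' = u' * A ^+ 2 * N.
  transitivity (u' * (1 - v' * w)); first by ring.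
  by rewrite evw; ring.
have e2 : (u' * w) ^+ 2 + 6 = (w ^+ 2 + 12 * A ^+ 2 - 6 * A ^+ 4 * N) * N.
  transitivity (w ^+ 2 * N - 6 * (v' * w) ^+ 2 + 6); first by rewrite /N; ring.
  by rewrite evw; ring.
have dN : (N %| (u' * w) ^+ 2 + 6)%Z by apply/dvdzP; eexists; exact: e2.
have N0 : 0 < N.
  apply: qnorm_gt0; move: nz; rewrite eu ev !mulf_eq0 !negb_or.
  by case/orP=> /andP[-> _]; rewrite ?orbT.
exists g, u', v', N, (u' * w); split=> //.
- by rewrite ![g * _]mulrC.
- by apply/coprimezP; exists (A, B).
split=> //; first by apply/dvdzP; eexists; exact: e1.
apply/predeqP => x; split=> [[c Oc <-]|[s [t ->]]].
  apply: latZ => //; rewrite lat_qi; exists (u' * A ^+ 2), v'.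
  by split; last (by rewrite ev mulrC); rewrite [in LHS]eu -[X in X * g](subrK (u' * w * v')) e1; ring.
have e3 : u' * w * u' + 6 * v' = (w + 6 * v' * A ^+ 2) * N.
  transitivity (N * w + 6 * v' * (1 - v' * w)); first by rewrite /N; ring.
  by rewrite evw; ring.
exists (qi u' (- v') * qi s 0 + qi (w + 6 * v' * A ^+ 2) (u' * A ^+ 2) * qi t 0).
  by rewrite !qiM qiD; apply: OKqi.
rewrite !qiM qiD qiM eu ev; congr qi.
  transitivity (g * (s * (u' ^+ 2 + 6 * v' ^+ 2) + t * ((w + 6 * v' * A ^+ 2) * u' - 6 * v' * u' * A ^+ 2))).
    by ring.
  by rewrite -/N; ring.
transitivity (g * t * (v' * w + A ^+ 2 * N)); first by rewrite /N; ring.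
by rewrite evw; ring.
Qed.

(** Gauss reduction of binary forms of discriminant -24; the reduced ones are
    x^2 + 6y^2 and 2x^2 + 3y^2. *)
Lemma form_reduction (A B C : int) : 0 < A -> A * C = B ^+ 2 + 6 ->
  exists x y : int, A * x ^+ 2 + 2 * B * x * y + C * y ^+ 2 = 1 \/
                    A * x ^+ 2 + 2 * B * x * y + C * y ^+ 2 = 2.
Proof.
have [n] := ubnP `|A|%N; elim: n => // n IH in A B C * => An A0 e.
have [k kB] : exists k : int, - A <= 2 * (B - k * A) <= A.
  exists ((2 * B + A) %/ (2 * A))%Z.
  have := divz_eq (2 * B + A) (2 * A); have := modz_ge0 (2 * B + A) (_ : 2 * A != 0).
  have := ltz_pmod (2 * B + A) (_ : 0 < 2 * A).
  by move: (_ %/ _)%Z (_ %% _)%Z => q r; nia.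
pose B' := B - k * A; pose C' := C - 2 * k * B + k ^+ 2 * A.
have e' : A * C' = B' ^+ 2 + 6.
  transitivity (A * C - 2 * k * B * A + k ^+ 2 * A ^+ 2); first by rewrite /C'; ring.
  by rewrite e /B'; ring.
suff [x [y h]] : exists x y : int, A * x ^+ 2 + 2 * B' * x * y + C' * y ^+ 2 = 1 \/
    A * x ^+ 2 + 2 * B' * x * y + C' * y ^+ 2 = 2.
  exists (x - k * y), y.
  have -> : A * (x - k * y) ^+ 2 + 2 * B * (x - k * y) * y + C * y ^+ 2 =
    A * x ^+ 2 + 2 * B' * x * y + C' * y ^+ 2 by rewrite /B' /C'; ring.
  exact: h.
have {}kB : - A <= 2 * B' <= A by [].
move: B' C' e' kB => {e k B C} B C e kB.
have [lt|ge] := ltP C A.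
  have C0 : 0 < C by nia.
  have [||x [y h]] := IH C B A _ C0; [lia|by rewrite mulrC|].
  exists y, x.
  have -> : A * y ^+ 2 + 2 * B * y * x + C * x ^+ 2 =
    C * x ^+ 2 + 2 * B * x * y + A * y ^+ 2 by ring.
  exact: h.
have : A < 3 by nia.
move=> A3; exists 1, 0; have : A = 1 \/ A = 2 by lia.
by case=> ->; [left|right]; ring.
Qed.

(** The reduced form that represents the norm form of the ideal decides whether
    the ideal is principal. *)
Lemma lat_classes (c b : int) : 0 < c -> (c %| b ^+ 2 + 6)%Z ->
  (exists u v, u ^+ 2 + 6 * v ^+ 2 = c /\ lat 1 c b = principal K (qi u v)) \/
  (exists u v, u ^+ 2 + 6 * v ^+ 2 = 2 * c).
Proof.
move=> c0 dc; have [C eC] := dvdzP dc.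
have [x [y h]] := form_reduction c0 (esym (etrans eC (mulrC C c))).
have N : (c * x + b * y) ^+ 2 + 6 * y ^+ 2 =
    (c * x ^+ 2 + 2 * b * x * y + C * y ^+ 2) * c.
  transitivity (c ^+ 2 * x ^+ 2 + 2 * b * x * y * c + y ^+ 2 * (b ^+ 2 + 6)); first by ring.
  by rewrite eC; ring.
case: h => f; rewrite f in N; [left|right]; exists (c * x + b * y), y => //.
rewrite mul1r in N; split=> //; apply/predeqP => z; split=> [[s [t ->]]|[d Od <-]].
  exists (qi (c * x + b * y) (- y) * qi s 0 + qi (b * x + y * C) x * qi t 0).
    by rewrite !qiM qiD; apply: OKqi.
  rewrite !qiM qiD qiM; congr qi.
    transitivity (s * ((c * x + b * y) ^+ 2 + 6 * y ^+ 2) + t * (b * (c * x ^+ 2 + 2 * b * x * y + C * y ^+ 2) + x * y * (C * c - (b ^+ 2 + 6)))).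
      by ring.
    by rewrite N f eC; ring.
  transitivity (t * (c * x ^+ 2 + 2 * b * x * y + C * y ^+ 2)); first by ring.
  by rewrite f; ring.
by apply: latZ => //; exists x, y; congr qi; ring.
Qed.

Lemma principalN x : principal K (- x) = principal K x.
Proof.
have sub y z : principal K y z -> principal K (- y) z.
  case=> c /OKE[u [v ->]] <-; exists (qi (- u) (- v)); first exact: OKqi.
  by rewrite -qiN mulrNN.
by apply/predeqP => z; split=> /sub; rewrite ?opprK.
Qed.

Lemma int_sqr3 (x : int) : exists k, x ^+ 2 = 3 * k \/ x ^+ 2 = 3 * k + 1.
Proof.
have [q [e|[e|e]]] : exists q : int, x = q * 3 \/ x = q * 3 + 1 \/ x = q * 3 - 1.
  by exists ((x + 1) %/ 3)%Z; lia.
- by exists (3 * q ^+ 2); left; rewrite e; ring.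
- by exists (3 * q ^+ 2 + 2 * q); right; rewrite e; ring.
- by exists (3 * q ^+ 2 - 2 * q); right; rewrite e; ring.
Qed.

Lemma norm_one_mod24 (U V n : int) : U ^+ 2 + 6 * V ^+ 2 = 24 * n + 1 ->
  exists k m, (U = 6 * k - 1 \/ U = 1 - 6 * k) /\ V = 2 * m.
Proof.
move=> e; have [m [eV|eV]] : exists m : int, V = m * 2 \/ V = m * 2 + 1.
    by exists (V %/ 2)%Z; lia.
  have [k3 e3] := int_sqr3 U.
  have [k [eU|[eU|[eU|[eU|[eU|eU]]]]]] : exists k : int, U = 6 * k - 1 \/ U = 1 - 6 * k
    \/ U = 6 * k \/ U = 6 * k + 2 \/ U = 6 * k + 3 \/ U = 6 * k - 2.
  - have [r|r] : (U %% 6)%Z = 1 \/ (U %% 6)%Z <> 1 by lia.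
      by exists (- (U %/ 6)%Z); lia.
    by exists ((U + 2) %/ 6)%Z; lia.
  - by exists k, m; split; [left|rewrite mulrC].
  - by exists k, m; split; [right|rewrite mulrC].
  - have : (6 * k) ^+ 2 = 2 * (18 * k ^+ 2) by ring.
    by rewrite -eU; move: (U ^+ 2) (V ^+ 2) (k ^+ 2) e => *; lia.
  - have : (6 * k + 2) ^+ 2 = 2 * (18 * k ^+ 2 + 12 * k + 2) by ring.
    by rewrite -eU; move: (U ^+ 2) (V ^+ 2) (k ^+ 2) e => *; lia.
  - have : (6 * k + 3) ^+ 2 = 3 * (12 * k ^+ 2 + 12 * k + 3) by ring.
    by rewrite -eU; move: (U ^+ 2) (V ^+ 2) (k ^+ 2) e => *; lia.
  - have : (6 * k - 2) ^+ 2 = 2 * (18 * k ^+ 2 - 12 * k + 2) by ring.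
    by rewrite -eU; move: (U ^+ 2) (V ^+ 2) (k ^+ 2) e => *; lia.
exfalso; have [k ek] := even_mulS m.
have [q [eU|eU]] : exists q : int, U = q * 2 \/ U = q * 2 + 1 by exists (U %/ 2)%Z; lia.
  have e4 : U ^+ 2 = 2 * (2 * q ^+ 2) by rewrite eU; ring.
  by move: e4 e; move: (U ^+ 2) (V ^+ 2) (q ^+ 2) => *; lia.
have [l el] := even_mulS q.
have eU8 : U ^+ 2 = 4 * (l * 2) + 1 by rewrite -el eU; ring.
have eV8 : V ^+ 2 = 4 * (k * 2) + 1 by rewrite -ek eV; ring.
by move: eU8 eV8 e; move: (U ^+ 2) (V ^+ 2) => *; lia.
Qed.

(** The class number is 2, but the norms 2x^2 + 3y^2 of the ideals in the
    nontrivial class are never 1 modulo 3.  A generator is determined up to sign,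
    and the sign is normalized so that the rational part is -1 modulo 6. *)
Lemma ideal_one_mod24 J n : integral_ideal K J -> absolute_norm K J = (24 * n + 1)%N ->
  exists k m : int, (6 * k - 1) ^+ 2 + 24 * m ^+ 2 = (24 * n + 1)%N /\
    J = principal K (qi (6 * k - 1) (2 * m)).
Proof.
move=> /integral_lat[g [c [b [g0 c0 dc ->]]]]; rewrite lat_norm // => nE.
have {}nE : g ^+ 2 * c = 24 * n%:Z + 1.
  by rewrite -[g]gez0_abs ?ltW // -[c]gez0_abs ?ltW //; lia.
have [[u [v [uv pr]]]|[u [v uv]]] := lat_classes c0 dc; last first.
  exfalso; have [p ep] := int_sqr3 g; have [q eq] := int_sqr3 u.
  have : g ^+ 2 * (u ^+ 2 + 6 * v ^+ 2) = 2 * (24 * n%:Z + 1) by rewrite uv -nE; ring.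
  case: ep => ep; rewrite ep.
    have -> : 3 * p * (u ^+ 2 + 6 * v ^+ 2) = 3 * (p * (u ^+ 2 + 6 * v ^+ 2)) by ring.
    by move: (p * _) => *; lia.
  case: eq => eq; rewrite eq.
    have -> : (3 * p + 1) * (3 * q + 6 * v ^+ 2) = 3 * (3 * p * q + 6 * p * v ^+ 2 + q + 2 * v ^+ 2) by ring.
    by move: (_ + 2 * _) => *; lia.
  have -> : (3 * p + 1) * (3 * q + 1 + 6 * v ^+ 2) = 3 * (3 * p * q + p + 6 * p * v ^+ 2 + q + 2 * v ^+ 2) + 1 by ring.
  by move: (_ + 2 * _) => *; lia.
have N : (g * u) ^+ 2 + 6 * (g * v) ^+ 2 = 24 * n%:Z + 1 by rewrite -nE -uv; ring.
have {pr}pr : lat g c b = principal K (qi (g * u) (g * v)).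
  apply/predeqP => x; split=> [[s [t ->]]|[d Od <-]].
    have : lat 1 c b (qi (c * s + b * t) t) by exists s, t; congr qi; ring.
    rewrite pr => -[d Od ed]; exists d => //.
    have -> : qi (g * u) (g * v) = qi u v * qi g 0 by rewrite qiM; congr qi; ring.
    by rewrite mulrA ed qiM; congr qi; ring.
  apply: latZ => //; have : lat 1 c b (qi u v).
    by rewrite pr; exists 1; [rewrite -qi1; apply: OKqi|rewrite mul1r].
  by rewrite !lat_qi => -[s [t [-> ->]]]; exists s, t; split; ring.
have [k [m [eU eV]]] := norm_one_mod24 N.
case: eU => eU; rewrite eU eV in N pr; [exists k, m|exists k, (- m)].
  by split=> //; transitivity (24 * n%:Z + 1); [rewrite -N; ring|lia].
split; first by transitivity (24 * n%:Z + 1); [rewrite -N; ring|lia].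
by rewrite pr -principalN qiN; congr (principal K (qi _ _)); ring.
Qed.

Lemma principal_norm (u v : int) : (u != 0) || (v != 0) ->
  absolute_norm K (principal K (qi u v)) = `|(u ^+ 2 + 6 * v ^+ 2)%R|%N.
Proof.
move=> /principal_lat[g [u' [v' [N [b [g0 N0 [-> ->] _ [eN _ _ ->]]]]]]].
rewrite lat_norm // -[(_ ^ 2)%N]absz_nat -abszM; congr absz.
have -> : (`|g| ^ 2)%N%:Z = g ^+ 2 by rewrite -[in RHS](gez0_abs (ltW g0)); lia.
by rewrite eN; ring.
Qed.

Lemma principal_integral (u v : int) : (u != 0) || (v != 0) ->
  integral_ideal K (principal K (qi u v)).
Proof.
by move=> /principal_lat[g [u' [v' [N [b [g0 N0 _ _ [_ _ dN ->]]]]]]]; apply: lat_integral.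
Qed.

Lemma qnorm_eq1 (u v u' v' : int) :
  (u ^+ 2 + 6 * v ^+ 2) * (u' ^+ 2 + 6 * v' ^+ 2) = 1 -> (u = 1 \/ u = -1) /\ v = 0.
Proof.
have := sqr_ge0 u; have := sqr_ge0 v; have := sqr_ge0 u'; have := sqr_ge0 v'.
move=> a1 a2 a3 a4 e; have {e} : u ^+ 2 + 6 * v ^+ 2 = 1.
  have X0 : 0 <= u ^+ 2 + 6 * v ^+ 2 by lia.
  have Y0 : 0 <= u' ^+ 2 + 6 * v' ^+ 2 by lia.
  move: X0 Y0 e; move: (u ^+ 2 + _) (u' ^+ 2 + _) => X Y X0 Y0 e.
  have nX : X <> 0 by move=> x0; rewrite x0 mul0r in e.
  have nY : Y <> 0 by move=> y0; rewrite y0 mulr0 in e.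
  have h : 0 <= (X - 1) * (Y - 1) by apply: mulr_ge0; lia.
  have {}h : 0 <= X * Y - X - Y + 1 by move: h; congr (_ <= _); ring.
  by rewrite e in h; lia.
move=> e; have v2 : v ^+ 2 = 0 by lia.
have u2 : u ^+ 2 == 1 by rewrite v2 in e; lia.
split; last by apply/eqP; rewrite -sqrf_eq0 v2.
by move: u2; rewrite sqrf_eq1 => /orP[]/eqP; [left|right].
Qed.

Lemma principal_inj (k m k' m' : int) :
  principal K (qi (6 * k - 1) (2 * m)) = principal K (qi (6 * k' - 1) (2 * m')) ->
  k = k' /\ m = m'.
Proof.
move=> e; have O1 : OK 1 by rewrite -qi1; apply: OKqi.
have : principal K (qi (6 * k - 1) (2 * m)) (qi (6 * k' - 1) (2 * m')).
  by rewrite e; exists 1; rewrite ?mul1r.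
have : principal K (qi (6 * k' - 1) (2 * m')) (qi (6 * k - 1) (2 * m)).
  by rewrite -e; exists 1; rewrite ?mul1r.
set x := qi (6 * k - 1) _; set x' := qi (6 * k' - 1) _.
move=> [_ /OKE[u [v ->]] e1] [_ /OKE[u' [v' ->]] e2].
have : qi u v * qi u' v' = qi 1 0.
  have nx : x != 0 by apply/eqP => /qi_eq0[]; lia.
  by apply: (mulIf nx); rewrite -mulrA e2 e1 qi1 mul1r.
rewrite qiM => /qi_inj[h1 h2].
have n1 : (u ^+ 2 + 6 * v ^+ 2) * (u' ^+ 2 + 6 * v' ^+ 2) = 1.
  transitivity ((u * u' - 6 * v * v') ^+ 2 + 6 * (u * v' + v * u') ^+ 2); first by ring.
  by rewrite h1 h2; ring.
have [uu v0] : (u = 1 \/ u = -1) /\ v = 0 by apply: qnorm_eq1 n1.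
by case: uu e1 => ->; rewrite v0 qiM => /qi_inj[]; lia.
Qed.

End QuadraticIdeals.

(** * The octic field *)
Section RationalGalois.
Variable L : splittingFieldType rat.

Definition intL (x : L) := integralOver (intr : int -> L) x.

Lemma intL_int (n : int) : intL n%:~R.
Proof. exact: (@integral_id _ _ (intr : {rmorphism int -> L})). Qed.

Lemma intLD x y : intL x -> intL y -> intL (x + y).
Proof. exact: integral_add. Qed.

Lemma intLN x : intL x -> intL (- x).
Proof. exact: integral_opp. Qed.

Lemma intLM x y : intL x -> intL y -> intL (x * y).
Proof. exact: integral_mul. Qed.

Lemma intLX x n : intL x -> intL (x ^+ n).
Proof.
move=> ix; elim: n => [|n IH]; first exact: (intL_int 1).
by rewrite exprS; apply: intLM.
Qed.

Lemma intL_root x n (m : int) : (0 < n)%N -> x ^+ n = m%:~R -> intL x.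
Proof.
move=> n0 e; exists ('X^n - m%:P); first by rewrite monicXnsubC.
rewrite /root rmorphB /= map_polyXn map_polyC /= !hornerE e subrr. by [].
Qed.

Lemma intL_rat (q : rat) : intL q%:A -> q \is a Num.int.
Proof.
move=> [p mp rp].
have rq : root (map_poly intr p : {poly rat}) q.
  rewrite -(fmorph_root (in_alg L)) -map_poly_comp; move: rp; congr (root _ _).
  by apply: eq_map_poly => n /=; rewrite -[LHS](rmorph_int (in_alg L)).
have rC : root (map_poly intr p : {poly algC}) (ratr q).
  move: rq; rewrite -(fmorph_root (@ratr algC)) -map_poly_comp; congr (root _ _).
  by apply: eq_map_poly => n /=; rewrite ratr_int.
have Aq : (ratr q : algC) \in Aint.
  apply: root_monic_Aint rC (monic_map _ mp) _.
  by apply/polyOverP => k; rewrite coef_map /= intr_int.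
have /intrP[m em] := Cint_rat_Aint (Crat_rat q) Aq.
apply/intrP; exists m; apply: (fmorph_inj (@ratr algC)).
by rewrite [LHS]em [RHS]ratr_int.
Qed.

Lemma gal_intL (s : gal_of {:L}) x : intL x -> intL (s x).
Proof.
move=> [p mp rp]; exists p => //.
have -> : map_poly intr p = map_poly s (map_poly intr p) :> {poly L}.
  by rewrite -map_poly_comp; apply: eq_map_poly => n /=; rewrite rmorph_int.
by rewrite fmorph_root.
Qed.

Lemma galois_full : galois 1 {:L}.
Proof.
apply/and3P; split; [exact: sub1v | | exact: normalFieldf].
apply/separableP => y _; apply: pcharf0_separable.
by move=> p; rewrite (pchar_lalg L) pchar_num.
Qed.

Lemma fixed_rat x : (forall s, s \in 'Gal({:L} / 1) -> s x = x)%g -> exists q, x = q%:A.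
Proof.
move=> fx; apply/vlineP; rewrite -(galois_fixedField galois_full).
by apply/fixedFieldP => //; apply: memvf.
Qed.

Lemma fixed_intL x : (forall s, s \in 'Gal({:L} / 1) -> s x = x)%g -> intL x ->
  exists n : int, x = n%:~R.
Proof.
move=> /fixed_rat[q ->] /intL_rat /intrP[m ->]; exists m.
by rewrite -[LHS]/(in_alg L m%:~R) rmorph_int.
Qed.

End RationalGalois.

Section SplittingField.
Variables (L : splittingFieldType rat) (a i : L).
Hypotheses (Ha : a ^+ 4 = 6%:R) (Hi : i ^+ 2 = -1).
Hypothesis HL : <<<<1; a>>; i>>%VS = {:L}%VS.

Local Notation G := ('Gal({:L} / 1))%g.

Definition root_m6 := i * a ^+ 2.
(** Its square is 2 theta.  It generates one of the two quadratic extensions of K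
    in L that are not normal over Q; a character of Gal(L/K) that is nontrivial on
    the center is the action on a generator of one of them. *)
Definition root_2theta := (1 + i) * a.

Local Notation th := root_m6.
Local Notation be := root_2theta.

Lemma th2E : th ^+ 2 = - 6%:R.
Proof. by rewrite /root_m6 exprMn Hi -exprM Ha mulN1r. Qed.

Lemma th2z : th ^+ 2 = (- 6)%:~R.
Proof. by rewrite th2E mulrNz. Qed.

Lemma be2E : be ^+ 2 = 2%:R * th.
Proof.
rewrite /root_2theta /root_m6; transitivity ((1 + i ^+ 2 + 2%:R * i) * a ^+ 2); first by ring.
by rewrite Hi; ring.
Qed.

Lemma intr_eq0L (n : int) : (n%:~R == 0 :> L) = (n == 0).
Proof. by rewrite -(rmorph_int (in_alg L)) fmorph_eq0 intr_eq0. Qed.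

Lemma intr_injL : injective (intr : int -> L).
Proof. by move=> m n /eqP; rewrite -subr_eq0 -intrB intr_eq0L subr_eq0 => /eqP. Qed.

Lemma gal_mulE (s t : gal_of {:L}) x : (s * t)%g x = t (s x).
Proof. by rewrite galM // memvf. Qed.

Lemma gal_sqrt (s : gal_of {:L}) x (n : int) : x ^+ 2 = n%:~R -> s x = x \/ s x = - x.
Proof.
move=> e; have : (s x) ^+ 2 == x ^+ 2 by rewrite -rmorphXn e rmorph_int.
by rewrite eqf_sqr => /orP[]/eqP; [left|right].
Qed.

Lemma gal_moves x (n : int) : x ^+ 2 = n%:~R -> (forall m : int, m ^+ 2 != n) ->
  exists2 s, s \in G & s x = - x.
Proof.
move=> e nsq; apply: contrapT => no.
have fx s : s \in G -> s x = x.
  by move=> sG; have [//|sx] := gal_sqrt s e; case: no; exists s.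
have [m em] := fixed_intL fx (intL_root (isT : (0 < 2)%N) e).
by move: (nsq m); rewrite -(inj_eq intr_injL) rmorphXn /= -em e eqxx.
Qed.

Lemma a2E : (a ^+ 2) ^+ 2 = 6%:~R. Proof. by rewrite -exprM Ha. Qed.

(** The elements fixed by s t^-1 form a subfield that contains a and i. *)
Lemma gal_ext (s t : gal_of {:L}) : s a = t a -> s i = t i -> s = t.
Proof.
move=> ea ei; pose A := [set (s * t^-1)%g].
have fixA x : s x = t x -> x \in fixedField A.
  move=> e; apply/fixedFieldP; first exact: memvf.
  by move=> u /set1P->; rewrite gal_mulE e -gal_mulE mulgV gal_id.
have /subvP sub : (<<<<1; a>>; i>> <= fixedField A)%VS.
  apply/FadjoinP; split; last exact: fixA.
  by apply/FadjoinP; split; [exact: sub1v|exact: fixA].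
apply/eqP/gal_eqP => x _; have xin : x \in <<<<1; a>>; i>>%VS by rewrite HL memvf.
have /fixedFieldP := sub x xin; move=> /(_ (memvf x) (s * t^-1)%g (set11 _)).
by rewrite gal_mulE => /(congr1 t); rewrite -gal_mulE mulVg gal_id.
Qed.

Lemma int_sqr_neg (m n : int) : n < 0 -> m ^+ 2 != n.
Proof. by move=> n0; have := sqr_ge0 m; lia. Qed.

(** Since -6 and 6 are not squares, automorphisms exist that move theta and a^2;
    either one of them, or their product, fixes i and negates a^2. *)
Lemma exists_sigma : exists2 s, s \in G & s i = i /\ s a = i * a.
Proof.
have [s1 g1 e1] := gal_moves th2z (fun m => int_sqr_neg m (isT : (- 6 < 0 :> int))).
have sq6 (m : int) : m ^+ 2 != 6.
  apply/eqP; rewrite expr2 => e; have m3 : -3 < m < 3 by nia.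
  have : m = -2 \/ m = -1 \/ m = 0 \/ m = 1 \/ m = 2 by lia.
  by do 4?[case]; move=> em; move: e; rewrite em.
have [s3 g3 e3] := gal_moves a2E sq6.
have [s gs [si sa2]] : exists2 s, s \in G & s i = i /\ s (a ^+ 2) = - a ^+ 2.
  have i2 : i ^+ 2 = (-1)%:~R by rewrite Hi.
  have i0 : i != 0 by apply/eqP => i0; move/eqP: i2; rewrite i0 expr0n /= eq_sym (intr_eq0L (-1)).
  have ni : (i == - i) = false.
    apply/negbTE; rewrite -addr_eq0 -mulr2n -mulr_natl mulf_eq0 negb_or i0 andbT.
    by rewrite (intr_eq0L 2).
  have [e3i|e3i] := gal_sqrt s3 i2; first by exists s3.
  have [e1i|e1i] := gal_sqrt s1 i2.
    exists s1 => //; split=> //; apply: (mulfI i0).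
    have h : s1 i * s1 (a ^+ 2) = - th by rewrite -rmorphM.
    by rewrite -[in LHS]e1i h mulrN.
  exists (s1 * s3)%g; first exact: groupM.
  rewrite !gal_mulE e1i rmorphN /= e3i opprK; split=> //.
  have -> : s1 (a ^+ 2) = a ^+ 2.
    have h : s1 i * s1 (a ^+ 2) = - th by rewrite -rmorphM.
    apply: (mulfI (_ : - i != 0)); first by rewrite oppr_eq0.
    by rewrite -[in LHS]e1i h mulNr.
  exact: e3.
have : (s a) ^+ 2 == (i * a) ^+ 2 by rewrite -rmorphXn /= sa2 exprMn Hi mulN1r.
rewrite eqf_sqr => /orP[/eqP sa|/eqP sa]; first by exists s.
exists (s * s * s)%g; first by rewrite !groupM.
rewrite !gal_mulE !si sa !(rmorphN, rmorphM) /= si sa; split=> //.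
rewrite !(rmorphN, rmorphM) /= si sa.
transitivity (- (i ^+ 2) * i * a); first by ring.
by rewrite Hi; ring.
Qed.

Lemma i2z : i ^+ 2 = (-1)%:~R. Proof. by rewrite Hi. Qed.

Lemma exists_tau : exists2 s, s \in G & s i = - i /\ s a = a.
Proof.
have [sg gsg [sgi sga]] := exists_sigma.
have [s2 g2 e2] := gal_moves i2z (fun m => int_sqr_neg m (isT : (- 1 < 0 :> int))).
have [s gs [si sa2]] : exists2 s, s \in G & s i = - i /\ s (a ^+ 2) = a ^+ 2.
  have [e2a|e2a] := gal_sqrt s2 a2E; first by exists s2.
  exists (s2 * sg)%g; first exact: groupM.
  rewrite !gal_mulE e2 e2a !rmorphN /= sgi; split=> //.
  by rewrite rmorphXn /= sga exprMn Hi mulN1r opprK.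
have : (s a) ^+ 2 == a ^+ 2 by rewrite -rmorphXn /= sa2.
rewrite eqf_sqr => /orP[/eqP sa|/eqP sa]; first by exists s.
exists (s * sg * sg)%g; first by rewrite !groupM.
rewrite !gal_mulE si sa !rmorphN /= !sgi sga !rmorphM /= sgi sga; split=> //.
by rewrite mulrA -expr2 Hi mulN1r opprK.
Qed.

Local Notation K := (<<1; th>>%AS).

Lemma gal_in1 (s : gal_of {:L}) : s \in G.
Proof. by rewrite gal_kHom ?sub1v // k1AHom. Qed.

Lemma galK_th (s : gal_of {:L}) : (s \in 'Gal({:L} / K)%g) = (s th == th).
Proof.
apply/idP/eqP => [sK|sth]; first exact: fixed_gal (subvf _) sK (memv_adjoin _ _).
rewrite gal_kHom ?subvf //; apply/kAHomP => x xK.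
have /subvP sub : (K <= fixedField [set s])%VS.
  apply/FadjoinP; split; first exact: sub1v.
  by apply/fixedFieldP => [|u /set1P->//]; apply: memvf.
by have /fixedFieldP := sub x xK; apply; rewrite ?memvf ?set11.
Qed.

Lemma ring_of_integersL x : ring_of_integers {:L}%AS x <-> intL x.
Proof. by split=> [[]//|ix]; split=> //; apply: memvf. Qed.

Lemma intL_i : intL i.
Proof. exact: intL_root (isT : (0 < 2)%N) i2z. Qed.

Lemma intL_a : intL a.
Proof. exact: intL_root (isT : (0 < 4)%N) (Ha : _ = 6%:~R). Qed.

Lemma intL_th : intL th.
Proof. by apply/intLM/intLX/intL_a/intL_i. Qed.

Lemma th_qi_eq0 (u v : int) : quad_int th u v = 0 -> u = 0 /\ v = 0.
Proof.
have [t gt [ti ta]] := exists_tau => e.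
have tth : t th = - th by rewrite rmorphM rmorphXn /= ti ta mulNr.
have e' : u%:~R - v%:~R * th = 0.
  by have := congr1 t e; rewrite rmorphD rmorphM /= !rmorph_int tth rmorph0 mulrN.
have u0 : u = 0.
  apply/eqP; rewrite -intr_eq0L; have : 2%:~R * u%:~R = 0 :> L.
    transitivity ((u%:~R + v%:~R * th) + (u%:~R - v%:~R * th)); first by ring.
    by rewrite e' addr0.
  by move/eqP; rewrite mulf_eq0 !intr_eq0L.
split=> //; move/eqP: e; rewrite /quad_int u0 add0r mulf_eq0 intr_eq0L => /orP[/eqP//|/eqP th0].
by move/eqP: th2z; rewrite th0 expr0n eq_sym intr_eq0L.
Qed.

(** The conjugate of x is its image under an automorphism that negates theta.
    The trace U, the norm N and W = theta (x - x') are rational integers with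
    6 U^2 + W^2 = 24 N, which forces U to be even and W to be divisible by 12. *)
Lemma ring_of_integersK x : ring_of_integers K x <-> exists u v, x = quad_int th u v.
Proof.
split=> [[xK ix]|[u [v ->]]]; last first.
  split; last by apply: intLD; [|apply: intLM]; try exact: intL_int; apply: intL_th.
  apply: rpredD; first exact: rpred_int.
  by apply: rpredM; [exact: rpred_int|exact: memv_adjoin].
have [t gt [ti ta]] := exists_tau.
have tth : t th = - th by rewrite rmorphM rmorphXn /= ti ta mulNr.
have sx (s : gal_of {:L}) : s th = th -> s x = x.
  by move/eqP; rewrite -galK_th => sK; apply: fixed_gal sK xK; apply: subvf.
have sx' (s : gal_of {:L}) : s th = - th -> s x = t x.
  move=> sth; have : (s * t^-1)%g x = x.
    apply: sx; rewrite gal_mulE sth -tth -gal_mulE mulgV gal_id //.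
  by rewrite gal_mulE => /(congr1 t); rewrite -gal_mulE mulVg gal_id.
have tt : t (t x) = x.
  rewrite -gal_mulE; apply: sx; rewrite gal_mulE tth rmorphN /= tth opprK //.
have st (s : gal_of {:L}) : s th = th \/ s th = - th by apply: gal_sqrt th2z.
have stx (s : gal_of {:L}) : s th = - th -> s (t x) = x.
  by move=> e; rewrite -gal_mulE; apply: sx; rewrite gal_mulE tth rmorphN /= e opprK.
have stx' (s : gal_of {:L}) : s th = th -> s (t x) = t x.
  by move=> e; rewrite -gal_mulE; apply: sx'; rewrite gal_mulE tth rmorphN /= e.
have itx : intL (t x) by apply: gal_intL.
have [U eU] : exists n : int, x + t x = n%:~R.
  apply: fixed_intL; last exact: intLD.
  move=> s _; rewrite rmorphD /=; case: (st s) => e; first by rewrite sx ?stx'.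
  by rewrite sx' ?stx // addrC.
have [W eW] : exists n : int, th * (x - t x) = n%:~R.
  apply: fixed_intL; last by apply: intLM (intL_th) (intLD ix (intLN itx)).
  move=> s _; rewrite rmorphM rmorphB /=; case: (st s) => e; first by rewrite sx ?stx' ?e.
  by rewrite sx' ?stx // e mulNr -mulrN opprB.
have [N eN] : exists n : int, x * t x = n%:~R.
  apply: fixed_intL; last exact: intLM.
  move=> s _; rewrite rmorphM /=; case: (st s) => e; first by rewrite sx ?stx'.
  by rewrite sx' ?stx // mulrC.
have key : 6 * U ^+ 2 + W ^+ 2 = 24 * N.
  apply: intr_injL.
  transitivity (6%:~R * U%:~R ^+ 2 + W%:~R ^+ 2 : L); first by ring.
  rewrite -eU -eW exprMn th2E; transitivity (24%:~R * (x * t x)); first by ring.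
  by rewrite eN; ring.
have [w ew] : exists w, W = 6 * w.
  exists (W %/ 6)%Z; have := divz_eq W 6; have : 0 <= (W %% 6)%Z < 6 by lia.
  move: (W %/ 6)%Z (W %% 6)%Z => q z z6 eWq.
  have : W ^+ 2 = 6 * (6 * q ^+ 2 + 2 * q * z) + z ^+ 2 by rewrite eWq; ring.
  have : z = 0 \/ z = 1 \/ z = 2 \/ z = 3 \/ z = 4 \/ z = 5 by lia.
  move: (6 * q ^+ 2 + _) (W ^+ 2) (U ^+ 2) key => ? ? ? ?.
  by do 5?[case]; move=> ez; rewrite eWq ez; lia.
have key2 : U ^+ 2 + 6 * w ^+ 2 = 4 * N.
  have : W ^+ 2 = 36 * w ^+ 2 by rewrite ew; ring.
  by move: (W ^+ 2) (w ^+ 2) (U ^+ 2) key => *; lia.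
have [u eu] : exists u, U = 2 * u.
  exists (U %/ 2)%Z; have [[]//|oU] : U = 2 * (U %/ 2)%Z \/ U = 2 * (U %/ 2)%Z + 1 by lia.
  have : U ^+ 2 = 2 * (2 * (U %/ 2)%Z ^+ 2 + 2 * (U %/ 2)%Z) + 1 by rewrite [in LHS]oU; ring.
  by move: (2 * _ ^+ 2 + _) (U ^+ 2) (w ^+ 2) key2 => *; lia.
have [v ev] : exists v, w = 2 * v.
  exists (w %/ 2)%Z; have [[]//|ow] : w = 2 * (w %/ 2)%Z \/ w = 2 * (w %/ 2)%Z + 1 by lia.
  have : w ^+ 2 = 2 * (2 * (w %/ 2)%Z ^+ 2 + 2 * (w %/ 2)%Z) + 1 by rewrite [in LHS]ow; ring.
  have : U ^+ 2 = 4 * u ^+ 2 by rewrite eu; ring.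
  by move: (2 * _ ^+ 2 + _) (U ^+ 2) (w ^+ 2) (u ^+ 2) key2 => *; lia.
exists u, (- v); apply: (mulfI (_ : 12%:~R != 0 :> L)); first by rewrite intr_eq0L.
transitivity (6%:~R * (x + t x) + 6%:~R * (x - t x)); first by ring.
have -> : 6%:~R * (x - t x) = - (th * (th * (x - t x))) by rewrite mulrA -expr2 th2E; ring.
by rewrite eU eW ew eu ev /quad_int; ring.
Qed.

Lemma i4E : i ^+ 4 = 1.
Proof. by rewrite (exprM i 2 2) Hi sqrrN expr1n. Qed.

Lemma gal_a (s : gal_of {:L}) : exists j, s a = i ^+ j * a.
Proof.
have [e|e] := gal_sqrt s a2E.
  have : (s a) ^+ 2 == a ^+ 2 by rewrite -rmorphXn /= e.
  rewrite eqf_sqr => /orP[/eqP sa|/eqP sa]; [exists 0%N|exists 2%N].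
    by rewrite mul1r.
  by rewrite Hi mulN1r.
have : (s a) ^+ 2 == (i * a) ^+ 2 by rewrite -rmorphXn /= e exprMn Hi mulN1r.
rewrite eqf_sqr => /orP[/eqP sa|/eqP sa]; [exists 1%N|exists 3%N]; rewrite sa //.
by rewrite exprS Hi mulrN1 mulNr.
Qed.

(** The field fixed by sg is Q(i); the traces of y and of i y to Q are rational
    integers. *)
Lemma fixed_sigma (sg : gal_of {:L}) y : sg i = i -> sg a = i * a -> intL y -> sg y = y ->
  exists m n : int, 2%:~R * y = m%:~R + n%:~R * i.
Proof.
move=> sgi sga iy sy; have [t gt [ti ta]] := exists_tau.
have sj j x : (sg ^+ j)%g x = iter j sg x.
  by elim: j x => [|j IH] x; rewrite ?expg0 ?gal_id // expgSr gal_mulE IH.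
have iti j : iter j sg i = i by elim: j => //= j ->.
have ita j : iter j sg a = i ^+ j * a.
  elim: j => [|j IH] /=; first by rewrite mul1r.
  by rewrite IH rmorphM rmorphXn /= sgi sga exprS; ring.
have ity j : iter j sg y = y by elim: j => //= j ->.
have sty : sg (t y) = t y.
  transitivity (t (iter 3 sg y)); last by rewrite ity.
  rewrite -sj -!gal_mulE; suff -> : (t * sg = sg ^+ 3 * t)%g by [].
  apply: gal_ext; rewrite (gal_mulE t) (gal_mulE (sg ^+ 3)%g) sj.
    rewrite ta sga ita rmorphM rmorphXn /= ti ta; congr (_ * _).
    transitivity (- i * i ^+ 2); first by rewrite Hi; ring.
    by ring.
  by rewrite ti rmorphN /= !sgi ti.
have itty j : iter j sg (t y) = t y by elim: j => //= j ->.
have tty : t (t y) = y.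
  rewrite -gal_mulE (_ : (t * t)%g = 1%g) ?gal_id //.
  by apply: gal_ext; rewrite gal_mulE gal_id ?ta // ti rmorphN /= ti opprK.
have all (s : gal_of {:L}) : (s y = y /\ s (t y) = t y /\ s i = i) \/
    (s y = t y /\ s (t y) = y /\ s i = - i).
  have [j ej] := gal_a s; have [si|si] := gal_sqrt s i2z; [left|right].
    have -> : s = (sg ^+ j)%g by apply: gal_ext; rewrite sj ?iti ?ita.
    by rewrite !sj ity itty iti.
  have -> : s = (t * sg ^+ j)%g.
    by apply: gal_ext; rewrite gal_mulE sj ?ta ?ita // ti si -sj rmorphN /= sj iti.
  by rewrite !gal_mulE !sj tty ity itty ti -sj rmorphN /= sj iti.
have [m em] : exists n : int, y + t y = n%:~R.
  apply: fixed_intL; last by apply: intLD (gal_intL _ iy).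
  move=> s _; rewrite rmorphD /=; case: (all s) => -[-> [-> _]] //.
  by rewrite addrC.
have [n en] : exists n : int, (y - t y) * i = n%:~R.
  apply: fixed_intL; last by apply: intLM intL_i; apply: intLD => //; apply/intLN/gal_intL.
  move=> s _; rewrite rmorphM rmorphB /=; case: (all s) => -[-> [-> ->]] //.
  by rewrite mulrN -mulNr opprB.
exists m, (- n); rewrite rmorphN /= -em -en.
transitivity ((y + t y) - (y - t y) * i ^+ 2); last by ring.
by rewrite Hi; ring.
Qed.

(** The eigencomponents of z for the automorphism sigma of order 4 that multiplies
    a by i become, after multiplication by powers of a, integers of Q(i) up to the
    denominator 2. *)
Lemma intL_clear (z : L) : intL z ->
  exists m n : nat -> int, 48%:~R * z = \sum_(k < 4) ((m k)%:~R + (n k)%:~R * i) * a ^+ k.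
Proof.
move=> iz; have [s gs [si sa]] := exists_sigma.
pose s1 := s z; pose s2 := s s1; pose s3 := s s2.
have s4 : s s3 = z.
  rewrite /s3 /s2 /s1 -!gal_mulE (_ : (s * _)%g = 1%g) ?gal_id //.
  apply: gal_ext; rewrite !gal_mulE gal_id ?si // sa.
  do 3!rewrite !rmorphM /= !si sa.
  by transitivity (i ^+ 4 * a); [ring|rewrite i4E mul1r].
have i1 : intL s1 by apply: gal_intL.
have i2 : intL s2 by apply: gal_intL.
have i3 : intL s3 by apply: gal_intL.
(* 4 z is the sum of the eigencomponents wk, on which sigma acts as i^k *)
pose w0 := z + s1 + s2 + s3; pose w1 := z - i * s1 - s2 + i * s3.
pose w2 := z - s1 + s2 - s3; pose w3 := z + i * s1 - s2 - i * s3.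
have [iI iA] := (intL_i, intL_a).
have [m0 [n0 e0]] : exists m n : int, 2%:~R * (w0 * a ^+ 4) = m%:~R + n%:~R * i.
  apply: (fixed_sigma si sa).
    by apply: intLM (intLX _ iA); rewrite /w0; do ![apply: intLD|apply: intLN|apply: intLM|by []].
  rewrite rmorphM rmorphXn /= sa exprMn /w0 !rmorphD /=.
  by rewrite -/s1 -/s2 -/s3 s4 i4E; ring.
have [m1 [n1 e1]] : exists m n : int, 2%:~R * (w1 * a ^+ 3) = m%:~R + n%:~R * i.
  apply: (fixed_sigma si sa).
    by apply: intLM (intLX _ iA); rewrite /w1; do ![apply: intLD|apply: intLN|apply: intLM|by []].
  rewrite rmorphM rmorphXn /= sa exprMn /w1 !(rmorphM, rmorphD, rmorphN) /=.
  rewrite -/s1 -/s2 -/s3 s4 si.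
  transitivity ((s1 - s3) * (i * i ^+ 2) * a ^+ 3 + (z - s2) * i ^+ 4 * a ^+ 3); first by ring.
  by rewrite i4E Hi; ring.
have [m2 [n2 e2]] : exists m n : int, 2%:~R * (w2 * a ^+ 2) = m%:~R + n%:~R * i.
  apply: (fixed_sigma si sa).
    by apply: intLM (intLX _ iA); rewrite /w2; do ![apply: intLD|apply: intLN|apply: intLM|by []].
  rewrite rmorphM rmorphXn /= sa exprMn /w2 !(rmorphD, rmorphN) /=.
  by rewrite -/s1 -/s2 -/s3 s4 Hi; ring.
have [m3 [n3 e3]] : exists m n : int, 2%:~R * (w3 * a) = m%:~R + n%:~R * i.
  apply: (fixed_sigma si sa).
    by apply: intLM iA; rewrite /w3; do ![apply: intLD|apply: intLN|apply: intLM|by []].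
  rewrite /w3 !(rmorphM, rmorphD, rmorphN) /= -/s2 -/s3 s4 sa -/s1 si.
  transitivity ((s1 - s3) * i * a + (s2 - z) * i ^+ 2 * a); first by ring.
  by rewrite Hi; ring.
exists (nth 0 [:: m0; m1; m2; m3]), (nth 0 [:: n0; n1; n2; n3]).
rewrite !big_ord_recl big_ord0 /= /bump /= !add1n -e0 -e1 -e2 -e3.
transitivity (2%:~R * a ^+ 4 * (w0 + w1 + w2 + w3)); last by ring.
by rewrite Ha /w0 /w1 /w2 /w3; ring.
Qed.

Section Frobenius.
Variable p : nat.
Hypotheses (pp : prime p) (p3 : (3 < p)%N).

Definition eqmodp (x y : L) := exists2 w, intL w & x - y = p%:R * w.

Lemma eqmodp_refl x : eqmodp x x.
Proof. by exists 0; [exact: (intL_int L 0)|rewrite subrr mulr0]. Qed.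

Lemma eqmodp_trans x y z : eqmodp x y -> eqmodp y z -> eqmodp x z.
Proof.
move=> [u iu eu] [v iv ev]; exists (u + v); first exact: intLD.
by rewrite mulrDr -eu -ev addrA subrK.
Qed.

Lemma eqmodpD x y x' y' : eqmodp x y -> eqmodp x' y' -> eqmodp (x + x') (y + y').
Proof.
move=> [u iu eu] [v iv ev]; exists (u + v); first exact: intLD.
by rewrite mulrDr -eu -ev; ring.
Qed.

Lemma eqmodpM x y x' y' : intL x -> intL y' ->
  eqmodp x y -> eqmodp x' y' -> eqmodp (x * x') (y * y').
Proof.
move=> ix iy' [u iu eu] [v iv ev]; exists (x * v + u * y').
  by apply: intLD; apply: intLM.
rewrite mulrDr mulrCA -ev [_ * (u * _)]mulrA -eu; ring.
Qed.

Lemma eqmodpX x y n : intL x -> intL y -> eqmodp x y -> eqmodp (x ^+ n) (y ^+ n).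
Proof.
move=> ix iy e; elim: n => [|n IH]; first exact: eqmodp_refl.
by rewrite !exprS; apply: eqmodpM => //; apply: intLX.
Qed.

Lemma eqmodp_frobD x y : intL x -> intL y -> eqmodp ((x + y) ^+ p) (x ^+ p + y ^+ p).
Proof.
move=> ix iy; have sum0 (I : finType) (P : pred I) (F : I -> L) :
    (forall k, P k -> eqmodp (F k) 0) -> eqmodp (\sum_(k | P k) F k) 0.
  move=> h; apply: (big_ind (fun z => eqmodp z 0)) => //; first exact: eqmodp_refl.
  by move=> u v hu hv; rewrite -[0]addr0; apply: eqmodpD.
have ep : p = p.-1.+1 by rewrite prednK // prime_gt0.
rewrite exprDn ep big_ord_recl big_ord_recr /= -ep subn0 expr0 mulr1 bin0 mulr1n.
rewrite /bump leq0n add1n -ep subnn expr0 mul1r binn mulr1n.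
rewrite addrA [X in eqmodp X _](_ : _ = (x ^+ p + y ^+ p) +
   \sum_(k < p.-1) x ^+ (p - bump 0 k) * y ^+ bump 0 k *+ 'C(p, bump 0 k)); last by ring.
rewrite -[X in eqmodp _ X]addr0; apply: eqmodpD; first exact: eqmodp_refl.
apply: sum0 => k _; rewrite /bump leq0n add1n.
have /dvdnP[q ->] : (p %| 'C(p, k.+1))%N by apply: prime_dvd_bin => //; have := ltn_ord k; lia.
exists (x ^+ (p - k.+1) * y ^+ k.+1 * q%:R).
  by apply: intLM (intL_int L q); apply: intLM; apply: intLX.
by rewrite subr0 -mulr_natr natrM; ring.
Qed.

Lemma eqmodp_frobDn x y n : intL x -> intL y ->
  eqmodp ((x + y) ^+ (p ^ n)) (x ^+ (p ^ n) + y ^+ (p ^ n)).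
Proof.
move=> ix iy; elim: n => [|n IH]; first exact: eqmodp_refl.
rewrite expnSr !exprM; apply: eqmodp_trans (eqmodp_frobD (intLX _ ix) (intLX _ iy)).
by apply: eqmodpX IH; rewrite -?exprM; [apply/intLX/intLD|apply: intLD; apply: intLX].
Qed.

Lemma eqmodp_int (m n : int) : (p %| m - n)%Z -> eqmodp m%:~R n%:~R.
Proof.
case/dvdzP=> q e; exists q%:~R; first exact: intL_int.
by rewrite -intrB e intrM mulrC pmulrn.
Qed.

Let M := (p ^ 4)%N.

(** This is why raising to the power p^4 fixes i and a modulo p: i^4 = 1, and
    a^4 = 6 has order dividing p - 1 modulo p. *)
Let M_decomp : exists r, M = ((p.-1 * r) * 4).+1.
Proof.
have op : odd p by case: (even_prime pp) => // p2; have := p3; rewrite p2.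
have [h eh] : exists h, p = h.*2.+1 by exists p./2; exact: odd_doubleE op.
pose k := (h * h.+1)%N; exists (h.+1 * (2 * k + 1))%N.
have e2 : (p ^ 2 = 4 * k + 1)%N by rewrite eh /k -mulnn; lia.
have e4 : (p.-1 * (h.+1 * (2 * k + 1)) = 2 * k * (2 * k + 1))%N.
  by rewrite eh /= mulnA; congr (_ * _)%N; rewrite /k; lia.
by rewrite /M (expnM p 2 2) e2 e4 -mulnn; clear; lia.
Qed.

Let fermat_int (m : int) : ~~ (p %| m)%Z -> (p %| m ^+ p.-1 - 1)%Z.
Proof.
move=> pm; rewrite -Fp_int_eq0 // rmorphB rmorphXn /= subr_eq0; apply/eqP.
have m0 : m%:~R != 0 :> 'F_p by rewrite Fp_int_eq0.
by apply: (mulfI m0); rewrite -exprS prednK ?prime_gt0 // Fp_fermat // mulr1.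
Qed.

Let frob_i : eqmodp (i ^+ M) i.
Proof.
have [r ->] := M_decomp; rewrite exprS mulnC exprM i4E expr1n mulr1; exact: eqmodp_refl.
Qed.

Let frob_int (m : int) : eqmodp (m%:~R ^+ M) m%:~R.
Proof.
have [r ->] := M_decomp; have [pm|pm] := boolP (p %| m)%Z.
  rewrite -rmorphXn; apply: eqmodp_int; rewrite exprS -[X in _ - X]mulr1 -mulrBr.
  exact: dvdz_mulr.
rewrite exprS -[X in eqmodp _ X]mulr1; apply: eqmodpM; try exact: intL_int.
- exact: (intL_int L 1).
- exact: eqmodp_refl.
rewrite -mulnA exprM -[X in eqmodp _ X](expr1n _ (r * 4)); apply: eqmodpX.
- exact/intLX/intL_int.
- exact: (intL_int L 1).
by rewrite -rmorphXn; apply: (@eqmodp_int _ 1); apply: fermat_int.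
Qed.

Let frob_a : eqmodp (a ^+ M) a.
Proof.
have [r ->] := M_decomp; rewrite exprS -[X in eqmodp _ X]mulr1.
apply: eqmodpM; [exact: intL_a|exact: (intL_int L 1)|exact: eqmodp_refl|].
rewrite mulnC exprM Ha exprM -[X in eqmodp _ X](expr1n _ r); apply: eqmodpX.
- exact/intLX/(intL_int L 6).
- exact: (intL_int L 1).
rewrite -[6%:R]/(6%:~R) -rmorphXn; apply: (@eqmodp_int _ 1); apply: fermat_int.
have := p3; rewrite dvdzE !absz_nat (Euclid_dvdM 2 3) // negb_or !gtnNdvd //; lia.
Qed.

(** No nilpotents modulo p: by [intL_clear] it suffices that raising to the power
    p^4, which is additive modulo p, fixes a, i and the rational integers. *)
Lemma intL_frob (z : L) : intL z -> eqmodp (z ^+ M) z.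
Proof.
move=> iz.
have frobM x y : intL x -> intL y -> eqmodp (x ^+ M) x -> eqmodp (y ^+ M) y ->
    eqmodp ((x * y) ^+ M) (x * y).
  by move=> ix iy ex ey; rewrite exprMn; apply: eqmodpM => //; apply: intLX.
have frobD x y : intL x -> intL y -> eqmodp (x ^+ M) x -> eqmodp (y ^+ M) y ->
    eqmodp ((x + y) ^+ M) (x + y).
  by move=> ix iy ex ey; apply: eqmodp_trans (eqmodp_frobDn _ ix iy) (eqmodpD ex ey).
pose good x := intL x /\ eqmodp (x ^+ M) x.
have gi : good i by split; [exact: intL_i|].
have ga : good a by split; [exact: intL_a|].
have gz (m : int) : good m%:~R by split; [exact: intL_int|exact: frob_int].
have gD x y : good x -> good y -> good (x + y).
  by move=> [ix ex] [iy ey]; split; [exact: intLD|exact: frobD].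
have gM x y : good x -> good y -> good (x * y).
  by move=> [ix ex] [iy ey]; split; [exact: intLM|exact: frobM].
have gX x n : good x -> good (x ^+ n).
  by move=> gx; elim: n => [|n IH]; [exact: (gz 1)|rewrite exprS; apply: gM].
have [m [n e48]] := intL_clear iz.
have [_ [w iw ew]] : good (48%:~R * z).
  rewrite e48; apply: (big_ind good) => //; first exact: (gz 0).
  by move=> k _; apply: (gM _ _ _ (gX _ _ ga)); apply: (gD) => //; apply: (gM).
have [v iv ev] := frob_int 48.
have c48 : coprimez 48 p.
  have : coprime p (2 ^ 4 * 3).
    by rewrite coprimeMr coprimeXr ?prime_coprime ?gtnNdvd //; have := p3; lia.
  by rewrite coprimezE coprime_sym.
have [[A B] /= eAB] := coprimezP _ _ c48.
exists (A%:~R * (w - v * z ^+ M) + B%:~R * (z ^+ M - z)).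
  apply: intLD; apply: intLM; try exact: intL_int.
    exact: (intLD iw (intLN (intLM iv (intLX M iz)))).
  exact: (intLD (intLX M iz) (intLN iz)).
have e1 : 1 = A%:~R * 48%:~R + B%:~R * p%:R :> L.
  by rewrite -[p%:R]/(p%:Z%:~R) -!intrM -intrD eAB.
transitivity (A%:~R * (p%:R * w - p%:R * v * z ^+ M) + B%:~R * p%:R * (z ^+ M - z)).
  rewrite -ew -ev exprMn.
  transitivity ((A%:~R * 48%:~R + B%:~R * p%:R) * (z ^+ M - z)); last by ring.
  by rewrite -e1 mul1r.
by ring.
Qed.

End Frobenius.

End SplittingField.

(** * Primes of the octic field *)
Section PrimesOfL.
Variable L : splittingFieldType rat.
Implicit Types (P p J : set L).

Local Notation OL := (ring_of_integers {:L}%AS).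

Lemma prime_int P x : prime_ideal {:L}%AS P -> P x -> intL x.
Proof. by move=> [[_ PO] _ _] /PO[]. Qed.

Lemma primeD P x y : prime_ideal {:L}%AS P -> P x -> P y -> P (x + y).
Proof. by move=> [[[_ _ PD _ _] _] _ _]; apply: PD. Qed.

Lemma primeZ P c x : prime_ideal {:L}%AS P -> intL c -> P x -> P (c * x).
Proof. by move=> [[[_ _ _ PZ _] _] _ _] ic; apply: PZ; apply/ring_of_integersL. Qed.

Lemma primeN P x : prime_ideal {:L}%AS P -> P x -> P (- x).
Proof. by move=> PP Px; rewrite -mulN1r; apply: primeZ => //; apply: (intL_int L (-1)). Qed.

Lemma primeM P x y : prime_ideal {:L}%AS P -> intL x -> intL y -> P (x * y) -> P x \/ P y.
Proof. by move=> [_ _ PM] ix iy; apply: PM; apply/ring_of_integersL. Qed.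

Lemma prime_dvd P (p : nat) (n : int) : prime_ideal {:L}%AS P -> prime p -> P p%:R ->
  P n%:~R -> (p %| n)%Z.
Proof.
move=> PP pp Pp Pn; apply/negPn/negP => pn; have [_ P1 _] := PP; apply: P1.
have cpn : coprimez p n by rewrite coprimezE absz_nat prime_coprime // -dvdzE in pn *.
have [[A B] /= eAB] := coprimezP _ _ cpn.
have -> : 1 = A%:~R * p%:R + B%:~R * n%:~R :> L.
  by rewrite -[p%:R]/(p%:Z%:~R) -!intrM -intrD eAB.
by apply: primeD => //; apply: primeZ => //; apply: intL_int.
Qed.

(** Zorn's lemma yields an ideal maximal among those that contain I but not 1,
    and such an ideal is prime. *)
Lemma exists_prime_above (I : set L) : (I `<=` OL)%classic -> (exists2 x, I x & x != 0) ->
  ~ ideal_mul OL I 1 ->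
  exists2 P, prime_ideal {:L}%AS P & (I `<=` P)%classic.
Proof.
move=> IO [x0 Ix0 nx0] no1; pose E := ideal_mul OL I.
have O1 : OL 1 by apply/ring_of_integersL; apply: (intL_int L 1).
have OM (x y : L) : OL x -> OL y -> OL (x * y).
  by move=> /ring_of_integersL ix /ring_of_integersL iy; apply/ring_of_integersL/intLM.
have OD (x y : L) : OL x -> OL y -> OL (x + y).
  by move=> /ring_of_integersL ix /ring_of_integersL iy; apply/ring_of_integersL/intLD.
have O0 : OL 0 by apply/ring_of_integersL; apply: (intL_int L 0).
have IE x : I x -> E x by move=> Ix; rewrite -[x]mul1r; apply: ideal_mul_mem.
have EO : (E `<=` OL)%classic.
  apply: (@ideal_mul_sub _ OL I OL); [exact: O0|exact: OD|].
  by move=> x y Ox /IO; apply: OM.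
pose good (A : set L) := [/\ A = set0 \/ (E `<=` A)%classic, (A `<=` OL)%classic, ~ A 1,
  (forall x y, A x -> A y -> A (x + y)) & (forall c x, OL c -> A x -> A (c * x))].
have [A [gA Amax]] : exists A, good A /\ forall B, (A `<` B)%classic -> ~ good B.
  apply: Zorn_bigcup => F Fgood Ftot; split.
  - have [FE|nFE] := pselect (exists2 X, F X & (E `<=` X)%classic).
      by right; case: FE => X FX EX y Ey; exists X => //; apply: EX.
    left; apply/predeqP => y; split=> // -[X FX Xy].
    have [[X0|EX] _ _ _ _] := Fgood _ FX; first by move: Xy; rewrite X0.
    by case: nFE; exists X.
  - by move=> y [X FX Xy]; have [_ XO _ _ _] := Fgood _ FX; apply: XO.
  - by move=> [X FX X1]; have [_ _ nX1 _ _] := Fgood _ FX.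
  - move=> x y [X FX Xx] [Y FY Yy]; have [XY|YX] := Ftot _ _ FX FY.
      exists Y => //; have [_ _ _ YD _] := Fgood _ FY; apply: YD => //; exact: XY.
    exists X => //; have [_ _ _ XD _] := Fgood _ FX; apply: XD => //; exact: YX.
  - move=> c x Oc [X FX Xx]; exists X => //; have [_ _ _ _ XZ] := Fgood _ FX; exact: XZ.
have gE : good E.
  split=> //; [by right|exact: ideal_mulD|].
  by move=> c x; apply: ideal_mulZ => d y; apply: OM.
case: gA => [A0E AO A1 AD AZ].
have EA : (E `<=` A)%classic.
  case: A0E => // A0; exfalso; apply: (Amax E) => //; rewrite A0; split=> // EA.
  by have := EA _ (IE _ Ix0).
exists A; last by move=> x /IE /EA.
split=> //; first split=> //; first split=> //.
- by move=> x _; apply: memvf.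
- by exists x0 => //; apply/EA/IE.
- exists 1; first by split=> //; apply: oner_neq0.
  by move=> x /AO; rewrite mul1r.
move=> x y Ox Oy Axy; apply: contrapT => /not_orP[nAx nAy].
pose B := [set z | exists u c, [/\ A u, OL c & z = u + c * x]]%classic.
have A0 : A 0 by rewrite -(mul0r x0); apply: AZ => //; apply/EA/IE.
have AB : (A `<=` B)%classic by move=> z Az; exists z, 0; split; rewrite ?mul0r ?addr0.
have Bx : B x by exists 0, 1; split; rewrite ?mul1r ?add0r.
(* the ideal generated by A and x is larger than A, so it contains 1 *)
apply: (Amax B); first by split=> // BA; apply: nAx; apply: BA.
split.
- by right => z /EA /AB.
- by move=> z [u [c [/AO Ou Oc ->]]]; apply: OD => //; apply: OM.
- move=> [u [c [Au Oc e]]]; apply: nAy.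
  rewrite -[y]mul1r e mulrDl -mulrA; apply: AD; last exact: AZ.
  by rewrite mulrC; apply: AZ.
- move=> z z' [u [c [Au Oc ->]]] [u' [c' [Au' Oc' ->]]].
  by exists (u + u'), (c + c'); split; [exact: AD|exact: OD|ring].
- move=> d z Od [u [c [Au Oc ->]]]; exists (d * u), (d * c).
  by split; [exact: AZ|exact: OM|ring].
Qed.

End PrimesOfL.

Section Unramified.
Variables (L : splittingFieldType rat) (a i : L).
Hypotheses (Ha : a ^+ 4 = 6%:R) (Hi : i ^+ 2 = -1).
Hypothesis HL : <<<<1; a>>; i>>%VS = {:L}%VS.

(** If p were a sum of products u v with u, v in P, then multiplying by all the
    elements e(u) = 1 - u^(p^4 - 1), which lie outside P and map u into p O_L by
    [intL_frob], would give w outside P with p w in p^2 O_L, that is w in p O_L. *)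
Lemma unramified_above (F : {subfield L}) (J : set L) p : prime p -> (3 < p)%N ->
  J p%:R -> unramified F J.
Proof.
move=> pp p3 Jp P [PP PJ] sub.
have Pp : P p%:R by move: Jp; rewrite -PJ => -[].
have [n [u [v [Pu Pv ep]]]] := sub _ Jp.
pose e (z : L) := 1 - z ^+ (p ^ 4).-1.
have M0 : (0 < p ^ 4)%N by rewrite expn_gt0 prime_gt0.
have eP z : P z -> intL (e z) /\ ~ P (e z).
  move=> Pz; have iz := prime_int PP Pz.
  split; first by apply: intLD (intLN (intLX _ iz)); apply: (intL_int L 1).
  have [_ P1 _] := PP; move=> Pe; apply: P1; rewrite -(subrK (z ^+ (p ^ 4).-1) 1).
  apply: primeD => //.
  have -> : (p ^ 4).-1 = (p ^ 4).-2.+1.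
    have : (2 ^ 4 <= p ^ 4)%N by rewrite leq_exp2r // ltnW // ltnW.
    lia.
  by rewrite exprSr; apply: primeZ => //; apply: intLX.
have ez z : P z -> exists2 y, intL y & e z * z = p%:R * y.
  move=> Pz; have iz := prime_int PP Pz; have [y iy ey] := intL_frob Ha Hi HL pp p3 iz.
  exists (- y); first exact: intLN.
  by rewrite mulrN -ey mulrBl mul1r -exprSr prednK // opprB.
pose w := \prod_(k < n) (e (u k) * e (v k)).
have [iw Pw] : intL w /\ ~ P w.
  rewrite /w; apply: (big_ind (fun x => intL x /\ ~ P x)).
  - by split; [exact: (intL_int L 1)|case: PP].
  - by move=> x y [ix nx] [iy ny]; split; [exact: intLM|case/(primeM PP ix iy)].
  - move=> k _; have [iu nu] := eP _ (Pu k); have [iv nv] := eP _ (Pv k).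
    by split; [exact: intLM|case/(primeM PP iu iv)].
have [Y iY eY] : exists2 Y, intL Y & w * p%:R = p%:R * p%:R * Y.
  have -> : w * p%:R = \sum_(k < n) w * (u k * v k) by rewrite ep mulr_sumr.
  pose Q (x : L) := exists2 Y, intL Y & x = p%:R * p%:R * Y.
  rewrite -/(Q _); apply: (big_ind Q).
  - by exists 0; [exact: (intL_int L 0)|rewrite mulr0].
  - move=> x y [X iX ->] [Z iZ ->]; exists (X + Z); [exact: intLD|by rewrite mulrDr].
  - move=> k _; have [y iy ey] := ez _ (Pu k); have [z iz ez'] := ez _ (Pv k).
    pose w' := \prod_(j < n | j != k) (e (u j) * e (v j)).
    exists (w' * (y * z)).
      apply: intLM; last exact: intLM.
      apply: (big_ind (@intL L)); [exact: (intL_int L 1)|exact: intLM|].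
      by move=> j _; apply: intLM; [case: (eP _ (Pu j))|case: (eP _ (Pv j))].
    rewrite /w (bigD1 k) //= -/w'.
    transitivity (w' * ((e (u k) * u k) * (e (v k) * v k))); first by ring.
    by rewrite ey ez'; ring.
apply: Pw; have p0 : p%:R != 0 :> L.
  by rewrite -[p%:R]/(p%:Z%:~R) intr_eq0L; have := prime_gt0 pp; lia.
have -> : w = Y * p%:R by apply: (mulIf p0); rewrite eY; ring.
exact: primeZ.
Qed.

Local Notation th := (root_m6 a i).
Local Notation be := (root_2theta a i).
Local Notation K := (<<1; th>>%AS).
Local Notation OK := (ring_of_integers K).
Local Notation qi := (quad_int th).
Local Notation lat := (quad_lattice th).

Let th2 := th2E Ha Hi.
Let OKE := ring_of_integersK Ha Hi.
Let q0 := th_qi_eq0 Ha Hi.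

Let OK_int x : OK x -> intL x. Proof. by case. Qed.

Let qi_int u v : intL (qi u v).
Proof. by apply/OK_int/OKE; exists u, v. Qed.

Let intL_divK (p : nat) u v y : (0 < p)%N -> intL y -> qi u v = p%:R * y ->
  (p %| u)%Z /\ (p %| v)%Z.
Proof.
move=> p0 iy e; have nzp : p%:R != 0 :> L.
  by rewrite -[p%:R]/(p%:Z%:~R) intr_eq0L; lia.
have yK : y \in K.
  have -> : y = (p%:R)^-1 * qi u v by rewrite e mulKf.
  apply: rpredM; first by rewrite rpredV rpred_nat.
  by have [] := OKqi OKE u v.
have /OKE[s [t ey]] : OK y by [].
have : qi u v = qi (p%:Z * s) (p%:Z * t).
  by rewrite e ey /quad_int !intrM mulrDr mulrA.
by move=> /(qi_inj q0)[-> ->]; split; apply: dvdz_mulr.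
Qed.

Let lat_int g c b x : lat g c b x -> intL x.
Proof. by move=> [s [t ->]]; apply: qi_int. Qed.

(** Multiplication by b - theta sends the ideal (p, b + theta) into p O_K, so this
    ideal cannot generate the unit ideal of O_L. *)
Lemma lies_over_split (p : nat) (b : int) : prime p -> (p %| b ^+ 2 + 6)%Z ->
  exists P, lies_over K P (lat 1 p b).
Proof.
move=> pp d; have p0 := prime_gt0 pp.
have [P PP sub] : exists2 P, prime_ideal {:L}%AS P & (lat 1 p b `<=` P)%classic.
  apply: exists_prime_above.
  - by move=> x /lat_int ix; apply/ring_of_integersL.
  - exists (qi p 0); first by exists 1, 0; congr quad_int; ring.
    by apply/eqP => /q0[]; lia.
  move=> h1; pose J := [set x | exists2 y, intL y & qi b (- 1) * x = p%:R * y]%classic.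
  have [y iy] : J 1.
    apply: ideal_mul_sub h1.
    - by exists 0; [exact: (intL_int L 0)|rewrite !mulr0].
    - move=> x y [u iu eu] [v iv ev]; exists (u + v); first exact: intLD.
      by rewrite !mulrDr eu ev.
    move=> c _ [_ ic] [s [t ->]]; have [e ee] := dvdzP d.
    exists (c * qi (b * s + e * t) (- s)); first by apply: intLM.
    have -> : p%:R = qi p 0 by rewrite (qiz th).
    rewrite mulrCA [RHS]mulrCA; congr (_ * _); rewrite !(qiM th2); congr quad_int; last by ring.
    transitivity (p%:Z * b * s + t * (b ^+ 2 + 6)); first by ring.
    by rewrite ee; ring.
  rewrite mulr1 => /(intL_divK p0 iy)[_]; rewrite dvdzE abszN dvdn1 => /eqP p1.
  by move: pp; rewrite -[p]/(`|p|%N) p1.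
exists P; split=> //; apply/predeqP => x; split=> [[Px /OKE[u [v ex]]]|lx]; last first.
  by split; [exact: sub|apply/OKE; case: lx => s [t ->]; do 2 eexists].
rewrite ex (lat1P q0); apply: (prime_dvd PP pp).
  by apply: sub; rewrite -[p%:R]/(p%:Z%:~R) -(qiz th) (lat1P q0) mulr0 subr0.
have -> : (u - b * v)%:~R = x - v%:~R * qi b 1 by rewrite ex /quad_int; ring.
apply: primeD => //; apply: primeN => //; apply: primeZ => //; first exact: intL_int.
by apply: sub; rewrite (lat1P q0) mulr1 subrr.
Qed.

Lemma lies_over_inert (p : nat) : prime p -> (forall b : int, ~~ (p %| b ^+ 2 + 6)%Z) ->
  exists P, lies_over K P (lat p 1 0).
Proof.
move=> pp nb; have p0 := prime_gt0 pp.
have latp : lat p 1 0 p%:R.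
  by rewrite -[p%:R]/(p%:Z%:~R) -(qiz th) (latzP q0) dvdzz dvdz0.
have [P PP sub] : exists2 P, prime_ideal {:L}%AS P & (lat p 1 0 `<=` P)%classic.
  apply: exists_prime_above.
  - by move=> x /lat_int ix; apply/ring_of_integersL.
  - exists (qi p 0); first by exists 1, 0; congr quad_int; ring.
    by apply/eqP => /q0[]; lia.
  move=> h1; pose J := [set x : L | exists2 y, intL y & x = p%:R * y]%classic.
  have [y iy] : J 1.
    apply: ideal_mul_sub h1.
    - by exists 0; [exact: (intL_int L 0)|rewrite !mulr0].
    - move=> x y [u iu eu] [v iv ev]; exists (u + v); first exact: intLD.
      by rewrite !mulrDr eu ev.
    move=> c _ [_ ic] [s [t ->]]; exists (c * qi s t); first by apply: intLM.
    have -> : p%:R = qi p 0 by rewrite (qiz th).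
    by rewrite [RHS]mulrCA; congr (_ * _); rewrite !(qiM th2); congr quad_int; ring.
  move=> e1; have [] := intL_divK p0 iy (etrans (qi1 th) e1).
  rewrite dvdzE dvdn1 => /eqP p1.
  by move: pp; rewrite -[p]/(`|p|%N) p1.
exists P; split=> //; apply/predeqP => x; split=> [[Px /OKE[u [v ex]]]|lx]; last first.
  by split; [exact: sub|apply/OKE; case: lx => s [t ->]; do 2 eexists].
rewrite ex (latzP q0); apply: (inert_dvd pp nb); apply: (prime_dvd PP pp); first exact: sub.
have -> : (u ^+ 2 + 6 * v ^+ 2)%:~R = qi u (- v) * x.
  by rewrite ex (qiM th2) -(qiz th); congr quad_int; ring.
exact: primeZ.
Qed.

(** * Frobenius elements *)

(** A Frobenius element multiplies a square root y of c by a sign congruent to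
    y^(N - 1) = c^((N - 1)/2), where N is the norm of the prime. *)
Lemma frobenius_sqrt P J (s : gal_of {:L}) (p : nat) (y c : L) (h : nat) :
  prime p -> odd p -> lies_over K P J -> J p%:R -> absolute_norm K J = h.*2.+1 ->
  is_frobenius K J s -> intL y -> y ^+ 2 = c -> ~ P y ->
  (s y = y \/ s y = - y) ->
  exists2 e : int, s y = e%:~R * y & (e = 1 \/ e = -1) /\ P (e%:~R - c ^+ h).
Proof.
move=> pp op PJ Jp nJ [_ fr] iy yc nPy sy; have [PP _] := PJ.
have [e es ee] : exists2 e : int, s y = e%:~R * y & e = 1 \/ e = -1.
  by case: sy => ->; [exists 1|exists (-1)]; rewrite ?mul1r ?mulN1r; [|left| |right].
exists e => //; split=> //.
have := fr P PJ y (proj2 (ring_of_integersL y) iy); rewrite nJ es.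
have -> : e%:~R * y - y ^+ h.*2.+1 = y * (e%:~R - c ^+ h).
  by rewrite exprS -mul2n exprM yc; ring.
have ic : intL c by rewrite -yc; apply: intLX.
by case/(primeM PP iy (intLD (intL_int L e) (intLN (intLX h ic)))).
Qed.

Lemma odd_of_gt3 p : prime p -> (3 < p)%N -> odd p.
Proof. by move=> pp p3; case: (even_prime pp) => // p2; move: p3; rewrite p2. Qed.

Lemma leg_of_prime P (p : nat) (e : int) (t : int) : prime_ideal {:L}%AS P ->
  prime p -> odd p -> P p%:R -> (e = 1 \/ e = -1) -> P (e%:~R - t%:~R ^+ p./2) ->
  e = leg t p.
Proof.
move=> PP pp op Pp ee; rewrite -rmorphXn -intrB => /(prime_dvd PP pp Pp).
rewrite -Fp_int_eq0 // intrB subr_eq0 rmorphXn /= => /eqP h.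
by apply/esym/leg_eq => //; case: ee => ->.
Qed.

Section FrobeniusValues.
Variables (p : nat) (s : gal_of {:L}).
Hypotheses (pp : prime p) (p3 : (3 < p)%N).
Let op := odd_of_gt3 pp p3.

Let pz0 : 0 < p%:Z. Proof. by rewrite ltz_nat prime_gt0. Qed.

Let notP P y n (m : int) : prime_ideal {:L}%AS P -> P p%:R -> intL y ->
  y ^+ n = m%:~R -> (0 < n)%N -> ~~ (p %| m)%Z -> ~ P y.
Proof.
move=> PP Pp iy ye n0 pm Py; case/negP: pm; apply: (prime_dvd PP pp Pp).
by rewrite -ye -(prednK n0) exprSr; apply: primeZ => //; apply: intLX.
Qed.

Let ndvd (m : nat) : (0 < m)%N -> (p %| m)%N -> (p <= m)%N.
Proof. by move=> m0 /(dvdn_leq m0). Qed.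

Let p24 : ~~ (p %| 24)%N.
Proof.
rewrite (_ : 24 = 2 ^ 3 * 3)%N // Euclid_dvdM // Euclid_dvdX // !andbT.
by rewrite !gtnNdvd // (ltn_trans _ p3).
Qed.

Let be_int : intL be.
Proof.
apply: intLM; last exact: (intL_a Ha).
by apply: intLD (intL_i Hi); apply: (intL_int L 1).
Qed.

Lemma be4 : be ^+ 4 = (- 24)%:~R.
Proof.
rewrite (exprM be 2 2) (be2E a Hi) exprMn th2 rmorphN /=.
by rewrite -natrX mulrN -natrM.
Qed.

Let be_cases : s \in 'Gal({:L} / K)%g -> s be = be \/ s be = - be.
Proof.
rewrite galK_th => /eqP sth.
have : (s be) ^+ 2 == be ^+ 2.
  by rewrite -rmorphXn /= (be2E a Hi) rmorphM /= sth rmorph_nat.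
by rewrite eqf_sqr => /orP[]/eqP; [left|right].
Qed.

Let i_cases : s i = i \/ s i = - i. Proof. exact: (gal_sqrt s (i2z Hi)). Qed.

Let nP_be P : prime_ideal {:L}%AS P -> P p%:R -> ~ P be.
Proof.
move=> PP Pp; apply: (notP PP Pp be_int be4) => //.
Qed.

Let nP_i P : prime_ideal {:L}%AS P -> P p%:R -> ~ P i.
Proof.
move=> PP Pp; apply: (notP PP Pp (intL_i Hi) (i2z Hi)) => //.
by rewrite dvdzE abszN dvdn1; case: (p) pp => [|[]].
Qed.

(** The residue field is F_p, in which theta is - b. *)
Lemma frobenius_split (b : int) : (p %| b ^+ 2 + 6)%Z ->
  is_frobenius K (lat 1 p b) s ->
  s i = (leg (-1) p)%:~R * i /\ s be = (leg (- (2 * b)) p)%:~R * be.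
Proof.
move=> d fr; have [P PJ] := lies_over_split pp d; have [PP PJe] := PJ.
have Jp : lat 1 p b p%:R.
  by rewrite -[p%:R]/(p%:Z%:~R) -(qiz th) (lat1P q0) mulr0 subr0.
have Pp : P p%:R by move: Jp; rewrite -PJe => -[].
have nJ : absolute_norm K (lat 1 p b) = (p./2).*2.+1.
  by rewrite (lat_norm OKE q0 _ (isT : 0 < 1 :> int) pz0) exp1n mul1n absz_nat -odd_doubleE.
have sK : s \in 'Gal({:L} / K)%g by case: fr.
split.
  have [e -> [ee Pe]] := frobenius_sqrt pp op PJ Jp nJ fr (intL_i Hi) (i2z Hi) (nP_i PP Pp) i_cases.
  by rewrite (leg_of_prime PP pp op Pp ee Pe).
have [e -> [ee Pe]] := frobenius_sqrt pp op PJ Jp nJ fr be_int (be2E a Hi) (nP_be PP Pp) (be_cases sK).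
rewrite (@leg_of_prime P p e (- (2 * b)) PP pp op Pp ee) //.
have Pb : P (2%:R * th - (- (2 * b))%:~R).
  have -> : 2%:R * th - (- (2 * b))%:~R = 2%:~R * qi b 1 by rewrite /quad_int; ring.
  apply: primeZ => //; first exact: intL_int.
  by have : lat 1 p b (qi b 1) by [rewrite (lat1P q0) mulr1 subrr]; rewrite -PJe => -[].
have -> : e%:~R - (- (2 * b))%:~R ^+ p./2 = (e%:~R - (2%:R * th) ^+ p./2)
   + ((2%:R * th) ^+ p./2 - (- (2 * b))%:~R ^+ p./2) by ring.
apply: primeD => //; rewrite subrXX mulrC; apply: primeZ => //.
apply: (big_ind (@intL L)); [exact: (intL_int L 0)|exact: intLD|].
move=> k _; apply: intLM; apply: intLX; last exact: intL_int.
by apply: (intLM (intL_int L 2)); exact: (intL_th Ha Hi).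
Qed.

(** The residue field has p^2 elements and (2 theta)^2 = -24, so the sign is
    (-24 / p)^((p + 1)/2) = (-1)^((p + 1)/2), as -6 is not a square modulo p. *)
Lemma frobenius_inert : (forall b : int, ~~ (p %| b ^+ 2 + 6)%Z) ->
  is_frobenius K (lat p 1 0) s -> s i = i /\ s be = (leg 6 p)%:~R * be.
Proof.
move=> nb fr; have [P PJ] := lies_over_inert pp nb; have [PP PJe] := PJ.
have Jp : lat p 1 0 p%:R.
  by rewrite -[p%:R]/(p%:Z%:~R) -(qiz th) (latzP q0) dvdzz dvdz0.
have Pp : P p%:R by move: Jp; rewrite -PJe => -[].
have ep := odd_doubleE op; set h := p./2 in ep.
have nJ : absolute_norm K (lat p 1 0) = ((h * h.+1).*2).*2.+1.
  rewrite (lat_norm OKE q0 _ pz0 (isT : 0 < 1 :> int)) muln1 absz_nat [in LHS]ep -mulnn.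
  by clear; lia.
have sK : s \in 'Gal({:L} / K)%g by case: fr.
split.
  have [e -> [ee Pe]] := frobenius_sqrt pp op PJ Jp nJ fr (intL_i Hi) (i2z Hi) (nP_i PP Pp) i_cases.
  suff -> : e = 1 by rewrite mul1r.
  case: ee => // ee; exfalso; have P2 : P (- 2)%:~R.
    move: Pe; rewrite ee -mul2n exprM mulrN1z sqrrN !expr1n.
    by congr P; ring.
  have := prime_dvd PP pp Pp P2; rewrite dvdzE => /(ndvd (isT : (0 < 2)%N)).
  by move: p3; lia.
have [e -> [ee Pe]] := frobenius_sqrt pp op PJ Jp nJ fr be_int (be2E a Hi) (nP_be PP Pp) (be_cases sK).
have l6 : leg (- 6) p = -1 by apply: leg_nonsquare => // b; rewrite opprK.
have l2 : leg 2 p ^+ 2 = 1.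
  by apply: leg_sqr1 => //; rewrite dvdzE; apply/negP => /(ndvd (isT : (0 < 2)%N)); move: p3; lia.
have l24 : leg (- 24) p = -1.
  by rewrite (_ : - 24 = 2 * 2 * - 6) // !legM // -expr2 l2 l6 mul1r.
have -> : leg 6 p = (-1) ^+ h.+1.
  by rewrite (_ : 6 = -1 * - 6) // legM // l6 legN1 // exprSr.
suff -> : e = (-1) ^+ h.+1 by [].
apply: (leg_inj pp op); [by case: ee => ->|by rewrite normrX normrN1 expr1n|].
rewrite rmorphXn rmorphN1 -[-1 in RHS]/((-1)%:~R) -l24 legE // -/h -exprM.
have sq : (2%:R * th) ^+ 2 = (- 24)%:~R by rewrite exprMn th2; ring.
move: Pe; rewrite -mul2n exprM sq -rmorphXn -intrB => /(prime_dvd PP pp Pp).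
by rewrite -Fp_int_eq0 // intrB subr_eq0 rmorphXn => /eqP.
Qed.

End FrobeniusValues.

End Unramified.

Lemma pent_ge (k : int) : (`|k| <= pent k)%N.
Proof.
have := tri_upE k; have := tri_dnE k; rewrite /pent.
have -> : k * (k - 1) = k ^+ 2 - k by ring.
have -> : k * (k + 1) = k ^+ 2 + k by ring.
have : `|k|%N%:Z <= k ^+ 2 by rewrite expr2; nia.
by move: (k ^+ 2) (tri_up k) (tri_dn k) => *; lia.
Qed.

(** * Artin maps over Q(sqrt(-6)) *)
Section Artin.
Variables (L : splittingFieldType rat) (a i : L).
Hypotheses (Ha : a ^+ 4 = 6%:R) (Hi : i ^+ 2 = -1).
Hypothesis HL : <<<<1; a>>; i>>%VS = {:L}%VS.

Local Notation th := (root_m6 a i).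
Local Notation be := (root_2theta a i).
Local Notation K := (<<1; th>>%AS).
Local Notation OK := (ring_of_integers K).
Local Notation qi := (quad_int th).
Local Notation lat := (quad_lattice th).

Let th2 := th2E Ha Hi.
Let OKE := ring_of_integersK Ha Hi.
Let q0 := th_qi_eq0 Ha Hi.

Let OK1 : OK 1. Proof. by have := OKqi OKE 1 0; rewrite (qi1 th). Qed.

(** The two signs d and e determine an element of Gal(L/K), and they are
    multiplicative in s: this is how Artin symbols are computed below. *)
Definition acts (s : gal_of {:L}) (d e : int) :=
  [/\ s \in 'Gal({:L} / K)%g, s i = d%:~R * i & s be = e%:~R * be].

Lemma actsM s t d e d' e' : acts s d e -> acts t d' e' -> acts (s * t)%g (d * d') (e * e').
Proof.
move=> [sK si sb] [tK ti tb]; split; first exact: groupM.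
  by rewrite gal_mulE si rmorphM /= rmorph_int ti intrM; ring.
by rewrite gal_mulE sb rmorphM /= rmorph_int tb intrM; ring.
Qed.

Lemma acts1 : acts 1%g 1 1.
Proof. by split; rewrite ?group1 // gal_id mul1r. Qed.

Section ArtinMap.
Variables (f : modulus K) (Phi : set L -> gal_of {:L}).
Hypothesis hPhi : is_artin_map f Phi.

Local Notation cop := (coprime_to_modulus f).

Lemma unit_ideal_absorb J : integral_ideal K J -> ideal_mul J (lat 1 1 0) = J.
Proof.
move=> [[_ [x0 J0 _] JD JZ _] _]; apply/predeqP => x; split; move: x.
  apply: ideal_mul_sub => //.
    by rewrite -(mul0r x0); apply: JZ => //; rewrite -(qi0 th); apply: (OKqi OKE).
  move=> x _ Jx [s [t ->]]; rewrite mulrC; apply: JZ => //; exact: (OKqi OKE).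
move=> x Jx; rewrite -[x]mulr1; apply: ideal_mul_mem => //.
by rewrite -(qi1 th) (lat1P q0) mulr0 subr0.
Qed.

Lemma unit_ideal_coprime : cop (lat 1 1 0).
Proof.
split; first by apply: (lat_integral th2 OKE q0).
exists 1, 0; split; rewrite ?addr0 //; first by rewrite -(qi1 th) (lat1P q0) mulr0 subr0.
have [[_ [x fx _] _ fZ _] _] := finite_partP f.
by rewrite -(mul0r x); apply: fZ => //; rewrite -(qi0 th); apply: (OKqi OKE).
Qed.

Lemma coprime_ray J : cop J -> ray_ideals f J.
Proof.
move=> cJ; have [JI _] := cJ; split; first by case: JI.
exists J, (lat 1 1 0); split=> //; first exact: unit_ideal_coprime.
exact: unit_ideal_absorb.
Qed.

Lemma ideal_mul_subl J1 J2 : integral_ideal K J1 -> integral_ideal K J2 ->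
  (ideal_mul J1 J2 `<=` J1)%classic.
Proof.
move=> [[_ [x0 J0 _] JD JZ _] _] [_ J2O]; apply: ideal_mul_sub => //.
  by rewrite -(mul0r x0); apply: JZ => //; rewrite -(qi0 th); apply: (OKqi OKE).
by move=> x y J1x J2y; rewrite mulrC; apply: JZ => //; apply: J2O.
Qed.

Lemma coprime_factor J1 J2 : integral_ideal K J1 -> integral_ideal K J2 ->
  cop (ideal_mul J1 J2) -> cop J1 /\ cop J2.
Proof.
move=> I1 I2 [_ [x [y [Jx fy e]]]]; split; split=> //; exists x, y; split=> //.
  exact: (ideal_mul_subl I1 I2).
by apply: (ideal_mul_subl I2 I1); rewrite ideal_mulC.
Qed.

Lemma artin_mul J1 J2 : cop J1 -> cop J2 -> Phi (ideal_mul J1 J2) = (Phi J1 * Phi J2)%g.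
Proof. by move=> c1 c2; case: hPhi => + _; apply; apply: coprime_ray. Qed.

Lemma artin_unit : Phi (lat 1 1 0) = 1%g.
Proof.
have c1 := unit_ideal_coprime; have := artin_mul c1 c1.
rewrite unit_ideal_absorb; last by case: c1.
by move/(congr1 (fun s => (Phi (lat 1 1 0))^-1 * s)%g); rewrite mulKg mulVg => ->.
Qed.

Lemma lat11 b : lat 1 1 b = lat 1 1 0.
Proof.
apply/predeqP => x; split=> [[s [t ->]]|[s [t ->]]]; [exists (s + b * t), t|exists (s - b * t), t];
  by congr quad_int; ring.
Qed.

Lemma coprime6_prime p : prime p -> coprime p 6 -> (3 < p)%N.
Proof. by case: p => [|[|[|[|]]]]. Qed.

(** By [lat_mul] the ideal is a product of primes of degree 1, over which both
    signs are multiplicative.  The first claim concerns all primes, also 2 and 3: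
    the modulus f may well be prime to them. *)
Lemma artin_lat1 (c : nat) (b : int) : (0 < c)%N -> (c %| b ^+ 2 + 6)%Z -> cop (lat 1 c b) ->
  Phi (lat 1 c b) \in 'Gal({:L} / K)%g /\
  (coprime c 6 -> acts (Phi (lat 1 c b)) (jac (-1) c) (jac (- (2 * b)) c)).
Proof.
move: c; apply: mul_prime_ind => [|p c pp c0 IH].
  rewrite lat11 artin_unit group1 => _ _; split=> // _; rewrite !jac1; exact: acts1.
rewrite PoszM => d cop12.
have dp : (p %| b ^+ 2 + 6)%Z by apply: dvdz_trans d; apply: dvdz_mulr.
have dc : (c %| b ^+ 2 + 6)%Z by apply: dvdz_trans d; apply: dvdz_mull.
have ip : integral_ideal K (lat 1 p b).
  by apply: (lat_integral th2 OKE q0) => //; rewrite ltz_nat prime_gt0.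
have ic : integral_ideal K (lat 1 c b) by apply: (lat_integral th2 OKE q0).
rewrite -(lat_mul th2 OKE d) in cop12 *.
have [c1 c2] := coprime_factor ip ic cop12; rewrite artin_mul //.
have fr : is_frobenius K (lat 1 p b) (Phi (lat 1 p b)).
  by case: hPhi => _; apply=> //; apply: (lat_prime_split th2 OKE q0).
have [gc ac] := IH dc c2; have gp : Phi (lat 1 p b) \in 'Gal({:L} / K)%g by case: fr.
split; first exact: groupM.
rewrite coprimeMl => /andP[cp6 cc6]; have p3 := coprime6_prime pp cp6.
have [fi fb] := frobenius_split Ha Hi pp p3 dp fr.
rewrite !jacMn ?(prime_gt0 pp) // !(jac_prime _ pp); apply: actsM; last exact: ac.
by split.
Qed.

(** A rational prime is inert, or the product of two conjugate primes, whose signs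
    multiply to (4 b^2 * (-1) / p) = (24 / p) = (6 / p). *)
Lemma artin_latz (g : nat) : (0 < g)%N -> cop (lat g 1 0) ->
  Phi (lat g 1 0) \in 'Gal({:L} / K)%g /\
  (coprime g 6 -> acts (Phi (lat g 1 0)) 1 (jac 6 g)).
Proof.
move: g; apply: mul_prime_ind => [|p g pp g0 IH].
  rewrite artin_unit group1 => _; split=> // _; rewrite jac1; exact: acts1.
rewrite PoszM -(lat_scale th2 OKE) // => cop12.
have pz0 : 0 < p%:Z by rewrite ltz_nat prime_gt0.
have ip : integral_ideal K (lat p 1 0) by apply: (lat_integral th2 OKE q0).
have ig : integral_ideal K (lat g 1 0) by apply: (lat_integral th2 OKE q0).
have [c1 c2] := coprime_factor ip ig cop12; rewrite artin_mul //.
have [gg ag] := IH c2.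
suff [gp ap] : Phi (lat p 1 0) \in 'Gal({:L} / K)%g /\
    (coprime p 6 -> acts (Phi (lat p 1 0)) 1 (leg 6 p)).
  split; first exact: groupM.
  rewrite coprimeMl => /andP[cp6 cg6]; rewrite jacMn ?(prime_gt0 pp) // (jac_prime _ pp).
  by rewrite -[1]mulr1; apply: actsM; [exact: ap|exact: ag].
have [[b db]|nb] := pselect (exists b : int, (p %| b ^+ 2 + 6)%Z); last first.
  have {}nb (b : int) : ~~ (p %| b ^+ 2 + 6)%Z by apply/negP => d; apply: nb; exists b.
  have fr : is_frobenius K (lat p 1 0) (Phi (lat p 1 0)).
    by case: hPhi => _; apply=> //; apply: (lat_prime_inert th2 OKE q0).
  have gp : Phi (lat p 1 0) \in 'Gal({:L} / K)%g by case: fr.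
  split=> // cp6; have p3 := coprime6_prime pp cp6.
  have [fi fb] := frobenius_inert Ha Hi pp p3 nb fr.
  by split=> //; rewrite mul1r.
have dnb : (p %| (- b) ^+ 2 + 6)%Z by rewrite sqrrN.
move: c1; rewrite -(lat_split th2 OKE db) => c1.
have i1 : integral_ideal K (lat 1 p b) by apply: (lat_integral th2 OKE q0).
have i2 : integral_ideal K (lat 1 p (- b)) by apply: (lat_integral th2 OKE q0).
have [k1 k2] := coprime_factor i1 i2 c1; rewrite artin_mul //.
have [g1 a1] := artin_lat1 (prime_gt0 pp) db k1.
have [g2 a2] := artin_lat1 (prime_gt0 pp) dnb k2.
split; first exact: groupM.
move=> cp6; have op := odd_of_gt3 pp (coprime6_prime pp cp6).
have := actsM (a1 cp6) (a2 cp6); rewrite !(jac_prime _ pp) -!legM // mulrN1 opprK.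
have -> : leg 1 p = 1 by apply: leg_eq => //; rewrite expr1n.
suff -> : leg (- (2 * b) * - (2 * - b)) p = leg 6 p by [].
have cp2 : ~~ (p %| 2)%Z.
  by rewrite dvdzE -prime_coprime //; apply: coprime_dvdr cp6.
transitivity (leg (6 * (2 * 2)) p).
  apply: leg_mod => //; case/dvdzP: db => q eq; apply/dvdzP; exists (- (4 * q)).
  transitivity (- 4 * (b ^+ 2 + 6)); first by ring.
  by rewrite eq; ring.
by rewrite !legM // -expr2 leg_sqr1 // mulr1.
Qed.

Lemma lat_nat J : integral_ideal K J -> exists (g c : nat) (b : int),
  [/\ (0 < g)%N, (0 < c)%N, (c %| b ^+ 2 + 6)%Z & J = lat g c b].
Proof.
move=> /(integral_lat th2 OKE)[g [c [b [g0 c0 d ->]]]].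
exists `|g|%N, `|c|%N, b; rewrite !gez0_abs ?ltW //; split=> //; lia.
Qed.

Lemma lat_factor (g c : nat) (b : int) : (0 < g)%N -> (0 < c)%N -> (c %| b ^+ 2 + 6)%Z ->
  cop (lat g c b) -> [/\ cop (lat g 1 0), cop (lat 1 c b) &
    Phi (lat g c b) = (Phi (lat g 1 0) * Phi (lat 1 c b))%g].
Proof.
move=> g0 c0 d.
have -> : lat g c b = ideal_mul (lat g 1 0) (lat 1 c b) by rewrite (lat_scale th2 OKE) // mulr1.
move=> h; have ig : integral_ideal K (lat g 1 0) by apply: (lat_integral th2 OKE q0).
have ic : integral_ideal K (lat 1 c b) by apply: (lat_integral th2 OKE q0).
by have [c1 c2] := coprime_factor ig ic h; split=> //; apply: artin_mul.
Qed.

(** Every ideal coprime to f is a product of primes, and Frobenius elements belong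
    to this group. *)
Lemma artin_gal J : ray_ideals f J -> Phi J \in 'Gal({:L} / K)%g.
Proof.
have copG I : cop I -> Phi I \in 'Gal({:L} / K)%g.
  move=> cI; have [/lat_nat[g [c [b [g0 c0 d eI]]]] _] := cI.
  rewrite eI in cI *; have [c1 c2 ->] := lat_factor g0 c0 d cI.
  by apply: groupM; [case: (artin_latz g0 c1)|case: (artin_lat1 c0 d c2)].
move=> rJ; have [_ [A [B [cA cB e]]]] := rJ.
have : Phi A = (Phi J * Phi B)%g by rewrite -e; case: hPhi => + _; apply=> //; apply: coprime_ray.
move=> eA; have -> : Phi J = (Phi A * (Phi B)^-1)%g by rewrite eA mulgK.
by rewrite groupM ?groupV ?copG.
Qed.

(** The explicit reciprocity law: the content of the generator contributes
    (6 / g), and the primitive part (6 / u') by [jac_norm_form]. *)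
Lemma artin_principal (u m : int) : odd `|u| -> ~~ (3 %| `|u|)%N ->
  cop (principal K (qi u (2 * m))) ->
  acts (Phi (principal K (qi u (2 * m)))) 1 (jac 6 `|u|).
Proof.
move=> ou u3; have nz : (u != 0) || (2 * m != 0) by apply/orP; left; apply: contraTneq ou => ->.
have [g [u' [v' [N [b [g0 N0 [eu ev] cuv [eN dN db ->]]]]]]] := principal_lat th2 OKE q0 nz.
move: ou u3; rewrite eu abszM oddM => /andP[og ou'] u3.
have [m' em'] : exists m', v' = 2 * m'.
  exists (v' %/ 2)%Z; have [//|ov] : v' = 2 * (v' %/ 2)%Z \/ v' = 2 * (v' %/ 2)%Z + 1.
    by clear; lia.
  have ov' : odd `|v'| by move: ov; clear; lia.
  have : odd `|(g * v')%R| by rewrite abszM oddM og ov'.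
  by rewrite -ev; clear; lia.
have eg : g = `|g|%N by rewrite gez0_abs // ltW.
have eNn : N = `|N|%N by rewrite gez0_abs // ltW.
have un0 : (0 < `|u'|)%N by rewrite lt0n; apply: contraTneq ou' => ->.
have gn0 : (0 < `|g|)%N by move: g0; clear; lia.
have Nn0 : (0 < `|N|)%N by move: N0; clear; lia.
rewrite eg eNn in db dN *.
move=> h; have [c1 c2 ->] := lat_factor gn0 Nn0 db h.
have [g3 u'3] : ~~ (3 %| `|g|)%N /\ ~~ (3 %| `|u'|)%N.
  by move: u3; rewrite Euclid_dvdM // negb_or => /andP.
have eN' : `|N|%N%:Z = u' ^+ 2 + 24 * m' ^+ 2 by rewrite -eNn eN em'; ring.
have cop6 (n : nat) : odd n -> ~~ (3 %| n)%N -> coprime n 6.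
  by move=> on n3; rewrite (coprimeMr n 2 3) coprimen2 on coprime_sym prime_coprime.
have cg6 := cop6 _ og g3.
have [k ek] := odd_int_sqr ou'.
have N8 : (`|N| %% 8 = 1)%N.
  have : `|N|%N%:Z = 8 * (k + 3 * m' ^+ 2) + 1 by rewrite eN' ek; ring.
  by clear; lia.
have oN : odd `|N| by move: N8; clear; lia.
have N3 : ~~ (3 %| `|N|)%N.
  apply: contra u'3 => dN3; have : (3%N %| u' * u')%Z.
    have -> : u' * u' = `|N|%N%:Z - 8 * m' ^+ 2 * 3%N%:Z by rewrite eN'; ring.
    by rewrite rpredB ?dvdz_mull // dvdzE.
  by rewrite dvdz_prime_mul // orbb dvdzE.
have [_ /(_ cg6) a1] := artin_latz gn0 c1.
have [_ /(_ (cop6 _ oN N3)) a2] := artin_lat1 Nn0 db c2.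
have := actsM a1 a2; rewrite mul1r jacN1 //.
have -> : (`|N| %% 4 == 3)%N = false by move: N8; clear; lia.
rewrite expr0 (@jac_norm_form u' m' b) //.
- by rewrite -jacMn.
- by move: cuv; rewrite coprimezE em' abszM coprimeMr => /andP[].
- by rewrite (_ : _ - _ = - (u' - b * v')) ?rpredN // em'; ring.
Qed.

End ArtinMap.

(** * Reciprocity modulo 24 and the conductor *)

Lemma mod24_integral : integral_ideal K (lat 24 1 0).
Proof. exact: (lat_integral th2 OKE q0). Qed.

Definition modulus24 : modulus K :=
  @Modulus L K (lat 24 1 0) [set t | real_embedding t]%classic mod24_integral (fun t h => h).

Lemma principal_mul (x y : L) :
  ideal_mul (principal K x) (principal K y) = principal K (x * y).
Proof.
have O1 := OK1.
have OM c d : OK c -> OK d -> OK (c * d).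
  move=> /OKE[u [v ->]] /OKE[u' [v' ->]]; rewrite (qiM th2); apply: (OKqi OKE).
have O0 : OK 0 by rewrite -(qi0 th); apply: (OKqi OKE).
apply/predeqP => z; split; move: z.
  apply: ideal_mul_sub.
  - by exists 0; [exact: O0|rewrite mul0r].
  - move=> _ _ [c /OKE[u [v ->]] <-] [d /OKE[u' [v' ->]] <-].
    exists (qi u v + qi u' v'); last by rewrite mulrDl.
    by rewrite (qiD th); apply: (OKqi OKE).
  - move=> _ _ [c Oc <-] [d Od <-]; exists (c * d); [exact: OM|ring].
move=> _ [c Oc <-]; rewrite mulrA; apply: ideal_mul_mem; [by exists c|].
by exists 1; rewrite ?mul1r.
Qed.

Lemma acts_trivial s : acts s 1 1 -> s = 1%g.
Proof.
move=> [_ si sb]; rewrite !mul1r in si sb.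
apply: (gal_ext HL); rewrite gal_id //.
have i1 : 1 + i != 0.
  apply/eqP => e; move/eqP: Hi; rewrite (_ : i = -1) ?sqrrN ?expr1n; last first.
    by apply/eqP; rewrite -addr_eq0 addrC e.
  by rewrite -addr_eq0 -[1 + 1]/(2%:~R) intr_eq0L.
by apply: (mulfI i1); rewrite -[RHS]sb rmorphM rmorphD rmorph1 /= si.
Qed.

Lemma principal_one_mod24 w : OK w -> lat 24 1 0 (w - 1) ->
  exists u m : int, [/\ w = qi u (2 * m), odd `|u|, ~~ (3 %| `|u|)%N & jac 6 `|u| = 1].
Proof.
move=> /OKE[u [v ->]]; rewrite -(qi1 th) (qiB th) (latzP q0) subr0 => -[/dvdzP[s es] /dvdzP[t et]].
have eu : u = 24 * s + 1 by move/eqP: es; rewrite subr_eq => /eqP->; ring.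
have ou : odd `|u| by rewrite eu; clear; lia.
have u3 : ~~ (3 %| `|u|)%N by rewrite eu; clear; lia.
exists u, (12 * t); split=> //; first by rewrite et; congr quad_int; ring.
rewrite jac6 //; have -> : (`|u| %% 24 \in [:: 7; 11; 13; 17])%N = false.
  have : (`|u| %% 24 = 1 \/ `|u| %% 24 = 23)%N by rewrite eu; clear; lia.
  by case=> ->.
by [].
Qed.

Lemma coprime_one_mod24 w : w != 0 -> OK w -> lat 24 1 0 (w - 1) ->
  coprime_to_modulus modulus24 (principal K w).
Proof.
move=> w0 Ow h; split.
  have /OKE[u [v ew]] := Ow; rewrite ew; apply: (principal_integral th2 OKE q0).
  by rewrite -negb_and; apply: contra w0 => /andP[/eqP u0 /eqP v0]; rewrite ew u0 v0 (qi0 th).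
exists w, (1 - w); split; last by rewrite addrC subrK.
  by exists 1; [exact: OK1|rewrite mul1r].
rewrite -opprB; case: h => s [t ->]; exists (- s), (- t).
by rewrite (qiN th); congr quad_int; ring.
Qed.

Lemma coprime_prime_gt3 J : prime_ideal K J -> coprime_to_modulus modulus24 J ->
  exists p, [/\ prime p, (3 < p)%N & J p%:R].
Proof.
move=> [JI J1 JM] [_ [x [y [Jx y24 e]]]].
have [JF JO] := JI; have [_ _ JD JZ _] := JF.
have OKn (n : nat) : OK n%:R by rewrite -[n%:R]/(n%:Z%:~R) -(qiz th); apply: (OKqi OKE).
have [p pp Jp] : exists2 p, prime p & J p%:R.
  have [g [c [b [g0 c0 d eJ]]]] := lat_nat JI.
  have Jgc : J (g * c)%N%:R.
    rewrite eJ -[_%:R]/((g * c)%N%:Z%:~R) -(qiz th).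
    by exists 1, 0; congr quad_int; rewrite ?PoszM; ring.
  have gc0 : (0 < g * c)%N by rewrite muln_gt0 g0.
  move: (g * c)%N gc0 Jgc; apply: mul_prime_ind => // p n pp n0 IH.
  rewrite natrM => /(JM _ _ (OKn p) (OKn n))[Jp|/IH//].
  by exists p.
exists p; split=> //; rewrite ltnNge; apply/negP => p3; apply: J1.
have p24 : (p %| 24)%N.
  by case: p pp p3 {Jp} => [|[|[|[|]]]].
have J24 : J 24%:R.
  by rewrite -(divnK p24) natrM; apply: JZ.
rewrite -e; apply: JD => //; case: y24 => s [t ->].
have -> : qi (24 * (1 * s + 0 * t)) (24 * t) = qi s t * 24%:R by rewrite /quad_int; ring.
by apply: JZ => //; apply: (OKqi OKE).
Qed.

(** A ray class (x / y) with x congruent to y is also (x z / y z), where z is an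
    inverse of y modulo 24; both new generators are 1 modulo 24, where the explicit
    law gives the trivial automorphism. *)
Lemma admissible24 : admissible modulus24.
Proof.
split=> [p pp cp|t //|Phi hPhi J [x [y [[x0 y0] cx cy [Ox [Oy fxy]] [_ ->]]]]].
  have [q [pq q3 Jq]] := coprime_prime_gt3 pp cp.
  exact: (unramified_above Ha Hi HL pq q3 Jq).
have OM c d : OK c -> OK d -> OK (c * d).
  move=> /OKE[u [v ->]] /OKE[u' [v' ->]]; rewrite (qiM th2); apply: (OKqi OKE).
have O1 := OK1.
have [_ [_ [t [[z Oz <-] t24 ezt]]]] := cy.
have e1 : y * z - 1 = - t by rewrite -ezt; ring.
have h1 : lat 24 1 0 (y * z - 1).
  rewrite e1; case: t24 => s [w ->]; exists (- s), (- w).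
  by rewrite (qiN th); congr quad_int; ring.
have h2 : lat 24 1 0 (x * z - 1).
  have -> : x * z - 1 = z * (x - y) + (y * z - 1) by ring.
  by apply: latD => //; apply: (latZ th2 OKE).
have z0 : z != 0.
  apply/eqP => zz; move: h1; rewrite zz mulr0 sub0r -(qi1 th) (qiN th) (latzP q0).
  by case.
have one w : w != 0 -> OK w -> lat 24 1 0 (w - 1) -> Phi (principal K w) = 1%g.
  move=> w0 Ow hw; have cw := coprime_one_mod24 w0 Ow hw.
  have [u [m [ew ou u3 j6]]] := principal_one_mod24 Ow hw.
  by apply: acts_trivial; rewrite ew in cw *; have := artin_principal hPhi ou u3 cw; rewrite j6.
have rJ : ray_ideals modulus24 (principal K (x / y)).
  split; last by exists (principal K x), (principal K y); split=> //; rewrite principal_mul divfK.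
  have [xK yK] : x \in K /\ y \in K by case: Ox; case: Oy.
  split.
  - by move=> _ [c [cK _] <-]; rewrite /mkset rpredM // rpred_div.
  - by exists (x / y); [exists 1; rewrite ?mul1r|rewrite mulf_neq0 // invr_eq0].
  - move=> _ _ [c /OKE[u [v ->]] <-] [d /OKE[u' [v' ->]] <-].
    exists (qi u v + qi u' v'); last by rewrite mulrDl.
    by rewrite (qiD th); apply: (OKqi OKE).
  - by move=> c _ Oc [d Od <-]; exists (c * d); rewrite ?mulrA //; apply: OM.
  - exists y => // _ [c Oc <-]; rewrite mulrC -mulrA divfK //; exact: OM.
have ryz : ray_ideals modulus24 (principal K (y * z)).
  by apply: coprime_ray; apply: coprime_one_mod24 => //; [rewrite mulf_neq0|apply: OM].
have := (proj1 hPhi) _ _ rJ ryz; rewrite principal_mul mulrA divfK //.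
rewrite (one (x * z)) ?mulf_neq0 //; last exact: OM.
by rewrite (one (y * z)) ?mulf_neq0 // ?mulg1 => [<-|]; last exact: OM.
Qed.

(** * The theta series over Q(sqrt(-6)) *)
Section Theta.
Variables (f : modulus K) (Phi : set L -> gal_of {:L}).
Hypotheses (hf : is_conductor f) (hPhi : is_artin_map f Phi).

(** An ideal of norm 1 modulo 24 is therefore coprime to the conductor, whatever
    the conductor is. *)
Lemma conductor_dvd24 : (lat 24 1 0 `<=` finite_part f)%classic.
Proof. by case: hf => _ /(_ _ admissible24)[]. Qed.

Lemma coprime24_conductor J : coprime_to_modulus modulus24 J -> coprime_to_modulus f J.
Proof.
move=> [JI [x [y [Jx y24 e]]]]; split=> //; exists x, y; split=> //.
exact: conductor_dvd24.
Qed.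

(** The center is generated by the automorphism that fixes i and negates a, hence
    negates beta: this quadratic character is nontrivial on it. *)
Definition theta_char (J : set L) : algC := if Phi J be == be then 1 else -1.

Lemma be_neqN : be == - be = false.
Proof.
apply/negbTE; rewrite -addr_eq0 -mulr2n -mulr_natl mulf_neq0 //.
  by rewrite -[2%:R]/(2%:~R) intr_eq0L.
rewrite -sqrf_eq0 (be2E a Hi) mulf_neq0 //; first by rewrite -[2%:R]/(2%:~R) intr_eq0L.
by rewrite -sqrf_eq0 (th2z Ha Hi) intr_eq0L.
Qed.

Lemma gal_be s : s \in 'Gal({:L} / K)%g -> s be = be \/ s be = - be.
Proof.
rewrite galK_th => /eqP sth; have : (s be) ^+ 2 == be ^+ 2.
  by rewrite -rmorphXn /= (be2E a Hi) rmorphM /= sth rmorph_nat.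
by rewrite eqf_sqr => /orP[]/eqP; [left|right].
Qed.

Lemma theta_char_class : class_character f Phi theta_char.
Proof.
split=> [J J' rJ rJ'|J rJ h]; last first.
  rewrite /theta_char; suff -> : Phi J = 1%g by rewrite gal_id eqxx.
  by case: h => // pJ; have [[_ _ ad] _] := hf; exact: (ad _ hPhi).
rewrite /theta_char (proj1 hPhi) // gal_mulE.
have [e|e] := gal_be (artin_gal hPhi rJ); rewrite e ?rmorphN /=;
  have [e'|e'] := gal_be (artin_gal hPhi rJ'); rewrite e' ?opprK ?eqxx ?[- be == be]eq_sym ?be_neqN.
- by rewrite mulr1.
- by rewrite mul1r.
- by rewrite mulr1.
- by rewrite mulrNN mulr1.
Qed.

Lemma theta_charE (u m : int) : odd `|u| -> ~~ (3 %| `|u|)%N ->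
  coprime_to_modulus f (principal K (qi u (2 * m))) ->
  theta_char (principal K (qi u (2 * m))) = (jac 6 `|u|)%:~R.
Proof.
move=> ou u3 cu; have [_ _ e] := artin_principal hPhi ou u3 cu.
rewrite /theta_char e jac6 //; case: (_ \in _).
  by rewrite expr1 mulrN1z mulN1r eq_sym be_neqN mulrN1z.
by rewrite expr0 mul1r eqxx.
Qed.

(** The witness is the ideal (7): as (6 / 7) = -1, its Artin symbol fixes i and
    negates a. *)
Lemma theta_char_center : nontrivial_on_center f Phi theta_char.
Proof.
have c7 : coprime_to_modulus f (principal K (qi 7 (2 * 0))).
  apply: coprime24_conductor; split; first exact: (principal_integral th2 OKE q0).
  exists (qi 49 0), (qi (- 48) 0); split.
  - by exists (qi 7 0); [apply: (OKqi OKE)|rewrite (qiM th2)].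
  - by exists (- 2), 0; congr quad_int.
  - by rewrite (qiD th) -(qi1 th).
have act7 : acts (Phi (principal K (qi 7 (2 * 0)))) 1 (jac 6 7).
  exact: (artin_principal hPhi (isT : odd `|7 : int|) (isT : ~~ (3 %| `|7 : int|)%N) c7).
rewrite jac6 // expr1 in act7; have [_ si sb] := act7.
rewrite mul1r in si; rewrite mulN1r in sb.
exists (principal K (qi 7 (2 * 0))); split.
- exact: coprime_ray.
- set s := Phi _ in si sb *; apply/centerP; split; first exact: gal_in1.
  have sa : s a = - a.
    have i1 : 1 + i != 0.
      by apply/eqP => e; move: be_neqN; rewrite /root_2theta e mul0r oppr0 eqxx.
    apply: (mulfI i1); rewrite mulrN -[X in - X]/be -sb /root_2theta.
    by rewrite rmorphM rmorphD rmorph1 /= si.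
  move=> t _; have [j ta] := gal_a Ha Hi t.
  apply: (gal_ext HL); rewrite !gal_mulE.
    by rewrite sa rmorphN /= ta rmorphM rmorphXn /= si sa mulrN.
  by rewrite si; have [ti|ti] := gal_sqrt t (i2z Hi); rewrite ti ?rmorphN /= si.
- rewrite /theta_char sb [- be == be]eq_sym be_neqN -subr_eq0 -opprD oppr_eq0.
  by rewrite -[1 + 1]/(2%:R) pnatr_eq0.
Qed.

(** The shift by n makes the ordinals run through the integers from - n to n. *)
Definition theta_ideal n (x : 'I_n.*2.+1 * 'I_n.*2.+1) : set L :=
  principal K (qi (6 * (x.1%:Z - n%:Z) - 1) (2 * (x.2%:Z - n%:Z))).

(** The equation (6k - 1)^2 + 24 m^2 = 24 n + 1 says that k(3k - 1)/2 + m^2 = n. *)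
Lemma theta_coefE n : theta_coef f theta_char (24 * n + 1) =
  \sum_(k < n.*2.+1) \sum_(m < n.*2.+1)
    (if (pent (k%:Z - n%:Z) + `|m%:Z - n%:Z| ^ 2 == n)%N
     then (-1) ^+ tri_dn (k%:Z - n%:Z) else 0).
Proof.
rewrite (pair_bigA _ (fun k m : 'I_n.*2.+1 => if _ then _ else 0)) /= -big_mkcond /=.
pose good (x : 'I_n.*2.+1 * 'I_n.*2.+1) :=
  (pent (x.1%:Z - n%:Z) + `|x.2%:Z - n%:Z| ^ 2 == n)%N.
have normE (k m : int) : (6 * k - 1) ^+ 2 + 24 * m ^+ 2 = (24 * n + 1)%N <->
    (pent k + `|m| ^ 2 = n)%N.
  have := tri_upE k; have := tri_dnE k; rewrite /pent.
  have -> : (6 * k - 1) ^+ 2 = 12 * (k * (k + 1)) + 24 * (k * (k - 1)) + 1 by ring.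
  move: (k * (k - 1)) (k * (k + 1)) (tri_up k) (tri_dn k) => A B U V eU eV.
  have : m ^+ 2 = (`|m| ^ 2)%N%:Z by lia.
  by move: (m ^+ 2) (`|m| ^ 2)%N => ? ? ->; lia.
have odd6 (k : int) : odd `|(6 * k - 1)%R| /\ ~~ (3 %| `|(6 * k - 1)%R|)%N by clear; lia.
have cop (k m : int) : (6 * k - 1) ^+ 2 + 24 * m ^+ 2 = (24 * n + 1)%N ->
    coprime_to_modulus f (principal K (qi (6 * k - 1) (2 * m))).
  move=> nE; apply: coprime24_conductor; split.
    by apply: (principal_integral th2 OKE q0); apply/orP; left; clear; lia.
  exists (qi (24 * n%:Z + 1) 0), (qi (- (24 * n%:Z)) 0); split.
  - exists (qi (6 * k - 1) (- (2 * m))); first exact: (OKqi OKE).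
    rewrite (qiM th2); congr quad_int; last by ring.
    transitivity ((6 * k - 1) ^+ 2 + 24 * m ^+ 2); first by ring.
    by rewrite nE; lia.
  - by exists (- n%:Z), 0; congr quad_int; ring.
  - by rewrite (qiD th) -(qi1 th); congr quad_int; ring.
have setE : [set J | coprime_to_modulus f J /\ absolute_norm K J = (24 * n + 1)%N]%classic =
    (@theta_ideal n @` [set x | good x])%classic.
  apply/predeqP => J; split=> [[[JI _] nJ]|[x /eqP gx <-]].
    have [k [m [nE eJ]]] := ideal_one_mod24 th2 OKE q0 JI nJ.
    have /eqP gkm := (normE k m).1 nE.
    have kn : (`|k| <= n)%N /\ (`|m| <= n)%N.
      have kp : (`|k| <= pent k)%N := pent_ge k.
      have mm : (`|m| <= `|m| ^ 2)%N by rewrite -mulnn; case: (`|m|)%N => // m'; rewrite leq_pmulr.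
      by move: gkm kp mm; clear; move: (`|m| ^ 2)%N => ? /eqP; lia.
    have kl : (`|(k + n%:Z)%R| < n.*2.+1)%N by lia.
    have ml : (`|(m + n%:Z)%R| < n.*2.+1)%N by lia.
    have ek : (Ordinal kl : nat)%:Z - n%:Z = k by rewrite /= ; lia.
    have em : (Ordinal ml : nat)%:Z - n%:Z = m by rewrite /= ; lia.
    exists (Ordinal kl, Ordinal ml); first by rewrite /= /good ek em.
    by rewrite /theta_ideal ek em eJ.
  have nE := (normE _ _).2 gx; split; first exact: cop.
  rewrite (principal_norm th2 OKE q0); last by apply/orP; left; clear; lia.
  rewrite -[RHS]absz_nat -nE; congr absz; ring.
rewrite /theta_coef setE fsbig_image; last first.
  move=> x y _ _ /(principal_inj th2 OKE q0)[e1 e2].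
  by case: x y e1 e2 => x1 x2 [y1 y2] /= e1 e2; congr (_, _); apply/val_inj => /=; lia.
have -> : [set x | good x]%classic = [set` [seq x <- enum {: 'I_n.*2.+1 * 'I_n.*2.+1} | good x]]%classic.
  by apply/predeqP => x /=; rewrite mem_filter mem_enum andbT.
rewrite -fsbig_seq; last by apply/filter_uniq/enum_uniq.
rewrite big_filter big_enum_cond /=.
apply: eq_bigr => x /eqP gx; have nE := (normE _ _).2 gx.
have [o6 t6] := odd6 (x.1%:Z - n%:Z).
by rewrite /theta_ideal theta_charE ?jac6_sign ?rmorphXn ?rmorphN1 //; apply: cop.
Qed.

End Theta.

End Artin.

Theorem proposition1p3 (L : splittingFieldType rat) (a i : L)
  (Ha : a ^+ 4 = 6%:R) (Hi : i ^+ 2 = -1)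
  (HL : <<<<1; a>>; i>>%VS = {:L}%VS)
  (Theta : nat -> algC)
  (HTheta : is_threefield_theta <<1; i * a ^+ 2>>%AS <<1; i>>%AS <<1; a ^+ 2>>%AS
              Theta)
  (r : nat -> algC)
  (Hr : forall m : nat, q_rho_q24 r m = qseries_part 24 1 Theta m)
  (n : nat) :
  r n = (partitions_even n)%:R - (partitions_odd n)%:R.
Proof.
have [[f [Phi [hf hPhi hTheta]]] _ _] := HTheta.
have rE : r n = Theta (24 * n + 1)%N.
  have := Hr (24 * n + 1)%N; rewrite /q_rho_q24 /qseries_part addn1 /= dvdn_mulr //.
  by rewrite mulKn // -addn1 mulnC modnMDl eqxx.
have cE := theta_char_class Ha Hi hf hPhi.
have ctr := theta_char_center Ha Hi HL hf hPhi.
rewrite rE (hTheta _ cE ctr) (theta_coefE Ha Hi HL hf hPhi).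
transitivity (((partitions_even n)%:R - (partitions_odd n)%:R : int)%:~R : algC).
  rewrite partitions_sum rmorph_sum; apply: eq_bigr => k _.
  rewrite rmorph_sum; apply: eq_bigr => m _ /=.
  by case: ifP => _; rewrite ?rmorphXn ?rmorphN1 ?rmorph0.
by rewrite rmorphB /= !rmorph_nat.
Qed.
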